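(* Let $\alpha\in(0,1)$, $T>0$, let $(a,b)\subseteq\mathbb{R}$ be an open interval (bounded or not), $\Omega_T:=(a,b)\times(0,T)$, let $D$ be a diffusivity as in the context, and let the data $u_0$ (on $(a,b)$) and $\mu,\nu$ (on $(0,T)$) be given. Then there is at most one weak solution of the problem $$\partial_t^\alpha u=(D(u)u_x)_x \text{ in } \Omega_T,\qquad u(x,0)=u_0(x),\qquad u(a,t)=\mu(t),\quad u(b,t)=\nu(t);$$ that is, there is at most one function $u\in H^1(\Omega_T)$ such that $$\int_a^b\int_0^T\Big[(K(u))_x\,\chi_x-u\,\frac{\partial}{\partial t}\big(J_t^{1-\alpha}\chi\big)\Big]dt\,dx=\int_0^T\big[D(\mu(t))\chi(a,t)-D(\nu(t))\chi(b,t)\big]dt-\int_a^b u_0(x)\,(J_t^{1-\alpha}\chi)(x,0)\,dx$$ for every test function $\chi\in C^1(\overline{\Omega_T})$ (of bounded support when $(a,b)$ is unbounded).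
   Context: Diffusivity: $D:[0,\infty)\to[0,\infty)$ is continuous, $C^1$ on $(0,\infty)$, with $D(0)=0$ and $D(u)>0$, $D'(u)>0$ for $u>0$. Put $K(z):=\int_0^z D(s)\,ds$. Solutions take values in $[0,\infty)$ (the domain of $D$). The equation can be written $\partial_t^\alpha u=(K(u))_{xx}$, where $\partial_t^\alpha$ is the Caputo derivative $\partial_t^\alpha u(x,t)=\frac{1}{\Gamma(1-\alpha)}\int_0^t(t-s)^{-\alpha}u_s(x,s)\,ds$. Right-sided fractional integral: for $\beta>0$, $J_t^{\beta}\chi(x,t)=\frac{1}{\Gamma(\beta)}\int_t^T(s-t)^{\beta-1}\chi(x,s)\,ds$. A weak solution is a function $u\in H^1(\Omega_T)$ for which the integrals in the identity make sense and the identity holds for all test functions; the data $u_0,\mu,\nu$ are such that the right-hand side makes sense. If an endpoint $a$ or $b$ is infinite, the corresponding boundary term is omitted. *)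

(* Defs.v *)
From HB Require Import structures.
From mathcomp Require Import all_boot all_order all_algebra.
From mathcomp Require Import all_classical all_reals all_analysis.

Set Implicit Arguments.
Unset Strict Implicit.
Unset Printing Implicit Defensive.

Import Order.TTheory GRing.Theory Num.Theory.
Import numFieldNormedType.Exports.

Local Open Scope classical_set_scope.
Local Open Scope ring_scope.

Notation leb1 := (@lebesgue_measure _).
Notation leb2 := (@lebesgue_measure _ \x @lebesgue_measure _)%E.

(* The endpoints are extended reals, so that the interval may be unbounded. *)
Definition Iab {R : realType} (a b : \bar R) : set R :=
  [set x | (a < x%:E)%E /\ (x%:E < b)%E].

(* Points of the space-time cylinder are pairs (x, t). *)
Definition OmegaT {R : realType} (a b : \bar R) (T : R) : set (R * R) :=
  Iab a b `*` `]0, T[.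

Definition px {R : realType} (f : R * R -> R) (z : R * R) : R :=
  derive1 (fun y => f (y, z.2)) z.1.

Definition pt {R : realType} (f : R * R -> R) (z : R * R) : R :=
  derive1 (fun s => f (z.1, s)) z.2.

Definition has_partials {R : realType} (f : R * R -> R) (z : R * R) : Prop :=
  derivable (fun y => f (y, z.2)) z.1 1 /\ derivable (fun s => f (z.1, s)) z.2 1.

Fixpoint Cn {R : realType} (n : nat) (f : R * R -> R) : Prop :=
  continuous f /\
  if n is m.+1 then (forall z, has_partials f z) /\ Cn m (px f) /\ Cn m (pt f)
  else True.

Definition Cc_infty {R : realType} (O : set (R * R)) (f : R * R -> R) : Prop :=
  (forall n, Cn n f) /\
  exists C : set (R * R), [/\ compact C, C `<=` O & forall z, ~ C z -> f z = 0].

Definition loc_integrable2 {R : realType} (O : set (R * R)) (f : R * R -> R) : Prop :=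
  forall C : set (R * R), compact C -> C `<=` O -> leb2.-integrable C (EFin \o f).

Definition weak_px {R : realType} (O : set (R * R)) (f g : R * R -> R) : Prop :=
  [/\ loc_integrable2 O f, loc_integrable2 O g &
   forall phi, Cc_infty O phi ->
     \int[leb2]_(z in O) (f z * px phi z) = - \int[leb2]_(z in O) (g z * phi z)].

Definition weak_pt {R : realType} (O : set (R * R)) (f g : R * R -> R) : Prop :=
  [/\ loc_integrable2 O f, loc_integrable2 O g &
   forall phi, Cc_infty O phi ->
     \int[leb2]_(z in O) (f z * pt phi z) = - \int[leb2]_(z in O) (g z * phi z)].

Definition L2 {R : realType} (O : set (R * R)) (f : R * R -> R) : Prop :=
  measurable_fun (O : set (measurableTypeR R * measurableTypeR R)) f /\ leb2.-integrable O (fun z => (f z ^+ 2)%:E).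

Definition H1 {R : realType} (O : set (R * R)) (u : R * R -> R) : Prop :=
  L2 O u /\
  exists ux ut, [/\ L2 O ux, L2 O ut, weak_px O u ux & weak_pt O u ut].

(* D is a total function on R; only its values on [0, +oo[ are constrained, and
   only these matter below. *)
Record diffusivity {R : realType} (D : R -> R) : Prop := Diffusivity {
  diff_cont : {within `[0, +oo[, continuous D} ;
  diff_derivable : forall z : R, 0 < z -> derivable D z 1 ;
  diff_cont_deriv : forall z : R, 0 < z -> {for z, continuous (derive1 D)} ;
  diff_at0 : D 0 = 0 ;
  diff_pos : forall z : R, 0 < z -> 0 < D z ;
  diff_deriv_pos : forall z : R, 0 < z -> 0 < derive1 D z }.

Definition Kfun {R : realType} (D : R -> R) (z : R) : R :=
  \int[leb1]_(s in `[0, z]) D s.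

Definition Gamma {R : realType} (p : R) : R :=
  \int[leb1]_(s in `]0, +oo[) (s `^ (p - 1) * expR (- s)).

Definition Jt {R : realType} (T beta : R) (chi : R * R -> R) (z : R * R) : R :=
  (Gamma beta)^-1 *
  \int[leb1]_(s in `]z.2, T[) ((s - z.2) `^ (beta - 1) * chi (z.1, s)).

(* chi and its first partial derivatives on O extend continuously to the
   closure of O; the values of chi outside that closure are irrelevant. *)
Definition C1_closure {R : realType} (O : set (R * R)) (chi : R * R -> R) : Prop :=
  [/\ {within closure O, continuous chi},
      forall z, O z -> has_partials chi z &
      exists cx ct : R * R -> R,
        [/\ {within closure O, continuous cx}, {within closure O, continuous ct} &
            forall z, O z -> cx z = px chi z /\ ct z = pt chi z]].

(* The support condition holds automatically when a and b are finite. *)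
Definition test_fun {R : realType} (a b : \bar R) (T : R) (chi : R * R -> R) : Prop :=
  C1_closure (OmegaT a b T) chi /\
  exists M : R, forall z, OmegaT a b T z -> M < `|z.1| -> chi z = 0.

Definition endpoint_term {R : realType} (D : R -> R) (c : \bar R) (m : R -> R)
    (chi : R * R -> R) (t : R) : R :=
  if c is r%:E then D (m t) * chi (r, t) else 0.

Definition boundary_integrand {R : realType} (D : R -> R) (a b : \bar R)
    (mu nu : R -> R) (chi : R * R -> R) (t : R) : R :=
  endpoint_term D a mu chi t - endpoint_term D b nu chi t.

(* The boundary data at a finite endpoint must lie in the domain of D, and the
   integrals on the right-hand side of the weak identity must exist. *)
Record admissible_data {R : realType} (alpha T : R) (a b : \bar R) (D : R -> R)
    (u0 mu nu : R -> R) : Prop := AdmissibleData {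
  data_mu : a \is a fin_num -> {ae leb1, forall t, t \in `]0, T[ -> 0 <= mu t} ;
  data_nu : b \is a fin_num -> {ae leb1, forall t, t \in `]0, T[ -> 0 <= nu t} ;
  data_boundary : forall chi, test_fun a b T chi ->
    leb1.-integrable `]0, T[ (EFin \o boundary_integrand D a b mu nu chi) ;
  data_initial : forall chi, test_fun a b T chi ->
    leb1.-integrable (Iab a b) (fun x => (u0 x * Jt T (1 - alpha) chi (x, 0))%:E) }.

Definition weak_integrand {R : realType} (alpha T : R) (u Kux chi : R * R -> R)
    (z : R * R) : R :=
  Kux z * px chi z - u z * pt (Jt T (1 - alpha) chi) z.

(* Kux is the weak derivative (K(u))_x, unique up to null sets. The integral over
   OmegaT is the integral for the product measure, equal by Fubini to the
   iterated integral since the integrand is required to be integrable. *)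
Definition weak_solution {R : realType} (alpha T : R) (a b : \bar R) (D : R -> R)
    (u0 mu nu : R -> R) (u : R * R -> R) : Prop :=
  [/\ H1 (OmegaT a b T) u,
      {ae leb2, forall z, OmegaT a b T z -> 0 <= u z} &
      exists Kux : R * R -> R,
        weak_px (OmegaT a b T) (Kfun D \o u) Kux /\
        forall chi, test_fun a b T chi ->
          leb2.-integrable (OmegaT a b T) (EFin \o weak_integrand alpha T u Kux chi) /\
          \int[leb2]_(z in OmegaT a b T) weak_integrand alpha T u Kux chi z =
          (\int[leb1]_(t in `]0, T[) boundary_integrand D a b mu nu chi t)
          - (\int[leb1]_(x in Iab a b) (u0 x * Jt T (1 - alpha) chi (x, 0)))].

(* Main.v *)
Require Import Defs.
From HB Require Import structures.
From mathcomp Require Import all_boot all_order all_algebra.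
From mathcomp Require Import all_classical all_reals all_analysis.
From mathcomp Require Import measurable_realfun ring lra.

Import Order.TTheory GRing.Theory Num.Theory.
Import numFieldNormedType.Exports.

Local Open Scope classical_set_scope.
Local Open Scope ring_scope.

Set Implicit Arguments.
Unset Strict Implicit.
Unset Printing Implicit Defensive.

(** Let [u] be the difference of two solutions, [v] the difference of their
    potentials [K(u1)] and [K(u2)], and [V] the weak space derivative of [v]. Since
    [K] is increasing, [u * v] is nonnegative and vanishes only where the solutions
    agree, so it suffices to show that its integral over the cylinder is zero.

    Let [W] be the left-sided fractional integral of order [alpha] of [V] in time.
    Applied to the equation, this integral turns the Caputo derivative into the
    identity, so that formally [v_x = V] and [W_x = c * u] with a positive constant
    [c]. The energy [F(x) = \int v(x, t) * W(x, t) dt] then satisfies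
    [F'(x) = \int V * W dt + c * \int u * v dt]. The first term is nonnegative because
    the kernel [t^(alpha - 1)] is positive definite ([frac_kernel_ge0]): by the Riesz
    composition formula [kpow_riesz] it is a superposition of products of one-sided
    kernels. At a finite endpoint [W] vanishes, by the boundary condition. Towards an
    infinite endpoint [F] comes close to zero on a sequence of points, because the
    solutions are dominated by a function [m(x)] of the space variable that is square
    integrable ([H1_dominated]). Hence [F] has no room to grow, and the integral of
    [u * v] is zero ([energy_zero]).

    The integral of [V * W] need not converge, as [V] is only known to be integrable.
    The positivity is therefore applied to the increments of [v], which are bounded in
    time. This gives the lower bound for the increments of [F] up to an error that is a
    product of two increments of functions of [x], and such an error disappears under
    repeated subdivision ([quadratic_monotone]).

    The two formal equations are made precise on slices: outside of a null set of
    points [x], increments of [v] and [W] in [x] are integrals of [V] and [c * u]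
    ([weak_slices]). For [W] the weak formulation is tested with a product of a cutoff
    in space and a right-sided fractional integral [eta] of a cutoff in time; the
    fractional integral of order [1 - alpha] in the weak formulation then composes
    with [eta] to a plain integral ([pt_Jt_tensor]). The resulting identity
    ([weak_difference]) does not see the data, nor the endpoints, since its test
    functions do not have to vanish there. The integrability that is part of the weak
    formulation makes [V] integrable up to the lateral boundary, but only up to times
    [S < T]; so the argument is carried out on shortened cylinders ([truncated_eq]),
    which exhaust the whole cylinder ([solutions_eq]). *)

(** Functions are extended by zero off their domain, so that integrability is only
    ever asked over the whole space. *)
Notation ibl mu f := (integrable mu setT (EFin \o f)).

(** * Integrals of real-valued functions *)

Section integral_tools.
Context d (T : measurableType d) (R : realType).
Variable mu : {measure set T -> \bar R}.
Implicit Types f g : T -> R.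

Lemma ae_imp (P Q : T -> Prop) : (forall x, P x -> Q x) ->
  {ae mu, forall x, P x} -> {ae mu, forall x, Q x}.
Proof. by move=> PQ; apply: filterS. Qed.

Lemma ae_and (P Q : T -> Prop) : {ae mu, forall x, P x} -> {ae mu, forall x, Q x} ->
  {ae mu, forall x, P x /\ Q x}.
Proof. by apply: filterS2. Qed.

Lemma ibl_mfun f : ibl mu f -> measurable_fun setT f.
Proof. by move=> /integrableP[mf _]; exact/measurable_EFinP. Qed.

Lemma ibl_le_ae f g : measurable_fun setT f -> {ae mu, forall x, `|f x| <= g x} ->
  ibl mu g -> ibl mu f.
Proof.
move=> mf fg /integrableP[mg gi]; apply/integrableP; split; first exact/measurable_EFinP.
rewrite (le_lt_trans _ gi)//; apply: ae_ge0_le_integral => //=.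
- by apply/measurable_EFinP; apply: measurableT_comp.
- by apply/measurable_EFinP; apply: measurableT_comp => //; exact/measurable_EFinP.
by apply: filterS fg => x fgx _; rewrite lee_fin (le_trans fgx)// ler_norm.
Qed.

Lemma ibl_le g f : measurable_fun setT f -> (forall x, `|f x| <= g x) ->
  ibl mu g -> ibl mu f.
Proof. by move=> mf fg; apply: ibl_le_ae mf _; exact: nearW. Qed.

Lemma ibl_mulb M g f : measurable_fun setT g -> (forall x, `|g x| <= M) ->
  ibl mu f -> ibl mu (fun x => g x * f x).
Proof.
move=> mg gM fi; apply: (@ibl_le (fun x => M * `|f x|)).
- by apply: measurable_funM => //; exact: ibl_mfun fi.
- by move=> x; rewrite normrM ler_wpM2r.
- by apply: (integrableZl measurableT M (integrable_norm fi)).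
Qed.

Lemma ibl_norm f : ibl mu f -> ibl mu (fun x => `|f x|).
Proof. exact: integrable_norm. Qed.

Lemma iblD f g : ibl mu f -> ibl mu g -> ibl mu (fun x => f x + g x).
Proof. by move=> fi gi; exact: (integrableD measurableT fi gi). Qed.

Lemma iblB f g : ibl mu f -> ibl mu g -> ibl mu (fun x => f x - g x).
Proof. by move=> fi gi; exact: (integrableB measurableT fi gi). Qed.

Lemma iblZ k f : ibl mu f -> ibl mu (fun x => k * f x).
Proof. by move=> fi; exact: (integrableZl measurableT k fi). Qed.

Lemma ibl_ae f g : ibl mu f -> measurable_fun setT g ->
  {ae mu, forall x, f x = g x} -> ibl mu g.
Proof.
move=> /ibl_norm fi mg fg; apply: (ibl_le_ae mg _ fi).
by apply: filterS fg => x ->.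
Qed.

Lemma Rint_ae f g : measurable_fun setT f -> measurable_fun setT g ->
  {ae mu, forall x, f x = g x} -> \int[mu]_x f x = \int[mu]_x g x.
Proof.
move=> mf mg fg; congr fine; apply: ae_eq_integral => //.
- exact/measurable_EFinP.
- exact/measurable_EFinP.
by apply: filterS fg => x -> _.
Qed.

Lemma Rint_le_ae f g : ibl mu f -> ibl mu g ->
  {ae mu, forall x, f x <= g x} -> \int[mu]_x f x <= \int[mu]_x g x.
Proof.
move=> fi gi fg.
rewrite (@Rint_ae g (fun x => Num.max (f x) (g x))); last first.
- by apply: filterS fg => x fg; rewrite max_r.
- by apply: measurable_maxr; exact: ibl_mfun.
- exact: ibl_mfun gi.
apply: le_Rintegral => //.
- apply: (ibl_ae gi).
    by apply: measurable_maxr; exact: ibl_mfun.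
  by apply: filterS fg => x fg; rewrite max_r.
- by move=> x _; rewrite le_max lexx.
Qed.

Lemma Rint_norm_le f g : ibl mu f -> ibl mu g ->
  {ae mu, forall x, `|f x| <= g x} -> `|\int[mu]_x f x| <= \int[mu]_x g x.
Proof.
move=> fi gi fg; apply: (le_trans (le_normr_Rintegral measurableT fi)).
by apply: Rint_le_ae => //; exact: ibl_norm.
Qed.

Lemma Rint_eq0_ae f : ibl mu f -> {ae mu, forall x, 0 <= f x} ->
  \int[mu]_x f x = 0 -> {ae mu, forall x, f x = 0}.
Proof.
move=> fi f0 i0; have mf := ibl_mfun fi.
have : \int[mu]_x `|f x| = 0.
  rewrite -[RHS]i0; apply: Rint_ae => //; first exact: measurableT_comp.
  by apply: filterS f0 => x f0; rewrite ger0_norm.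
move=> i0'.
have : (\int[mu]_x `|(EFin \o f) x| = 0)%E.
  have fin : (\int[mu]_x (`|f x|)%:E)%E \is a fin_num.
    by apply: integrable_fin_num => //; exact: ibl_norm fi.
  by rewrite -[LHS](fineK fin); congr EFin.
move/(ae_eq_integral_abs _ measurableT _).1 => H.
have /H : measurable_fun setT (EFin \o f) by exact/measurable_EFinP.
by apply: filterS => x /(_ I)/= [].
Qed.

Lemma ibl_patch (A : set T) f : measurable A ->
  mu.-integrable A (EFin \o f) -> ibl mu (f \_ A).
Proof. by move=> mA; rewrite -restrict_EFin => /(integrable_mkcond _ mA). Qed.

Lemma ibl_unpatch (A : set T) f : measurable A ->
  ibl mu (f \_ A) -> mu.-integrable A (EFin \o f).
Proof. by move=> mA; rewrite -restrict_EFin => /(integrable_mkcond _ mA). Qed.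

Lemma ibl_fine (F : T -> \bar R) : mu.-integrable setT F -> ibl mu (fun x => fine (F x)).
Proof.
move=> Fi; apply: (le_integrable _ _ _ Fi) => //.
  apply/measurable_EFinP; apply: (@measurableT_comp _ _ _ _ _ _ fine) => //.
  exact: measurable_int Fi.
by move=> x _ /=; case: (F x) => //=; rewrite ?normr0 ?leey.
Qed.

Lemma Rint_dominated (f_ : nat -> T -> R) f g :
  (forall n, measurable_fun setT (f_ n)) -> measurable_fun setT f ->
  {ae mu, forall x, f_ ^~ x @ \oo --> f x} ->
  ibl mu g -> (forall n, {ae mu, forall x, `|f_ n x| <= g x}) ->
  (fun n => \int[mu]_x f_ n x) @ \oo --> \int[mu]_x f x.
Proof.
move=> mf_ mf ff gi fg.
have [fi _ cv] := @dominated_convergence _ T R mu setT measurableT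
  (fun n => EFin \o f_ n) (EFin \o f) (EFin \o g)
  (fun n => (measurable_EFinP _ _).2 (mf_ n)) ((measurable_EFinP _ _).2 mf)
  ltac:(by apply: filterS ff => x ff _; apply: cvg_EFin ff; exact: nearW) gi
  ltac:(by have /ae_foralln := fg; apply: filterS => x fg' n _; rewrite /= lee_fin).
apply: fine_cvg; rewrite fineK; last exact: integrable_fin_num.
exact: cv.
Qed.

End integral_tools.

Section fubini_tools.
Context d1 d2 (T1 : measurableType d1) (T2 : measurableType d2) (R : realType).
Variable m1 : {sigma_finite_measure set T1 -> \bar R}.
Variable m2 : {sigma_finite_measure set T2 -> \bar R}.
Implicit Types f : T1 * T2 -> R.

Lemma mfun_sec1 f x : measurable_fun setT f -> measurable_fun setT (fun y => f (x, y)).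
Proof. by move=> mf; exact: measurableT_comp. Qed.

Lemma mfun_sec2 f y : measurable_fun setT f -> measurable_fun setT (fun x => f (x, y)).
Proof. by move=> mf; exact: measurableT_comp. Qed.

Lemma ibl_sec1 f : ibl (m1 \x m2)%E f -> {ae m1, forall x, ibl m2 (fun y => f (x, y))}.
Proof. exact: ae_integrable1. Qed.

Lemma ibl_sec2 f : ibl (m1 \x m2)%E f -> {ae m2, forall y, ibl m1 (fun x => f (x, y))}.
Proof. exact: ae_integrable2. Qed.

Lemma Rint12 f : ibl (m1 \x m2)%E f ->
  \int[m1]_x (\int[m2]_y f (x, y)) = \int[(m1 \x m2)%E]_z f z.
Proof.
move=> fi; rewrite /Rintegral -(integral12_prod_meas1 fi); congr fine.
apply: ae_eq_integral => //.
- apply/measurable_EFinP; apply: (@measurableT_comp _ _ _ _ _ _ fine) => //.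
  exact: measurable_fubini_F fi.
- exact: measurable_fubini_F fi.
apply: filterS (ibl_sec1 fi) => x ix _; rewrite fineK//.
exact: integrable_fin_num.
Qed.

Lemma Rint21 f : ibl (m1 \x m2)%E f ->
  \int[m2]_y (\int[m1]_x f (x, y)) = \int[(m1 \x m2)%E]_z f z.
Proof.
move=> fi; rewrite /Rintegral -(integral21_prod_meas1 fi); congr fine.
apply: ae_eq_integral => //.
- apply/measurable_EFinP; apply: (@measurableT_comp _ _ _ _ _ _ fine) => //.
  exact: measurable_fubini_G fi.
- exact: measurable_fubini_G fi.
apply: filterS (ibl_sec2 fi) => x ix _; rewrite fineK//.
exact: integrable_fin_num.
Qed.

Lemma ibl_F f : ibl (m1 \x m2)%E f -> ibl m1 (fun x => \int[m2]_y f (x, y)).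
Proof. by move=> fi; have /ibl_fine := integrable_fubini_F fi. Qed.

Lemma ibl_G f : ibl (m1 \x m2)%E f -> ibl m2 (fun y => \int[m1]_x f (x, y)).
Proof.
move=> fi; apply: ibl_fine; have mf := ibl_mfun fi.
apply/integrableP; split; first exact: measurable_fubini_G fi.
have := (integrable21ltyP m1 m2 ((measurable_EFinP _ _).2 mf)).1 fi.
apply: le_lt_trans; apply: ge0_le_integral => //=.
- by apply: measurableT_comp => //; exact: (measurable_fubini_G fi).
- apply: (measurable_fun_fubini_tonelli_G (fun z => (`|f z|)%:E)) => //.
  by apply/measurable_EFinP; exact: measurableT_comp.
- move=> y _; apply: le_abse_integral => //.
  by apply/measurable_EFinP; exact: mfun_sec2.
Qed.

Lemma measurable_norm_int f : measurable_fun setT f ->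
  measurable_fun setT (fun x => \int[m2]_t `|f (x, t)|).
Proof.
move=> mf; apply: (@measurableT_comp _ _ _ _ _ _ fine) => //.
apply: (measurable_fun_fubini_tonelli_F (fun z => (`|f z|)%:E)) => //.
by apply/measurable_EFinP; exact: measurableT_comp.
Qed.

(** Tonelli's criterion. The bound on the inner integrals is only asked almost
    everywhere, as the slices of weak solutions are only controlled there. *)
Lemma tonelli_ibl_ae f (g : T1 -> R) : measurable_fun setT f -> ibl m1 g ->
  {ae m1, forall x, (\int[m2]_y (`|f (x, y)|)%:E <= (g x)%:E)%E} -> ibl (m1 \x m2)%E f.
Proof.
move=> mf gi fg; apply/integrable12ltyP; first exact/measurable_EFinP.
have /integrableP[mg] := gi; apply: le_lt_trans.
apply: ae_ge0_le_integral => //=.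
- by move=> x _; exact: integral_ge0.
- apply: (measurable_fun_fubini_tonelli_F (fun z => (`|f z|)%:E)) => //.
  by apply/measurable_EFinP; exact: measurableT_comp.
- by apply/measurable_EFinP; apply: measurableT_comp => //; exact: ibl_mfun gi.
by apply: filterS fg => x fgx _; rewrite (le_trans fgx)// lee_fin ler_norm.
Qed.

Lemma tonelli_ibl f (g : T1 -> R) : measurable_fun setT f -> ibl m1 g ->
  (forall x, (\int[m2]_y (`|f (x, y)|)%:E <= (g x)%:E)%E) -> ibl (m1 \x m2)%E f.
Proof. by move=> mf gi fg; apply: (tonelli_ibl_ae mf gi); exact: nearW. Qed.

Lemma ibl_prod (f : T1 -> R) (g : T2 -> R) : ibl m1 f -> ibl m2 g ->
  ibl (m1 \x m2)%E (fun z => f z.1 * g z.2).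
Proof.
move=> fi gi; apply: (@tonelli_ibl _ (fun x => (\int[m2]_y `|g y|) * `|f x|)).
- apply: measurable_funM.
    by apply: measurableT_comp => //; exact: ibl_mfun fi.
  by apply: measurableT_comp => //; exact: ibl_mfun gi.
- by apply: iblZ; exact: ibl_norm.
move=> x; under eq_integral do rewrite /= normrM EFinM.
rewrite integralZl//; last exact: (ibl_norm gi).
rewrite mulrC EFinM /Rintegral fineK//.
by apply: integrable_fin_num => //; exact: (ibl_norm gi).
Qed.

(** Slicing in the other direction defines a measure with the same values on
    rectangles. *)
Lemma prod_meas2E (N : set (T1 * T2)) : measurable N ->
  ((m1 \x m2) N = \int[m2]_y m1 (ysection N y))%E.
Proof.
move=> mN; transitivity ((m1 \x^ m2)%E N) => //.
by apply: product_measure_unique => //= A B mA mB; rewrite product_measure2E.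
Qed.

(** The measure of the exceptional set is the integral of the measures of its
    slices, which is available because the set is measurable. *)
Lemma prod_ae1 (A : set (T1 * T2)) : measurable A ->
  {ae m1, forall x, {ae m2, forall y, A (x, y)}} ->
  {ae (m1 \x m2)%E, forall z, A z}.
Proof.
move=> mA h; exists (~` A); split => //; first exact: measurableC.
have mX : measurable_fun setT (m2 \o xsection (~` A)).
  by apply: measurable_fun_xsection; exact: measurableC.
rewrite /product_measure1/=.
transitivity (\int[m1]_x `|(m2 \o xsection (~` A)) x|)%E.
  by apply: eq_integral => x _; rewrite gee0_abs.
apply/ae_eq_integral_abs => //; apply: filterS h => x [N [mN N0 AN]] _ /=.
apply: (subset_measure0 _ mN _ N0).
  by apply: measurable_xsection; exact: measurableC.
by move=> y; rewrite /xsection/= inE => /AN.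
Qed.

Lemma prod_ae2 (A : set (T1 * T2)) : measurable A ->
  {ae m2, forall y, {ae m1, forall x, A (x, y)}} ->
  {ae (m1 \x m2)%E, forall z, A z}.
Proof.
move=> mA h; exists (~` A); split => //; first exact: measurableC.
have mX : measurable_fun setT (m1 \o ysection (~` A)).
  by apply: measurable_fun_ysection; exact: measurableC.
rewrite prod_meas2E; last exact: measurableC.
transitivity (\int[m2]_x `|(m1 \o ysection (~` A)) x|)%E.
  by apply: eq_integral => x _; rewrite gee0_abs.
apply/ae_eq_integral_abs => //; apply: filterS h => x [N [mN N0 AN]] _ /=.
apply: (subset_measure0 _ mN _ N0).
  by apply: measurable_ysection; exact: measurableC.
by move=> y; rewrite /ysection/= inE => /AN.
Qed.

End fubini_tools.

Section swap.
Context d1 d2 (T1 : measurableType d1) (T2 : measurableType d2) (R : realType).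
Variable m1 : {sigma_finite_measure set T1 -> \bar R}.
Variable m2 : {sigma_finite_measure set T2 -> \bar R}.
Variable f : T1 * T2 -> R.
Hypothesis fi : ibl (m1 \x m2)%E f.

Lemma ibl_swap : ibl (m2 \x m1)%E (fun z => f (z.2, z.1)).
Proof.
have mf := ibl_mfun fi.
have mfs : measurable_fun setT (fun z : T2 * T1 => f (z.2, z.1)).
  apply: measurableT_comp => //.
  exact: measurable_fun_pair.
apply/integrable12ltyP; first exact/measurable_EFinP.
by have /integrable21ltyP := fi; apply; exact/measurable_EFinP.
Qed.

Lemma Rint_swap : \int[(m2 \x m1)%E]_z f (z.2, z.1) = \int[(m1 \x m2)%E]_z f z.
Proof. by rewrite -(Rint12 ibl_swap) (Rint21 fi). Qed.

End swap.

(** * Changes of variable *)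

Section plane_measure.
Context {R : realType}.
Local Notation leb := (@lebesgue_measure R).
Local Open Scope ereal_scope.

Let sfin : sigma_finite setT (leb \x leb).
Proof.
pose F n : set R := [set` `[- n%:R, n%:R]%R].
exists (fun n => F n `*` F n).
  apply/esym/seteqP; split => // z _.
  exists (Num.truncn (Num.max `|z.1| `|z.2|)%R).+1 => //.
  have := truncnS_gt (Num.max `|z.1| `|z.2|)%R; rewrite gt_max => /andP[h1 h2].
  by split; rewrite /F /= in_itv/= -ler_norml ltW.
move=> n; have Foo : leb (F n) < +oo.
  by rewrite /F lebesgue_measure_itv/=; case: ifP => _; rewrite -?EFinB ltry.
split; first by apply: measurableX; exact: measurable_itv.
by rewrite product_measure1E ?lte_mul_pinfty ?ge0_fin_numE//; exact: measurable_itv.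
Qed.

(** Lebesgue measure of the plane as a sigma-finite measure, so that it can be
    multiplied by Lebesgue measure once more. *)
Definition plane_measure :
    {sigma_finite_measure set (measurableTypeR R * measurableTypeR R)%type -> \bar R} :=
  HB.pack (leb \x leb) (Measure_isSigmaFinite.Build _ _ _ (leb \x leb) sfin).

End plane_measure.

Section affine.
Context {R : realType}.
Local Notation leb := (@lebesgue_measure R).
Local Open Scope ereal_scope.

Let aff (k b : R) : measurableTypeR R -> measurableTypeR R := fun x => (k * x + b)%R.

Let maff k b : measurable_fun setT (aff k b).
Proof. by apply: measurable_funD => //; exact: measurable_funM. Qed.

Let leb_affine (k b : R) : (0 < k)%R -> forall A, measurable A ->
  leb A = k%:E * leb (aff k b @^-1` A).
Proof.
move=> k0 A mA.
pose kk : {nonneg R} := NngNum (ltW k0).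
pose phi : {mfun _ >-> _} := HB.pack (aff k b) (isMeasurableFun.Build _ _ _ _ _ (maff k b)).
have := @lebesgue_measure_unique R (mscale kk (pushforward leb phi)).
apply => // _ [[c d]] _ <-.
transitivity (k%:E * leb (aff k b @^-1` [set` `]c, d]%R])) => //=.
rewrite /aff (_ : _ @^-1` _ = [set` `](c - b) / k, (d - b) / k]%R]); last first.
  apply/seteqP; split => x /=; rewrite !in_itv/= ltr_pdivrMr// ler_pdivlMr//;
    by rewrite ltrBlDr lerBrDr ![(x * k)%R]mulrC.
rewrite !lebesgue_measure_itv/= !lte_fin ltr_pM2r ?invr_gt0//.
rewrite ltrD2r; case: ifPn => _; last by rewrite mule0.
by rewrite -!EFinB -EFinM; congr EFin; field; rewrite gt_eqF.
Qed.

(** The image measure is identified on half-open intervals, which determine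
    Lebesgue measure. *)
Lemma ge0_integral_affine (k b : R) (F : R -> \bar R) : (0 < k)%R ->
  measurable_fun [set: R] F -> (forall x, 0 <= F x) ->
  \int[leb]_x F x = k%:E * \int[leb]_x F (k * x + b)%R.
Proof.
move=> k0 mF F0.
pose kk : {nonneg R} := NngNum (ltW k0).
have mphi := maff k b.
pose nu_ := mscale kk (pushforward leb (aff k b)) : {measure set (measurableTypeR R) -> \bar R}.
pose nu := nu_ mphi.
transitivity (\int[nu]_x F x).
  by apply: eq_measure_integral => A mA _; exact: leb_affine.
rewrite ge0_integral_mscale//; congr (_ * _).
by rewrite ge0_integral_pushforward.
Qed.

Lemma ge0_integral_opp (F : R -> \bar R) :
  measurable_fun [set: R] F -> (forall x, 0 <= F x) ->
  \int[leb]_x F x = \int[leb]_x F (- x)%R.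
Proof.
move=> mF F0.
pose nu_ := pushforward leb (-%R : measurableTypeR R -> measurableTypeR R)
     : {measure set (measurableTypeR R) -> \bar R}.
pose nu := nu_ (@oppr_measurable R setT).
transitivity (\int[nu]_x F x).
  by apply: eq_measure_integral => A mA _; apply/esym/lebesgue_measureN.
by rewrite ge0_integral_pushforward.
Qed.

Lemma ge0_integral_shift (b : R) (F : R -> \bar R) :
  measurable_fun [set: R] F -> (forall x, 0 <= F x) ->
  \int[leb]_x F (x + b)%R = \int[leb]_x F x.
Proof.
move=> mF F0; rewrite [RHS](@ge0_integral_affine 1 b)// mul1e.
by apply: eq_integral => x _; rewrite mul1r.
Qed.

Lemma ge0_integral_reflect (b : R) (F : R -> \bar R) :
  measurable_fun [set: R] F -> (forall x, 0 <= F x) ->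
  \int[leb]_x F (b - x)%R = \int[leb]_x F x.
Proof.
move=> mF F0; rewrite -[RHS](ge0_integral_shift b)// [RHS]ge0_integral_opp.
- by apply: eq_integral => x _; rewrite addrC.
- by apply: measurableT_comp => //; exact: measurable_funD.
- by move=> x; exact: F0.
Qed.

Lemma ibl_shift (b : R) (f : R -> R) : ibl leb f -> ibl leb (fun x => f (x + b)%R).
Proof.
move=> fi; have mf := ibl_mfun fi; apply/integrableP; split.
  apply/measurable_EFinP; apply: measurableT_comp => //; exact: measurable_funD.
have /integrableP[_] := fi.
by rewrite -(ge0_integral_shift b)//; apply: measurableT_comp => //; exact/measurable_EFinP.
Qed.

Lemma ibl_reflect (b : R) (f : R -> R) : ibl leb f -> ibl leb (fun x => f (b - x)%R).
Proof.
move=> fi; have mf := ibl_mfun fi; apply/integrableP; split.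
  apply/measurable_EFinP; apply: measurableT_comp => //; exact: measurable_funB.
have /integrableP[_] := fi.
by rewrite -(ge0_integral_reflect b)//; apply: measurableT_comp => //; exact/measurable_EFinP.
Qed.

End affine.

(** * Power kernels and the positivity of fractional integrals *)

Section powers.
Context {R : realType}.
Local Notation leb := (@lebesgue_measure R).
Implicit Types (p c y : R).

Lemma continuous_powR p y : 0 < y -> {for y, continuous (fun x : R => x `^ p)}.
Proof.
move=> y0; apply: differentiable_continuous; apply/derivable1_diffP.
by apply: derivable_powR; rewrite in_itv/= y0.
Qed.

Let pow_prim p y : p != -1 -> 0 < y ->
  is_derive y 1 (fun x => (p + 1)^-1 * x `^ (p + 1)) (y `^ p).
Proof.
move=> p1 y0; have p10 : p + 1 != 0 by rewrite addr_eq0.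
have h := is_deriveZ (p + 1)^-1 (is_derive1_powR (p + 1) y0).
apply: (is_derive_eq h).
by rewrite addrK; change (((p + 1)^-1 : R) * ((p + 1) * y `^ p) = y `^ p); rewrite mulKf.
Qed.

Lemma integral_pow_lt p (e c : R) : -1 < p -> 0 < e -> e < c ->
  (\int[leb]_(y in `[e, c]) (y `^ p)%:E <= ((p + 1)^-1 * c `^ (p + 1))%:E)%E.
Proof.
move=> p1 e0 ec; have pN1 : p != -1 by rewrite gt_eqF.
have p10 : 0 < p + 1 by lra.
rewrite (@continuous_FTC2 _ _ (fun x => (p + 1)^-1 * x `^ (p + 1)))//.
- rewrite -EFinB lee_fin lerBlDr lerDl mulr_ge0 ?powR_ge0// invr_ge0; lra.
- apply: continuous_in_subspaceT => x /set_mem/=; rewrite in_itv/= => /andP[ex _].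
  by apply: continuous_powR; lra.
- have cont x : 0 < x -> {for x, continuous (fun x => (p + 1)^-1 * x `^ (p + 1))}.
    move=> x0; apply: differentiable_continuous; apply/derivable1_diffP.
    by have := pow_prim pN1 x0 => -[].
  split.
  + move=> x; rewrite in_itv/= => /andP[ex _].
    by have /(pow_prim pN1) [] : 0 < x by lra.
  + by apply: cvg_at_right_filter; exact: cont.
  + by apply: cvg_at_left_filter; apply: cont; lra.
- move=> x; rewrite in_itv/= => /andP[ex _].
  have x0 : 0 < x by lra.
  have h := pow_prim pN1 x0.
  by rewrite derive1E (@derive_val _ _ _ _ _ _ _ h).
Qed.

(** Monotone convergence over intervals away from the singularity, where the
    primitive is differentiable. *)
Lemma integral_pow0_lty p c : -1 < p -> 0 < c ->
  (\int[leb]_(y in `]0%R, c]) (y `^ p)%:E < +oo)%E.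
Proof.
move=> p1 c0.
pose F (n : nat) : set R := `[c / n.+2%:R, c]%classic.
have FE : \bigcup_i F i = `]0, c]%classic.
  apply/seteqP; split => [x [n _]|x]; rewrite /F/= !in_itv/= => /andP[h1 h2].
    by rewrite h2 andbT (lt_le_trans _ h1)// divr_gt0.
  exists (Num.truncn (c / x)) => //=.
  rewrite in_itv/= h2 andbT ler_pdivrMr// mulrC -ler_pdivrMr//.
  apply: ltW; apply: (lt_trans (truncnS_gt (c / x))).
  by rewrite ltr_nat.
have cv : ((\int[leb]_(y in F n) (y `^ p)%:E) @[n --> \oo] -->
    \int[leb]_(y in \bigcup_i F i) (y `^ p)%:E)%E.
  apply: ge0_nondecreasing_set_cvg_integral => //.
  - apply/nondecreasing_seqP => n; apply/subsetPset => x; rewrite /F/= !in_itv/=.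
    move=> /andP[h1 ->]; rewrite andbT (le_trans _ h1)//.
    by rewrite ler_pM2l// lef_pV2 ?posrE// ler_nat.
  - move=> n; exact: measurable_itv.
  - by move=> n; apply/measurable_EFinP; apply: measurable_funTS; exact: measurable_powR.
  - by move=> n x _; rewrite lee_fin powR_ge0.
rewrite -FE; apply: (@le_lt_trans _ _ ((p + 1)^-1 * c `^ (p + 1))%:E); last exact: ltry.
rewrite -(cvg_lim _ cv)//; apply: lime_le; first by apply/cvg_ex; eexists; exact: cv.
apply: nearW => n; apply: integral_pow_lt => //; first by rewrite divr_gt0.
by rewrite ltr_pdivrMr// ltr_pMr// ltr1n.
Qed.

Lemma integral_powy_lty p : p < -1 ->
  (\int[leb]_(y in `[1%R, +oo[) (y `^ p)%:E < +oo)%E.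
Proof.
move=> p1; have pN1 : p != -1 by rewrite lt_eqF.
have cont x : 0 < x -> {for x, continuous (fun x => (p + 1)^-1 * x `^ (p + 1))}.
  move=> x0; apply: differentiable_continuous; apply/derivable1_diffP.
  by have := pow_prim pN1 x0 => -[].
rewrite (@ge0_continuous_FTC2y _ _ (fun x => (p + 1)^-1 * x `^ (p + 1)) _ 0).
- by rewrite -EFinB ltry.
- by move=> x _; exact: powR_ge0.
- apply: continuous_in_subspaceT => x /set_mem/=; rewrite in_itv/= andbT => x1.
  by apply: continuous_powR; lra.
- rewrite -[X in _ --> X](mulr0 (p + 1)^-1); apply: cvgM; first exact: cvg_cst.
  have -> : (fun x : R => x `^ (p + 1)) = (fun x => (x `^ (- (p + 1)))^-1).
    by apply/funext => x; rewrite -powRN opprK.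
  apply/gtr0_cvgV0.
    by near=> x; rewrite powR_gt0//; near: x; exact: nbhs_pinfty_gt.
  apply/cvgryPge => A; near=> x.
  have q0 : 0 < - (p + 1) by lra.
  have B1 : 1 <= Num.max 1 A by rewrite le_max lexx.
  have B0 : 0 <= Num.max 1 A by rewrite (le_trans _ B1).
  rewrite (@le_trans _ _ (Num.max 1 A))// ?le_max ?lexx ?orbT//.
  have -> : Num.max 1 A = (Num.max 1 A `^ (- (p + 1))^-1) `^ (- (p + 1)).
    by rewrite -powRrM mulVf ?gt_eqF// powRr1.
  have xB : Num.max 1 A `^ (- (p + 1))^-1 <= x.
    by near: x; exact: nbhs_pinfty_ge.
  apply: ge0_ler_powR => //; first exact: ltW.
    by rewrite nnegrE powR_ge0.
  by rewrite nnegrE (le_trans _ xB)// powR_ge0.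
- move=> x x1; have x0 : 0 < x by lra.
  by have [] := pow_prim pN1 x0.
- by apply: cvg_at_right_filter; apply: cont.
- move=> x; rewrite in_itv/= andbT => x1; have x0 : 0 < x by lra.
  by rewrite derive1E (@derive_val _ _ _ _ _ _ _ (pow_prim pN1 x0)).
Unshelve. all: by end_near. Qed.

End powers.

Section kernels.
Context {R : realType}.
Local Notation leb := (@lebesgue_measure R).
Implicit Types (p q c y : R).

Lemma ae_pick (P : R -> Prop) (x y : R) : {ae leb, forall s, x < s < y -> P s} -> x < y ->
  exists s, x < s < y /\ P s.
Proof.
move=> [M [mM M0 PM]] xy; apply: contrapT => nex.
have : (leb `]x, y[%classic <= leb M)%E.
  apply: le_measure; rewrite ?inE//.
  move=> z /=; rewrite in_itv/= => xzy; apply: PM => /= pz; apply: nex.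
  by exists z; split => //; exact: pz.
by rewrite M0 lebesgue_measure_itv/= lte_fin xy -EFinB lee_fin leNgt subr_gt0 xy.
Qed.

Lemma Rint_gt0 (f : R -> R) (u v : R) : u < v -> ibl leb f -> (forall x, 0 <= f x) ->
  (forall x, u < x < v -> 0 < f x) -> 0 < \int[leb]_x f x.
Proof.
move=> uv fi f0 fp; rewrite lt_neqAle Rintegral_ge0// andbT; apply/negP => /eqP/esym i0.
have f_eq0 : {ae leb, forall x, f x = 0} by apply: Rint_eq0_ae => //; exact: nearW.
have [|s [/fp fs s0]] := @ae_pick (fun x => f x = 0) u v _ uv.
  by apply: ae_imp f_eq0 => s.
by rewrite s0 ltxx in fs.
Qed.

Lemma ge0_ibl (f : R -> R) : measurable_fun setT f -> (forall x, 0 <= f x) ->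
  (\int[leb]_x (f x)%:E < +oo)%E -> ibl leb f.
Proof.
move=> mf f0 fi; apply/integrableP; split; first exact/measurable_EFinP.
by under eq_integral do rewrite /= ger0_norm//.
Qed.

Lemma ibl_powy p : p < -1 -> ibl leb ((fun w : R => w `^ p) \_ `[1, +oo[).
Proof.
move=> p1; apply: ge0_ibl.
- apply/(measurable_restrictT _ _).1 => //.
  by apply: measurable_funTS; exact: measurable_powR.
- by move=> x; rewrite patchE; case: ifP => // _; exact: powR_ge0.
have := integral_powy_lty p1; rewrite integral_mkcond.
by congr (_ < _)%E; apply: eq_integral => x _; rewrite !patchE; case: ifP.
Qed.

Lemma ler_powR_neg p x y : p <= 0 -> 0 < x -> x <= y -> y `^ p <= x `^ p.
Proof.
move=> p0 x0 xy; have y0 : 0 < y by rewrite (lt_le_trans x0).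
rewrite -(opprK p) !(powRN _ (- p)) lef_pV2 ?posrE ?powR_gt0//.
by apply: ge0_ler_powR => //; rewrite ?nnegrE ?oppr_ge0 ?(ltW x0) ?(ltW y0).
Qed.

(** The kernel of a one-sided fractional integral. *)
Definition kpow p y : R := if 0 < y then y `^ p else 0.

Lemma kpow_ge0 p y : 0 <= kpow p y.
Proof. by rewrite /kpow; case: ifPn => // _; exact: powR_ge0. Qed.

Lemma kpow_gt0 p y : 0 < y -> 0 < kpow p y.
Proof. by rewrite /kpow => y0; rewrite y0 powR_gt0. Qed.

Lemma measurable_kpow p : measurable_fun setT (kpow p).
Proof.
by apply: measurable_fun_ifT => //; exact: measurable_fun_ltr.
Qed.

Lemma kpowM p c y : 0 < c -> kpow p (c * y) = c `^ p * kpow p y.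
Proof.
move=> c0; rewrite /kpow pmulr_rgt0//; case: ifPn => y0; last by rewrite mulr0.
by rewrite powRM// ltW.
Qed.

(** The truncation makes the kernel integrable and is invisible to functions
    supported in an interval of length [c]. *)
Definition kcut p c y : R := if y < c then kpow p y else 0.

Lemma kcut_ge0 p c y : 0 <= kcut p c y.
Proof. by rewrite /kcut; case: ifP => // _; exact: kpow_ge0. Qed.

Lemma measurable_kcut p c : measurable_fun setT (kcut p c).
Proof.
apply: measurable_fun_ifT => //; first exact: measurable_fun_ltr.
exact: measurable_kpow.
Qed.

Lemma ibl_kcut p c : -1 < p -> ibl leb (kcut p c).
Proof.
move=> p1; apply: ge0_ibl; [exact: measurable_kcut|exact: kcut_ge0|].
have [c0|c0] := leP c 0.
  rewrite integral0_eq//= => y _; rewrite /kcut /kpow; case: ifPn => // yc.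
  by rewrite ltNge (le_trans (ltW yc)).
apply: le_lt_trans (integral_pow0_lty p1 c0).
rewrite [leRHS]integral_mkcond; apply: ge0_le_integral => //=.
- by move=> y _; rewrite lee_fin kcut_ge0.
- by apply/measurable_EFinP; exact: measurable_kcut.
- apply/(measurable_restrictT _ _).1 => //.
  by apply/measurable_EFinP; apply: measurable_funTS; exact: measurable_powR.
- move=> y _; rewrite patchE mem_setE in_itv/= /kcut /kpow.
  case: ifPn => yc; last by case: ifP => // _; rewrite lee_fin powR_ge0.
  by case: ifPn => y0; rewrite ?(ltW yc)//=.
Qed.

(** Euler's Beta function at [p + 1] and [q + 1]. *)
Definition Beta p q : R := \int[leb]_s (kpow p s * kpow q (1 - s)).

Let mbeta (p q t r : R) : measurable_fun setT (fun s : R => kpow p (s - t) * kpow q (r - s)).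
Proof.
apply: measurable_funM; (apply: measurableT_comp; first exact: measurable_kpow).
- exact: measurable_funB.
- exact: measurable_funB.
Qed.

(* Near each of its two singularities the product is dominated by the singular
   factor, the other one being at most its value at 1/2. *)
Let ibl_beta p q : -1 < p -> p <= 0 -> -1 < q -> q <= 0 ->
  ibl leb (fun s => kpow p s * kpow q (1 - s)).
Proof.
move=> p1 p0 q1 q0.
have i2 := ibl_reflect 1 (ibl_kcut 2 q1).
have i1 := ibl_kcut 2 p1.
apply: (@ibl_le _ _ _ leb (fun s => 2^-1 `^ q * kcut p 2 s + 2^-1 `^ p * kcut q 2 (1 - s))).
- have := mbeta p q 0 1; congr measurable_fun; apply/funext => s; by rewrite subr0.
- move=> s; rewrite ger0_norm ?mulr_ge0 ?kpow_ge0//.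
  rewrite /kcut /kpow.
  case: (ltP 0 s) => s0; last first.
    rewrite mul0r addr_ge0// mulr_ge0 ?powR_ge0//.
      by case: ifP.
    by case: ifP => //; case: ifP => // *; exact: powR_ge0.
  case: (ltP 0 (1 - s)) => s1; last first.
    rewrite mulr0 addr_ge0// mulr_ge0 ?powR_ge0//.
      by case: ifP => // *; exact: powR_ge0.
    by case: ifP.
  have -> : s < 2 by lra.
  have -> : 1 - s < 2 by lra.
  have [sh|sh] := leP s 2^-1.
    have h : (1 - s) `^ q <= 2^-1 `^ q by apply: ler_powR_neg => //; lra.
    rewrite mulrC (@le_trans _ _ (2^-1 `^ q * s `^ p))//.
      by rewrite ler_wpM2r// powR_ge0.
    by rewrite lerDl mulr_ge0// powR_ge0.
  have h : s `^ p <= 2^-1 `^ p by apply: ler_powR_neg => //; lra.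
  rewrite (@le_trans _ _ (2^-1 `^ p * (1 - s) `^ q))//.
    by rewrite ler_wpM2r// powR_ge0.
  by rewrite lerDr mulr_ge0// powR_ge0.
- by apply: iblD; apply: iblZ.
Qed.

Lemma Beta_gt0 p q : -1 < p -> p <= 0 -> -1 < q -> q <= 0 -> 0 < Beta p q.
Proof.
move=> p1 p0 q1 q0; apply: (@Rint_gt0 _ 0 1) => //; first exact: ibl_beta.
  by move=> s; rewrite mulr_ge0// kpow_ge0.
by move=> s /andP[s0 s1]; rewrite mulr_gt0// kpow_gt0//; lra.
Qed.

(** The composition rule for fractional integrals; an affine substitution maps the
    interval from [t] to [r] to the unit interval. *)
Lemma kpow_beta p q t r : -1 < p -> p <= 0 -> -1 < q -> q <= 0 ->
  (\int[leb]_s (kpow p (s - t) * kpow q (r - s))%:E =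
   (Beta p q * kpow (p + q + 1) (r - t))%:E)%E.
Proof.
move=> p1 p0 q1 q0.
have [rt|tr] := leP r t.
  rewrite integral0_eq.
    by rewrite /kpow ltNge subr_le0 rt/= mulr0.
  move=> s _; rewrite /kpow; case: (ltP 0 (s - t)) => h1; last by rewrite mul0r.
  case: (ltP 0 (r - s)) => h2; rewrite ?mulr0//; exfalso.
  by have := ltr_leD h1 rt; have := h2; rewrite !subr_gt0 in h1 h2 *; lra.
have rt0 : 0 < r - t by lra.
rewrite (@ge0_integral_affine _ (r - t) t)//; last 2 first.
- by apply/measurable_EFinP; exact: mbeta.
- by move=> s; rewrite lee_fin mulr_ge0// kpow_ge0.
have E (s : R) : ((kpow p ((r - t) * s + t - t) * kpow q (r - ((r - t) * s + t)))%:E =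
    ((r - t) `^ (p + q))%:E * (kpow p s * kpow q (1 - s))%:E)%E.
  rewrite addrK (_ : r - ((r - t) * s + t) = (r - t) * (1 - s)); last by ring.
  rewrite !kpowM// -EFinM powRD ?(gt_eqF rt0) ?implybT//; congr EFin; ring.
under eq_integral do rewrite E.
have ib := ibl_beta p1 p0 q1 q0.
rewrite integralZl//.
have -> : (\int[leb]_s (kpow p s * kpow q (1 - s))%:E = (Beta p q)%:E)%E.
  by rewrite /Beta /Rintegral fineK//; apply: integrable_fin_num.
rewrite -!EFinM; congr EFin; rewrite /kpow rt0.
rewrite (@powRD _ _ (p + q) 1) ?(gt_eqF rt0) ?implybT//.
rewrite (powRr1 (ltW rt0)); ring.
Qed.

End kernels.

Section riesz.
Context {R : realType}.
Local Notation leb := (@lebesgue_measure R).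
Local Notation leb2 := (leb \x leb)%E.
Implicit Types (p q c y : R).

(** The constant of the Riesz composition formula. The integral converges at
    infinity for [q < - 1/2] only. *)
Definition Riesz q : R := \int[leb]_w (kpow q w * kpow q (1 + w)).

Let ibl_riesz q : -1 < q -> q < - 2^-1 -> ibl leb (fun w => kpow q w * kpow q (1 + w)).
Proof.
move=> q1 q2.
have i1 := ibl_kcut 1 q1.
have i2 : ibl leb ((fun w : R => w `^ (q + q)) \_ `[1, +oo[) by apply: ibl_powy; lra.
apply: (@ibl_le _ _ _ leb (fun w => kcut q 1 w + ((fun w : R => w `^ (q + q)) \_ `[1, +oo[) w)).
- apply: measurable_funM; first exact: measurable_kpow.
  by apply: measurableT_comp; [exact: measurable_kpow|exact: measurable_funD].
- move=> w; rewrite ger0_norm ?mulr_ge0 ?kpow_ge0// patchE mem_setE in_itv/= andbT.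
  rewrite /kcut; case: (ltP w 1) => w1.
    rewrite addr0 /kpow; case: ifPn => w0; last by rewrite mul0r.
    have w10 : 0 < 1 + w by lra.
    rewrite w10 ler_piMr ?powR_ge0//.
    have q0 : q <= 0 by lra.
    have le1 : 1 <= 1 + w by lra.
    by have := @ler_powR_neg R q 1 (1 + w) q0 ltr01 le1; rewrite powR1.
  have w0 : 0 < w by lra.
  have w10 : 0 < 1 + w by lra.
  rewrite add0r /kpow w0 w10 powRD ?(gt_eqF w0) ?implybT//.
  by rewrite ler_wpM2l ?powR_ge0// ler_powR_neg//; lra.
- exact: iblD.
Qed.

Lemma Riesz_gt0 q : -1 < q -> q < - 2^-1 -> 0 < Riesz q.
Proof.
move=> q1 q2; apply: (@Rint_gt0 _ _ 0 1) => //; first exact: ibl_riesz.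
  by move=> s; rewrite mulr_ge0// kpow_ge0.
by move=> s /andP[s0 s1]; rewrite mulr_gt0// kpow_gt0//; lra.
Qed.

Let mriesz (q s t : R) : measurable_fun setT (fun w : R => kpow q (t - w) * kpow q (s - w)).
Proof.
by apply: measurable_funM; apply: measurableT_comp;
  first [exact: measurable_kpow|exact: measurable_funB].
Qed.

Let kpow_riesz_lt q s t : -1 < q -> q < - 2^-1 -> s < t ->
  (\int[leb]_w (kpow q (t - w) * kpow q (s - w))%:E =
   (Riesz q * (t - s) `^ (q + q + 1))%:E)%E.
Proof.
move=> q1 q2 st; have d0 : 0 < t - s by lra.
rewrite -(@ge0_integral_reflect _ s)//; last 2 first.
- by apply/measurable_EFinP; exact: mriesz.
- by move=> w; rewrite lee_fin mulr_ge0// kpow_ge0.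
rewrite (@ge0_integral_affine _ (t - s) 0)//; last 2 first.
- apply/measurable_EFinP.
  have := mriesz q s t => /measurableT_comp; apply; exact: measurable_funB.
- by move=> w; rewrite lee_fin mulr_ge0// kpow_ge0.
have E (w : R) : ((kpow q (t - (s - ((t - s) * w + 0))) * kpow q (s - (s - ((t - s) * w + 0))))%:E =
    ((t - s) `^ (q + q))%:E * (kpow q w * kpow q (1 + w))%:E)%E.
  rewrite (_ : t - (s - ((t - s) * w + 0)) = (t - s) * (1 + w)); last by ring.
  rewrite (_ : s - (s - ((t - s) * w + 0)) = (t - s) * w); last by ring.
  rewrite !kpowM// -EFinM powRD ?(gt_eqF d0) ?implybT//; congr EFin; ring.
under eq_integral do rewrite E.
have ib := ibl_riesz q1 q2.
rewrite integralZl//.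
have -> : (\int[leb]_s (kpow q s * kpow q (1 + s))%:E = (Riesz q)%:E)%E.
  by rewrite /Riesz /Rintegral fineK//; apply: integrable_fin_num.
rewrite -!EFinM; congr EFin.
rewrite (@powRD _ _ (q + q) 1) ?(gt_eqF d0) ?implybT//.
rewrite (powRr1 (ltW d0)); ring.
Qed.

(** The symmetric kernel is a superposition of products of one-sided kernels, which
    is what makes it positive definite. *)
Lemma kpow_riesz q s t : -1 < q -> q < - 2^-1 -> s != t ->
  (\int[leb]_w (kpow q (t - w) * kpow q (s - w))%:E =
   (Riesz q * (kpow (q + q + 1) (t - s) + kpow (q + q + 1) (s - t)))%:E)%E.
Proof.
move=> q1 q2; rewrite neq_lt => /orP[st|ts].
  by rewrite kpow_riesz_lt// /kpow !subr_gt0 st ltNge (ltW st)/= addr0.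
under eq_integral do rewrite mulrC.
by rewrite kpow_riesz_lt// /kpow !subr_gt0 ts ltNge (ltW ts)/= add0r.
Qed.

(** Convolutions converge absolutely in both variables together, so that Fubini's
    theorem applies to the double integrals below. *)
Lemma conv_ibl (k a b : R -> R) M : ibl leb k -> ibl leb a ->
  measurable_fun setT b -> (forall x, `|b x| <= M) ->
  ibl leb2 (fun z => a z.1 * (k (z.1 - z.2) * b z.2)).
Proof.
move=> ki ai mb bM.
have mk := ibl_mfun ki; have ma := ibl_mfun ai.
apply: (@tonelli_ibl _ _ _ _ _ leb leb _ (fun x => `|a x| * (M * \int[leb]_y `|k y|))).
- apply: measurable_funM; first exact: measurableT_comp.
  apply: measurable_funM; last exact: measurableT_comp.
  by apply: measurableT_comp => //; exact: measurable_funB.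
- by under eq_fun do rewrite mulrC; apply: iblZ; exact: ibl_norm.
move=> x.
have kN : (\int[leb]_y (`|k y|)%:E)%E \is a fin_num.
  by apply: integrable_fin_num => //; exact: ibl_norm ki.
rewrite (@le_trans _ _ (\int[leb]_y ((`|a x| * M)%:E * (`|k (x - y)|)%:E)%E)%E)//.
  apply: ge0_le_integral => //=.
  - apply/measurable_EFinP; apply: measurableT_comp => //.
    apply: measurable_funM => //; apply: measurable_funM => //.
    by apply: measurableT_comp => //; exact: measurable_funB.
  - apply/measurable_EFinP; apply: measurable_funM => //; apply: measurableT_comp => //.
    by apply: measurableT_comp => //; exact: measurable_funB.
  - by move=> y _; rewrite lee_fin !normrM -mulrA ler_wpM2l// mulrC ler_wpM2r.
rewrite ge0_integralZl//; last 2 first.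
- by apply/measurable_EFinP; apply: measurableT_comp => //;
     apply: measurableT_comp => //; exact: measurable_funB.
- by rewrite lee_fin mulr_ge0// (le_trans _ (bM 0)).
rewrite (@ge0_integral_reflect _ x (fun y => (`|k y|)%:E))//; last first.
  by apply/measurable_EFinP; exact: measurableT_comp.
by rewrite -(fineK kN) -EFinM lee_fin mulrA.
Qed.

End riesz.

Section positivity.
Context {R : realType}.
Local Notation leb := (@lebesgue_measure R).
Local Notation leb2 := (leb \x leb)%E.
Variables (q T M : R) (f : R -> R).
Hypotheses (q1 : -1 < q) (q2 : q < - 2^-1).
Hypotheses (mf : measurable_fun setT f) (fM : forall x, `|f x| <= M)
           (f0 : forall x, ~ (0 < x < T) -> f x = 0).

Let al := q + q + 1.
Let k := kcut al T.

Lemma bounded_supp_ibl (g : R -> R) (N : R) : measurable_fun setT g ->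
  (forall x, `|g x| <= N) -> (forall x, ~ (0 < x < T) -> g x = 0) -> ibl leb g.
Proof.
move=> mg gN g0.
have : ibl leb (fun x => g x * \1_(`]0, T[) x).
  by apply: (@ibl_mulb _ _ _ leb N) => //; exact: integrable_indic_itv.
congr (leb.-integrable _ _); apply/funext => x /=; rewrite indicE mem_setE in_itv/=.
by case: (boolP (0 < x < T)) => [_|/negP/g0 ->]; rewrite ?mulr1 ?mul0r.
Qed.

Let fi : ibl leb f. Proof. exact: (bounded_supp_ibl mf fM). Qed.

Let fhi (w : R) : ibl leb (fun t => f t * kpow q (t - w)).
Proof.
have mh : measurable_fun setT (fun t : R => kpow q (t - w)).
  by apply: measurableT_comp; [exact: measurable_kpow|exact: measurable_funB].
have ki : ibl leb (fun t => kcut q (T - w) (t - w)) by apply: ibl_shift; exact: ibl_kcut.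
apply: (@ibl_le _ _ _ leb (fun t => M * kcut q (T - w) (t - w))).
- exact: measurable_funM.
- move=> t; rewrite normrM (ger0_norm (kpow_ge0 _ _)) /kcut ltrD2r.
  case: ltP => tT; first by rewrite ler_wpM2r ?kpow_ge0.
  by rewrite f0 ?normr0 ?mul0r ?mulr0//; move/andP => [_]; rewrite ltNge tT.
- exact: iblZ.
Qed.

(* On the diagonal the composition formula fails, the integral on the left being
   infinite there. *)
Let P (g : R -> R) (z : (R * R) * R) : R :=
  if 0 < `|z.1.1 - z.1.2|
  then (g z.1.1 * kpow q (z.1.1 - z.2)) * (g z.1.2 * kpow q (z.1.2 - z.2)) else 0.

Let mP (g : R -> R) : measurable_fun setT g -> measurable_fun setT (P g).
Proof.
move=> mg.
have m11 : measurable_fun setT (fun z : (R * R) * R => z.1.1) by exact: measurableT_comp.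
have m12 : measurable_fun setT (fun z : (R * R) * R => z.1.2) by exact: measurableT_comp.
apply: measurable_fun_ifT => //.
  apply: measurable_fun_ltr => //; apply: measurableT_comp => //.
  exact: measurable_funB.
apply: measurable_funM; (apply: measurable_funM; first exact: measurableT_comp);
  apply: measurableT_comp; first [exact: measurable_kpow|exact: measurable_funB].
Qed.

Let Q (g : R -> R) (z : R * R) :=
  g z.1 * g z.2 * (Riesz q * (k (z.1 - z.2) + k (z.2 - z.1))).

Let intP (g : R -> R) (z : R * R) : (forall x, ~ (0 < x < T) -> g x = 0) ->
  (\int[leb]_w (P g (z, w))%:E = (Q g z)%:E)%E.
Proof.
move=> g0; rewrite /P /Q /=; case: (boolP (0 < `|z.1 - z.2|)) => zd; last first.
  rewrite integral0_eq//.
  move: zd; rewrite normr_gt0 negbK subr_eq0 => /eqP ->.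
  by rewrite subrr /k /kcut /kpow ltxx !(if_same, addr0, mulr0).
under eq_integral do rewrite ?zd.
have z12 : z.2 != z.1 by move: zd; rewrite normr_gt0 subr_eq0 eq_sym.
have [h1|h1] := boolP (0 < z.1 < T); last first.
  rewrite (g0 _ (elimN idP h1)) !mul0r.
  by rewrite integral0_eq// => w _; rewrite !mul0r.
have [h2|h2] := boolP (0 < z.2 < T); last first.
  rewrite (g0 _ (elimN idP h2)) !(mul0r, mulr0).
  by rewrite integral0_eq// => w _; rewrite !(mul0r, mulr0).
have kE : k (z.1 - z.2) + k (z.2 - z.1) = kpow al (z.1 - z.2) + kpow al (z.2 - z.1).
  rewrite /k /kcut.
  have -> : z.1 - z.2 < T by lra.
  by have -> : z.2 - z.1 < T by lra.
have R_ := kpow_riesz q1 q2 z12.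
transitivity ((g z.1 * g z.2)%:E * \int[leb]_w (kpow q (z.1 - w) * kpow q (z.2 - w))%:E)%E.
  rewrite -integralZl//.
    by apply: eq_integral => w _; rewrite -EFinM; congr EFin; ring.
  apply: ge0_ibl.
  - by apply: measurable_funM; apply: measurableT_comp;
      first [exact: measurable_kpow|exact: measurable_funB].
  - by move=> w; rewrite mulr_ge0// kpow_ge0.
  by rewrite R_ ltry.
by rewrite R_ kE -EFinM.
Qed.

Let ki : ibl leb k.
Proof.
have h : -1 < q + q + 1 by move: q1 => h; lra.
exact: ibl_kcut.
Qed.

Let Qi (g : R -> R) (N : R) : measurable_fun setT g -> (forall x, `|g x| <= N) ->
  (forall x, ~ (0 < x < T) -> g x = 0) ->
  let c := \int[leb2]_z (g z.1 * (k (z.1 - z.2) * g z.2)) in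
  ibl leb2 (Q g) /\ \int[leb2]_z Q g z = 2 * Riesz q * c.
Proof.
move=> mg gN g0; have gi := bounded_supp_ibl mg gN g0.
have F1 := conv_ibl ki gi mg gN; have F2 := ibl_swap F1.
have QE : Q g = fun z => Riesz q * (g z.1 * (k (z.1 - z.2) * g z.2) +
                                    g z.2 * (k (z.2 - z.1) * g z.1)).
  by apply/funext => z; rewrite /Q; ring.
rewrite QE; split; first by apply: iblZ; exact: iblD.
rewrite RintegralZl//; last exact: iblD.
rewrite RintegralD//.
by rewrite [X in _ + X](Rint_swap F1)/=; ring.
Qed.

Let Pi : ibl (plane_measure \x leb)%E (P f).
Proof.
have mnf : measurable_fun setT (fun x => `|f x|) by exact: measurableT_comp.
have nfM x : `|(`|f x|)| <= M by rewrite normr_id.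
have nf0 x : ~ (0 < x < T) -> `|f x| = 0 by move/f0 ->; rewrite normr0.
have [iQ _] := Qi mnf nfM nf0.
apply: (@tonelli_ibl _ _ _ _ _ plane_measure leb _ (Q (fun x => `|f x|))) => //.
  exact: mP.
move=> z; rewrite -intP// le_eqVlt; apply/orP; left; apply/eqP.
apply: eq_integral => w _; congr EFin; rewrite /P; case: ifP => _; last exact: normr0.
by rewrite !normrM !(ger0_norm (kpow_ge0 _ _)).
Qed.

Let offdiag : {ae leb2, forall z : R * R, 0 < `|z.1 - z.2|}.
Proof.
pose A : set (measurableTypeR R * measurableTypeR R) := [set z | 0 < `|z.1 - z.2|].
apply: (@prod_ae1 _ _ _ _ _ leb leb A).
  have : measurable_fun setT (fun z : measurableTypeR R * measurableTypeR R => 0 < `|z.1 - z.2|).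
    apply: measurable_fun_ltr => //; apply: measurableT_comp => //.
    exact: measurable_funB.
  by move=> /(_ measurableT [set true]); rewrite setTI; apply.
apply: nearW => t; exists [set t]; split => //; first exact: lebesgue_measure_set1.
by move=> r /=; rewrite /A /= normr_gt0 subr_eq0 => /negP; rewrite negbK => /eqP.
Qed.

(** By the Riesz composition formula the quadratic form is an integral over [w] of
    the squares of [\int f(t) (t - w)^q dt]. *)
Lemma frac_kernel_ge0 : 0 <= \int[leb]_t (f t * \int[leb]_r (k (t - r) * f r)).
Proof.
have [iQ E2] := Qi mf fM f0; have F1 := conv_ibl ki fi mf fM.
have E1 : \int[leb]_t (f t * \int[leb]_r (k (t - r) * f r)) =
          \int[leb2]_z (f z.1 * (k (z.1 - z.2) * f z.2)).
  rewrite -(Rint12 F1); apply: eq_Rintegral => t _ /=; rewrite RintegralZl//.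
  have := @ibl_mulb _ _ _ leb M f _ mf fM (ibl_reflect t ki).
  by congr (leb.-integrable _ _); apply/funext => r /=; rewrite mulrC.
have : 0 <= \int[leb2]_z (Q f z).
  have <- : \int[leb]_w \int[leb2]_z P f (z, w) = \int[leb2]_z (Q f z).
    rewrite (Rint21 Pi) -(Rint12 Pi); apply: eq_Rintegral => z _.
    by rewrite /Rintegral intP.
  apply: Rintegral_ge0 => w _.
  have iw := ibl_prod (fhi w) (fhi w).
  rewrite (@Rint_ae _ _ _ leb2 _ (fun z => f z.1 * kpow q (z.1 - w) * (f z.2 * kpow q (z.2 - w)))).
  - rewrite -(Rint12 iw)/=.
    under eq_Rintegral do rewrite RintegralZl//.
    by rewrite RintegralZr// -expr2 sqr_ge0.
  - exact: (mfun_sec2 w (mP mf)).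
  - exact: ibl_mfun iw.
  - by apply: ae_imp offdiag => z zd; rewrite /P/= zd.
by rewrite E1 E2 pmulr_rge0// mulr_gt0// Riesz_gt0.
Qed.

End positivity.

(** * Smooth cutoffs *)

Section smooth_functions.
Context {R : realType}.
Implicit Types f g : R -> R.

(** The one-variable counterpart of [Cn]. The derivative is a witness, which is
    easier to exhibit than the derivative operator is to compute. *)
Fixpoint Sm (n : nat) f : Prop :=
  if n is m.+1 then exists2 g : R -> R, (forall x : R, is_derive x 1 f (g x)) & Sm m g
  else continuous f.

Lemma is_derive_continuous f g : (forall x : R, is_derive x 1 f (g x)) -> continuous f.
Proof.
move=> fg x; apply: differentiable_continuous; apply/derivable1_diffP.
by have [] := fg x.
Qed.

Lemma Sm_continuous n f : Sm n f -> continuous f.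
Proof. by case: n => [//|n] [g fg _]; exact: is_derive_continuous fg. Qed.

Lemma SmW n f : Sm n.+1 f -> Sm n f.
Proof.
elim: n f => [|n IH] f [g fg gn]; first exact: is_derive_continuous fg.
by exists g => //; exact: IH.
Qed.

Lemma SmD n f g : Sm n f -> Sm n g -> Sm n (fun x => f x + g x).
Proof.
elim: n f g => [|n IH] f g; first by move=> cf cg x; apply: cvgD; [exact: cf|exact: cg].
move=> [f' ff' f'n] [g' gg' g'n]; exists (fun x => f' x + g' x); last exact: IH.
by move=> x; exact: is_deriveD.
Qed.

Lemma SmM n f g : Sm n f -> Sm n g -> Sm n (fun x => f x * g x).
Proof.
elim: n f g => [|n IH] f g; first by move=> cf cg x; apply: cvgM; [exact: cf|exact: cg].
move=> fn gn; have fn' := SmW fn; have gn' := SmW gn.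
move: fn gn => [f' ff' f'n] [g' gg' g'n].
exists (fun x => f x * g' x + g x * f' x); last by apply: SmD; exact: IH.
by move=> x; exact: is_deriveM.
Qed.

Lemma Sm_cst n (c : R) : Sm n (fun=> c).
Proof.
elim: n c => [c x|n IH c]; first exact: cvg_cst.
by exists (fun=> 0) => // x; exact: is_derive_cst.
Qed.

Lemma SmZ n (c : R) f : Sm n f -> Sm n (fun x => c * f x).
Proof. by apply: SmM; exact: Sm_cst. Qed.

Lemma is_derive_affine f (k b x d : R) : is_derive (k * x + b) 1 f d ->
  is_derive x 1 (fun x => f (k * x + b)) (k * d).
Proof.
move=> fd; rewrite mulrC.
have h : is_derive x 1 (fun x : R => k * x + b) k.
  have h1 := is_deriveD (is_deriveZ k (is_derive_id x 1)) (is_derive_cst b x 1).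
  by apply: (is_derive_eq h1); rewrite addr0; exact: mulr1.
exact: (@is_derive1_comp _ f (fun x => k * x + b) x d k fd h).
Qed.

Lemma Sm_affine n f (k b : R) : Sm n f -> Sm n (fun x => f (k * x + b)).
Proof.
elim: n f => [f cf x|n IH f [g fg gn]].
  apply: continuous_comp; last exact: cf.
  by apply: cvgD; [apply: cvgM; [exact: cvg_cst|exact: cvg_id]|exact: cvg_cst].
exists (fun x => k * g (k * x + b)); last by apply: SmZ; exact: IH.
by move=> x; exact: is_derive_affine.
Qed.

(** The functions [p(1/x) exp(-1/x)], extended by zero, form a family that is
    stable under differentiation. *)
Definition flat (p : {poly R}) (x : R) : R :=
  if 0 < x then p.[x^-1] * expR (- x^-1) else 0.

(* The exponential decays faster than any power of [x]; the second power gives a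
   zero derivative at the origin. *)
Let flat_bound (p : {poly R}) : exists2 C, 0 <= C &
  forall x : R, `|x| <= 1 -> `|flat p x| <= C * x ^+ 2.
Proof.
pose A := \sum_(i < size p) `|p`_i|.
exists (A * ((size p + 2)`!)%:R).
  by rewrite mulr_ge0// sumr_ge0.
move=> x x1; rewrite /flat; case: ifPn => x0; last first.
  by rewrite normr0 mulr_ge0 ?sqr_ge0// mulr_ge0// sumr_ge0.
have xle : x <= 1 by rewrite (le_trans (ler_norm x)).
have y1 : 1 <= x^-1 by rewrite invf_ge1.
have y0 : 0 < x^-1 by rewrite invr_gt0.
have pb : `|p.[x^-1]| <= A * x^-1 ^+ (size p).
  rewrite horner_coef (le_trans (ler_norm_sum _ _ _))// mulr_suml.
  apply: ler_sum => i _; rewrite normrM ler_wpM2l//.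
  by rewrite ger0_norm ?exprn_ge0 ?(ltW y0)// ler_weXn2l// ltnW.
have eb : expR (- x^-1) <= ((size p + 2)`!)%:R * x ^+ (size p + 2).
  rewrite expRN -[leRHS]invrK lef_pV2 ?posrE ?expR_gt0//; last first.
    by rewrite invr_gt0 mulr_gt0 ?exprn_gt0// ltr0n fact_gt0.
  rewrite invfM -exprVn mulrC addn2.
  have := expR_ge1Dxn (size p).+1 (ltW y0); apply: le_trans.
  by rewrite lerDr.
rewrite normrM (ger0_norm (expR_ge0 _)).
rewrite (le_trans (ler_pM _ _ pb eb)) ?expR_ge0//.
rewrite exprD exprVn le_eqVlt; apply/orP; left; apply/eqP; field.
by rewrite expf_neq0// gt_eqF.
Qed.

Let flat' (p : {poly R}) : {poly R} := 'X ^+ 2 * (p - p^`()).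

Let flat_derive p (x : R) : is_derive x 1 (flat p) (flat (flat' p) x).
Proof.
have [x0|x0|->] := ltgtP x 0.
- have -> : flat (flat' p) x = 0 by rewrite /flat ltNge (ltW x0).
  apply: (@near_eq_is_derive _ _ _ (fun=> 0 : R)).
  near=> y; rewrite /flat ltNge ifF//; apply/negbTE; rewrite negbK ltW//.
  by near: y; exact: lt_nbhsl.
- have xN0 : x != 0 by rewrite gt_eqF.
  have hV := is_deriveV xN0 (is_derive_id x (1 : R)).
  have h1 := @is_derive1_comp _ (horner p) (fun y => y^-1) _ _ _ (is_derive_poly p x^-1) hV.
  have h2 := @is_derive1_comp _ expR (fun y => - y^-1) _ _ _ (is_derive_expR (- x^-1)) (is_deriveN hV).
  have h : is_derive x (1 : R) (fun y : R => p.[y^-1] * expR (- y^-1)) (flat (flat' p) x).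
    apply: (is_derive_eq (is_deriveM h1 h2)).
    rewrite /flat x0 /flat' !hornerE /= /GRing.scale /=; field.
    exact: xN0.
  apply: (near_eq_is_derive _ h); near=> y; rewrite /flat ifT//.
  by near: y; exact: lt_nbhsr.
- have -> : flat (flat' p) 0 = 0 by rewrite /flat ltxx.
  have [C C0 fC] := flat_bound p.
  have c : h^-1 *: ((flat p \o shift 0) (h *: 1) - flat p 0) @[h --> (0 : R)^'] --> (0 : R).
    apply/cvgrPdist_le => e e0; near=> h.
    have h0 : h != 0 by near: h; exact: nbhs_dnbhs_neq.
    have h1 : `|h| <= 1.
      near: h; apply: dnbhs0_le; exact: ltr01.
    have h2 : `|h| <= e / (C + 1).
      near: h; apply: dnbhs0_le; rewrite divr_gt0//; lra.
    rewrite sub0r normrN [flat p 0]/flat ltxx subr0 /= addr0.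
    rewrite /GRing.scale /= mulr1 normrM normfV.
    rewrite ler_pdivrMl ?normr_gt0//.
    rewrite (le_trans (fC _ h1))// -real_normK ?num_real// mulrC expr2 -mulrA.
    rewrite ler_wpM2l// (le_trans _ (_ : e / (C + 1) * (C + 1) <= e))//.
      by apply: ler_pM => //; lra.
    by rewrite divfK// gt_eqF//; lra.
  by apply: DeriveDef; [apply/cvg_ex; exists 0|exact/cvg_lim].
Unshelve. all: by end_near. Qed.

Lemma Sm_flat n p : Sm n (flat p).
Proof.
elim: n p => [|n IH] p; first exact: is_derive_continuous (flat_derive p).
by exists (flat (flat' p)).
Qed.

Definition bump0 (x : R) : R := flat 1 (1 + x) * flat 1 (1 - x).

Lemma Sm_bump0 n : Sm n bump0.
Proof.
have -> : bump0 = fun x => flat 1 (1 * x + 1) * flat 1 ((- 1) * x + 1).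
  by apply/funext => x; rewrite /bump0 mul1r mulN1r addrC [- x + 1]addrC.
by apply: SmM; apply: Sm_affine; exact: Sm_flat.
Qed.

Lemma flat1_ge0 x : 0 <= flat 1 x.
Proof. by rewrite /flat; case: ifP => // _; rewrite hornerE mul1r expR_ge0. Qed.

Lemma bump0_ge0 x : 0 <= bump0 x. Proof. by rewrite mulr_ge0// flat1_ge0. Qed.

Lemma bump0_gt0 x : -1 < x < 1 -> 0 < bump0 x.
Proof.
move=> /andP[x0 x1]; rewrite mulr_gt0// /flat ifT ?hornerE ?mul1r ?expR_gt0//; lra.
Qed.

Lemma bump0_out x : ~ (-1 < x < 1) -> bump0 x = 0.
Proof.
rewrite /bump0 /flat; case: (ltP 0 (1 + x)) => h1; last by rewrite mul0r.
case: (ltP 0 (1 - x)) => h2; last by rewrite mulr0.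
by move=> h; exfalso; apply: h; apply/andP; split; lra.
Qed.

Local Notation leb := (@lebesgue_measure R).

Lemma continuous_mfun f : continuous f -> measurable_fun (setT : set (measurableTypeR R)) f.
Proof. exact: continuous_measurable_fun. Qed.

Let bump0_bounded : exists M : R, forall x, `|bump0 x| <= M.
Proof.
have cb : {within `[-1, 1], continuous bump0}.
  by apply: continuous_subspaceT; exact: (Sm_continuous (Sm_bump0 0)).
have N11 : -1 <= 1 :> R by lra.
have [c _ cM] := EVT_max N11 cb.
exists (bump0 c) => x; rewrite ger0_norm ?bump0_ge0//.
have [xin|xout] := boolP (-1 < x < 1).
  by apply: cM; rewrite in_itv/=; case/andP : xin => /ltW -> /ltW ->.
by rewrite (bump0_out (elimN idP xout)) bump0_ge0.
Qed.

Let ibl_bump0 : ibl leb bump0.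
Proof.
have [M bM] := bump0_bounded.
have := @integrable_indic_itv R (-1) 1 true true => /(iblZ M).
apply: ibl_le.
  by apply: continuous_mfun; exact: (Sm_continuous (Sm_bump0 0)).
move=> x; rewrite indicE mem_setE in_itv/=.
have [xin|xout] := boolP (-1 <= x < 1); first by rewrite mulr1.
rewrite bump0_out ?normr0 ?mulr0// => /andP[h1 h2].
by move/negP : xout; apply; rewrite (ltW h1).
Qed.

Let mass : R := \int[leb]_x bump0 x.

Let mass_gt0 : 0 < mass.
Proof.
have N11 : -1 < 1 :> R by lra.
exact: (Rint_gt0 N11 ibl_bump0 bump0_ge0 bump0_gt0).
Qed.

Definition bumpf x := mass^-1 * bump0 x.

Lemma Sm_bump n : Sm n bumpf. Proof. by apply: SmZ; exact: Sm_bump0. Qed.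

Lemma continuous_bump : continuous bumpf. Proof. exact: (Sm_continuous (Sm_bump 0)). Qed.

Lemma bump_ge0 x : 0 <= bumpf x.
Proof. by rewrite mulr_ge0 ?bump0_ge0// invr_ge0 ltW. Qed.

Lemma bump_gt0 x : -1 < x < 1 -> 0 < bumpf x.
Proof. by move=> h; rewrite mulr_gt0 ?bump0_gt0// invr_gt0. Qed.

Lemma bump_out x : ~ (-1 < x < 1) -> bumpf x = 0.
Proof. by rewrite /bumpf => /bump0_out ->; rewrite mulr0. Qed.

Lemma bump_bounded : exists M : R, forall x, bumpf x <= M.
Proof.
have [M bM] := bump0_bounded; exists (mass^-1 * M) => x.
by rewrite ler_wpM2l ?invr_ge0 ?(ltW mass_gt0)// (le_trans (ler_norm _)).
Qed.

Lemma ibl_bump : ibl leb bumpf. Proof. exact: iblZ. Qed.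

Lemma Rint_bump : \int[leb]_x bumpf x = 1.
Proof. by rewrite RintegralZl// mulVf// gt_eqF. Qed.

(** A smooth step from 0 to 1 across the interval from -1 to 1. *)
Definition step x : R := \int[leb]_(y in `]-oo, x]) bumpf y.

Lemma is_derive_step (x : R) : is_derive x 1 step (bumpf x).
Proof.
have xx : x < x + 1 by rewrite ltrDl.
have bi : leb.-integrable [set` Interval -oo%O (BRight (x + 1))] (EFin \o bumpf).
  by apply: integrableS ibl_bump => //; exact: measurable_itv.
have [d e] := continuous_FTC1 xx bi (ltNyr x) (@continuous_bump x).
apply: DeriveDef; first exact: d.
by rewrite -derive1E e.
Qed.

Lemma Sm_step n : Sm n step.
Proof.
case: n => [|n]; first exact: is_derive_continuous is_derive_step.
by exists bumpf; [exact: is_derive_step|exact: Sm_bump].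
Qed.

Lemma step_ge0 x : 0 <= step x.
Proof. by apply: Rintegral_ge0 => y _; exact: bump_ge0. Qed.

Lemma step_le x : x <= -1 -> step x = 0.
Proof.
move=> x1; rewrite /step /Rintegral integral0_eq// => y /=; rewrite in_itv/= => yx.
by rewrite bump_out// => /andP[h _]; move: (lt_le_trans h yx); rewrite ltNge x1.
Qed.

Lemma step_ge x : 1 <= x -> step x = 1.
Proof.
move=> x1; rewrite -Rint_bump /step Rintegral_mkcond; apply: eq_Rintegral => y _.
rewrite patchE mem_setE in_itv/=; case: ifPn => //; rewrite -ltNge => xy.
by rewrite bump_out// => /andP[_ h]; move: (lt_trans xy h); rewrite ltNge x1.
Qed.

Lemma step_le1 x : step x <= 1.
Proof.
rewrite -Rint_bump /step Rintegral_mkcond; apply: Rint_le_ae.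
- apply: ibl_patch => //.
  by apply: (integrableS measurableT _ _ ibl_bump).
- exact: ibl_bump.
- by apply: nearW => y; rewrite patchE; case: ifP => // _; exact: bump_ge0.
Qed.

End smooth_functions.

Section cutoffs.
Context {R : realType}.
Implicit Types f g : R -> R.

Lemma step_nd (x y : R) : x <= y -> step x <= step y.
Proof.
move=> xy; rewrite /step [leLHS]Rintegral_mkcond [leRHS]Rintegral_mkcond.
have bi (z : R) : ibl (@lebesgue_measure R) (bumpf \_ `]-oo, z]).
  by apply: ibl_patch => //; apply: (integrableS measurableT _ _ (@ibl_bump R)).
apply: Rint_le_ae; [exact: bi|exact: bi|apply: nearW => z].
rewrite !patchE !mem_setE !in_itv/=; case: ifPn => zx.
  by rewrite (le_trans zx xy).
by case: ifP => // _; exact: bump_ge0.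
Qed.

(** A smooth function that rises from 0 to 1 within distance [r] of [p] and
    returns to 0 within distance [r] of [q]. *)
Definition cutoff (p q r x : R) : R := step ((x - p) / r) - step ((x - q) / r).

Definition dcutoff (p q r x : R) : R :=
  r^-1 * bumpf ((x - p) / r) - r^-1 * bumpf ((x - q) / r).

Let affE (p r x : R) : (x - p) / r = r^-1 * x + (- (p / r)).
Proof. by ring. Qed.

Lemma is_derive_cutoff p q r (x : R) : is_derive x 1 (cutoff p q r) (dcutoff p q r x).
Proof.
have -> : cutoff p q r = fun x => step (r^-1 * x + (- (p / r))) - step (r^-1 * x + (- (q / r))).
  by apply/funext => y; rewrite /cutoff !affE.
rewrite /dcutoff !affE; apply: is_deriveB; apply: is_derive_affine; exact: is_derive_step.
Qed.

Lemma Sm_cutoff n p q r : Sm n (cutoff p q r).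
Proof.
have -> : cutoff p q r =
    fun x => step (r^-1 * x + (- (p / r))) + (-1) * step (r^-1 * x + (- (q / r))).
  by apply/funext => y; rewrite /cutoff !affE mulN1r.
by apply: SmD; [|apply: SmZ]; apply: Sm_affine; exact: Sm_step.
Qed.

Lemma continuous_cutoff p q r : continuous (cutoff p q r).
Proof. exact: (Sm_continuous (Sm_cutoff 0 p q r)). Qed.

Lemma continuous_dcutoff p q r : continuous (dcutoff p q r).
Proof.
have [g h cg] := Sm_cutoff 1 p q r.
have -> // : dcutoff p q r = g.
apply/funext => x; have h1 := is_derive_cutoff p q r x.
by rewrite -(@derive_val _ _ _ _ _ _ _ h1) (@derive_val _ _ _ _ _ _ _ (h x)).
Qed.

Lemma measurable_cutoff p q r : measurable_fun setT (cutoff p q r).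
Proof. by apply: continuous_mfun; exact: continuous_cutoff. Qed.

Lemma measurable_dcutoff p q r : measurable_fun setT (dcutoff p q r).
Proof. by apply: continuous_mfun; exact: continuous_dcutoff. Qed.

Lemma cutoff_ge0 (p q r x : R) : 0 < r -> p <= q -> 0 <= cutoff p q r x.
Proof.
move=> r0 pq; rewrite subr_ge0 step_nd// ler_pM2r ?invr_gt0//; lra.
Qed.

Lemma cutoff_le1 (p q r x : R) : 0 < r -> p <= q -> cutoff p q r x <= 1.
Proof.
move=> r0 pq; rewrite /cutoff; have := step_le1 ((x - p) / r); have := step_ge0 ((x - q) / r).
lra.
Qed.

Lemma cutoff_norm_le1 (p q r x : R) : 0 < r -> p <= q -> `|cutoff p q r x| <= 1.
Proof. by move=> r0 pq; rewrite ger0_norm ?cutoff_ge0 ?cutoff_le1. Qed.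

Lemma cutoff_out (p q r x : R) : 0 < r -> p <= q -> ~ (p - r < x < q + r) -> cutoff p q r x = 0.
Proof.
move=> r0 pq h; rewrite /cutoff; have [xp|px_] := leP x (p - r).
  by rewrite !step_le ?subrr// ler_pdivrMr//; lra.
have xq : q + r <= x by rewrite leNgt; apply/negP => xq; apply: h; rewrite px_.
by rewrite !step_ge ?subrr// ler_pdivlMr//; lra.
Qed.

Lemma cutoff_in (p q r x : R) : 0 < r -> p <= q -> p + r <= x <= q - r -> cutoff p q r x = 1.
Proof.
move=> r0 pq /andP[h1 h2]; rewrite /cutoff step_ge ?step_le ?subr0//.
  by rewrite ler_pdivrMr//; lra.
by rewrite ler_pdivlMr//; lra.
Qed.

Lemma dcutoff_out (p q r x : R) : 0 < r -> p <= q -> ~ (p - r < x < q + r) -> dcutoff p q r x = 0.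
Proof.
move=> r0 pq h; rewrite /dcutoff !bump_out ?mulr0 ?subrr// => /andP[].
  rewrite ltr_pdivlMr// ltr_pdivrMr// => h1 h2; apply: h; apply/andP; split; lra.
rewrite ltr_pdivlMr// ltr_pdivrMr// => h1 h2; apply: h; apply/andP; split; lra.
Qed.

Lemma dcutoff_bounded (p q r : R) : 0 < r -> exists M : R, forall x, `|dcutoff p q r x| <= M.
Proof.
move=> r0; have [M bM] := @bump_bounded R; exists (r^-1 * M + r^-1 * M) => x.
have rV0 : 0 <= r^-1 by rewrite invr_ge0 ltW.
have h y : `|r^-1 * bumpf y| <= r^-1 * M.
  by rewrite ger0_norm; [exact: ler_wpM2l|rewrite mulr_ge0// bump_ge0].
by rewrite (le_trans (ler_normB _ _))// lerD.
Qed.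

End cutoffs.

Section cutoff_limit.
Context {R : realType}.

Lemma cutoff_cvg (p q x : R) : p <= q -> x != p -> x != q ->
  (fun n => cutoff p q n.+1%:R^-1 x) @ \oo --> (\1_(`]p, q[) x : R).
Proof.
have st (c : R) : x != c ->
    (fun n => step ((x - c) / n.+1%:R^-1)) @ \oo --> (((c < x)%R)%:R : R).
  move=> xc; have d0 : 0 < `|x - c| by rewrite normr_gt0 subr_eq0.
  apply: cvg_near_cst; near=> n.
  have nd : `|x - c|^-1 <= n.+1%:R.
    near: n; exists (Num.truncn `|x - c|^-1) => // n /= nn.
    rewrite ltW// (lt_le_trans (truncnS_gt _))// ler_nat ltnS//.
  have h1 : 1 <= `|x - c| * n.+1%:R by rewrite mulrC -ler_pdivrMr// mul1r.
  rewrite invrK; case: ltP => cx.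
    by rewrite step_ge//; move: h1; rewrite ger0_norm ?subr_ge0// ltW.
  rewrite step_le//; move: h1; rewrite ler0_norm ?subr_le0// mulNr; lra.
move=> pq xp xq.
have -> : \1_(`]p, q[) x = ((p < x)%R)%:R - ((q < x)%R)%:R :> R.
  rewrite indicE mem_setE in_itv/=; case: (ltgtP p x) xp => // [px|xp] _.
    by case: (ltgtP x q) xq => // _ _; rewrite ?subr0 ?subrr.
  by rewrite (ltNge q) (le_trans (ltW xp) pq)/= subrr.
by apply: cvgB; exact: st.
Unshelve. all: by end_near. Qed.

End cutoff_limit.

Section tensors.
Context {R : realType}.
Implicit Types f g : R -> R.

Definition tensor f g (z : R * R) : R := f z.1 * g z.2.

Lemma px_tensor f g f' (z : R * R) : is_derive z.1 1 f (f' z.1) ->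
  px (tensor f g) z = tensor f' g z.
Proof.
move=> [fd fv]; rewrite /px /tensor/= derive1Mr//; congr (_ * _).
by rewrite derive1E.
Qed.

Lemma pt_tensor f g g' (z : R * R) : is_derive z.2 1 g (g' z.2) ->
  pt (tensor f g) z = tensor f g' z.
Proof.
move=> [gd gv]; rewrite /pt /tensor/= derive1Ml//; congr (_ * _).
by rewrite derive1E.
Qed.

Lemma has_partials_tensor f g (z : R * R) : derivable f z.1 1 -> derivable g z.2 1 ->
  has_partials (tensor f g) z.
Proof.
move=> fd gd; split; rewrite /tensor/=.
  exact: (derivableM fd (derivable_cst _ _ _)).
exact: (derivableM (derivable_cst _ _ _) gd).
Qed.

Lemma continuous_tensor f g : continuous f -> continuous g -> continuous (tensor f g).
Proof.
move=> cf cg z; apply: cvgM.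
  by apply: continuous_comp; [exact: cvg_fst|exact: cf].
by apply: continuous_comp; [exact: cvg_snd|exact: cg].
Qed.

Lemma Cn_tensor n f g : Sm n f -> Sm n g -> Cn n (tensor f g).
Proof.
elim: n f g => [|n IH] f g; first by move=> cf cg; split => //; exact: continuous_tensor.
move=> fn gn; split.
  by apply: continuous_tensor; [exact: Sm_continuous fn|exact: Sm_continuous gn].
have fn' := SmW fn; have gn' := SmW gn.
move: fn gn => [f' fd f'n] [g' gd g'n]; split.
  by move=> z; apply: has_partials_tensor; [have [] := fd z.1|have [] := gd z.2].
split.
  have -> : px (tensor f g) = tensor f' g by apply/funext => z; exact: px_tensor.
  exact: IH.
have -> : pt (tensor f g) = tensor f g' by apply/funext => z; exact: pt_tensor.
exact: IH.
Qed.

Lemma Cc_infty_tensor (O : set (R * R)) (p q r p' q' r' : R) :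
  0 < r -> p <= q -> 0 < r' -> p' <= q' ->
  `[p - r, q + r]%classic `*` `[p' - r', q' + r']%classic `<=` O ->
  Cc_infty O (tensor (cutoff p q r) (cutoff p' q' r')).
Proof.
move=> r0 pq r'0 pq' sub; split; first by move=> n; apply: Cn_tensor; exact: Sm_cutoff.
exists (`[p - r, q + r]%classic `*` `[p' - r', q' + r']%classic); split => //.
  by apply: compact_setX; exact: segment_compact.
move=> z nz; rewrite /tensor.
have [h|h] := boolP (p - r < z.1 < q + r); last by rewrite cutoff_out ?mul0r//; exact/negP.
have [h'|h'] := boolP (p' - r' < z.2 < q' + r'); last first.
  by rewrite (@cutoff_out _ p' q') ?mulr0//; exact/negP.
exfalso; apply: nz; split; rewrite /= in_itv/=.
  by case/andP : h => /ltW -> /ltW ->.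
by case/andP : h' => /ltW -> /ltW ->.
Qed.

End tensors.

(** * Slices of weakly differentiable functions *)

Section supports.
Context d (T : measurableType d) (R : realType).
Variable mu : {measure set T -> \bar R}.
Implicit Types f g h : T -> R.

Lemma mul_supp_ibl (A : set T) M f h : measurable A -> mu.-integrable A (EFin \o f) ->
  measurable_fun setT h -> (forall x, `|h x| <= M) -> (forall x, ~ A x -> h x = 0) ->
  ibl mu (fun x => f x * h x).
Proof.
move=> mA fi mh hM h0; have := ibl_mulb mh hM (ibl_patch mA fi).
congr (mu.-integrable _ _); apply/funext => x /=; rewrite patchE mulrC.
by case: ifPn => // /negP; rewrite inE => /h0 ->; rewrite !mulr0.
Qed.

Lemma ae_countable (I : countType) (P : I -> T -> Prop) :
  (forall i, {ae mu, forall x, P i x}) -> {ae mu, forall x, forall i, P i x}.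
Proof.
move=> h; pose Q n x := if unpickle n is Some i then P i x else True.
have : {ae mu, forall x, forall n, Q n x}.
  apply: ae_foralln => n; rewrite /Q; case: (unpickle n) => [i|]; first exact: h.
  exact: nearW.
by apply: ae_imp => x hx i; have := hx (pickle i); rewrite /Q pickleK.
Qed.

End supports.

Section lebesgue_points.
Context {R : realType}.
Local Notation leb := (@lebesgue_measure R).
Implicit Types (f g : R -> R) (a b : \bar R).

Lemma ae_neq (c : R) : {ae leb, forall x, x != c}.
Proof.
exists [set c]; split => //; first exact: lebesgue_measure_set1.
by move=> x /= /negP; rewrite negbK => /eqP.
Qed.

(** Local integrability in the open interval. *)
Definition lint a b f := forall p q : R, Iab a b p -> Iab a b q ->
  leb.-integrable `[p, q]%classic (EFin \o f).

Lemma Iab_mid a b (p q x : R) : Iab a b p -> Iab a b q -> p <= x <= q -> Iab a b x.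
Proof.
move=> [ap _] [_ qb] /andP[px xq]; split.
  by rewrite (lt_le_trans ap)// lee_fin.
by rewrite (le_lt_trans _ qb)// lee_fin.
Qed.

Lemma lintB a b f g : lint a b f -> lint a b g -> lint a b (fun x => f x - g x).
Proof.
move=> fl gl p q ap bq.
have m : measurable (`[p, q]%classic : set (measurableTypeR R)) by exact: measurable_itv.
apply: ibl_unpatch => //.
have := iblB (ibl_patch m (fl p q ap bq)) (ibl_patch m (gl p q ap bq)).
congr (leb.-integrable _ (_ \o _)); apply/funext => x; rewrite !patchE.
by case: ifP; rewrite ?subr0.
Qed.

(** Lebesgue points, with the averages written as integrals so that they compare
    directly with integrals against bumps. *)
Definition Lpt f (x : R) := forall e : R, 0 < e -> exists2 d : R, 0 < d &
  forall r : R, 0 < r -> r < d ->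
    (\int[leb]_(y in ball x r) (`|f y - f x|)%:E <= (e * r)%:E)%E.

Let rat_between (x y : R) : x < y -> exists q : rat, x < ratr q < y.
Proof.
move=> xy; have [q] := rat_in_itvoo xy; rewrite in_itv/= => h; by exists q.
Qed.

(** Strictly inside an open interval there is room for rational endpoints. *)
Lemma Iab_rat a b (x : R) : Iab a b x -> exists p q : rat,
  [/\ Iab a b (ratr p), Iab a b (ratr q), ratr p < x & x < ratr q].
Proof.
move=> [ax xb].
have [p [p1 p2]] : exists p : rat, (a < (ratr p)%:E)%E /\ (ratr p : R) < x.
  case: a ax => [a||]//.
    by rewrite lte_fin => /rat_between[p /andP[]]; exists p.
  by have [p /andP[_ h]] := @rat_between (x - 1) x ltac:(lra); exists p; rewrite ltNyr.
have [q [q1 q2]] : exists q : rat, ((ratr q)%:E < b)%E /\ x < (ratr q : R).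
  case: b xb => [b||]//.
    by rewrite lte_fin => /rat_between[q /andP[]]; exists q.
  by have [q /andP[h _]] := @rat_between x (x + 1) ltac:(lra); exists q; rewrite ltry.
exists p, q; split => //; split => //.
  by apply: lt_trans xb; rewrite lte_fin.
by apply: lt_trans ax _; rewrite lte_fin.
Qed.

(** Lebesgue's differentiation theorem for the restrictions of [f] to rational
    subintervals, of which there are countably many. *)
Lemma ae_Lpt a b f : lint a b f -> {ae leb, forall x, Iab a b x -> Lpt f x}.
Proof.
move=> fl.
pose P (i : rat * rat) x := Iab a b (ratr i.1) -> Iab a b (ratr i.2) ->
  ratr i.1 < x < ratr i.2 -> Lpt f x.
have : {ae leb, forall x, forall i, P i x}; last first.
  apply: ae_imp => x Px abx.
  have [p [q [pa qb px xq]]] := Iab_rat abx.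
  by apply: (Px (p, q)) => //; rewrite px.
apply: ae_countable => -[p q]; rewrite /P/=.
have [pa|] := pselect (Iab a b (ratr p)); last by move=> ?; exact: nearW.
have [qb|] := pselect (Iab a b (ratr q)); last by move=> ?; exact: nearW.
set p' := ratr p; set q' := ratr q; pose g := f \_ `[p', q'].
have gl : locally_integrable setT g.
  by apply: integrable_locally_restrict; [exact: measurable_itv|exact: fl].
have := lebesgue_differentiation gl; apply: ae_imp => x gx _ _ /andP[px xq] e e0.
have fg y : p' <= y <= q' -> g y = f y.
  by move=> h; rewrite /g patchE mem_setE in_itv/= h.
have e20 : 0 < e / 2 by rewrite divr_gt0.
have := gx _ (@nbhs_open_ereal_lt _ 0 (fun=> e / 2) e20) => -[d /= d0 dP].
exists (Num.min d (Num.min (x - p') (q' - x))).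
  by rewrite !lt_min d0 !subr_gt0 px.
move=> r r0; rewrite !lt_min => /and3P[rd rp rq].
have := dP r; rewrite /= sub0r normrN (gtr0_norm r0) => /(_ rd r0).
rewrite /davg /iavg lebesgue_measure_ball ?(ltW r0)// inver ifF; last first.
  by apply/negbTE; rewrite mulrn_eq0/= gt_eqF.
have -> : (\int[leb]_(y in ball x r) `|((center (g x) \o g) y)%:E| =
    \int[leb]_(y in ball x r) (`|f y - f x|)%:E)%E.
  apply: eq_integral => y; rewrite inE /ball/= ltr_distlC => /andP[h1 h2].
  by rewrite !fg ?(ltW px) ?(ltW xq)//; apply/andP; split; lra.
move=> h; apply: ltW; move: h.
set I := (\int[leb]_(y in _) _)%E; move=> h.
rewrite (_ : (e * r)%:E = ((r *+ 2)%:E * (e / 2)%:E)%E); last first.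
  by rewrite -EFinM; congr EFin; rewrite -mulr_natl; field.
by rewrite -lte_pdivrMl// mulrn_wgt0.
Qed.

End lebesgue_points.

Section weak_derivative.
Context {R : realType}.
Local Notation leb := (@lebesgue_measure R).
Implicit Types (f : R -> R) (a b : \bar R).

(* The derivative of a cutoff is the difference of two of these mollifiers. *)
Let rho (p r x : R) : R := r^-1 * bumpf ((x - p) / r).

Let mrho p r : measurable_fun setT (rho p r).
Proof.
apply: measurable_funM => //; apply: measurableT_comp.
  by apply: continuous_mfun; exact: continuous_bump.
by apply: measurable_funM => //; exact: measurable_funB.
Qed.

Let rho_ge0 p r x : 0 < r -> 0 <= rho p r x.
Proof. by move=> r0; rewrite mulr_ge0 ?bump_ge0// invr_ge0 ltW. Qed.

Let rho_out p r x : 0 < r -> ~ ball p r x -> rho p r x = 0.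
Proof.
move=> r0 h; rewrite /rho bump_out ?mulr0// ltr_pdivlMr// ltr_pdivrMr// => h2.
by apply: h; rewrite /ball/= ltr_distlC; lra.
Qed.

Let rho_int p r : 0 < r -> (\int[leb]_x (rho p r x)%:E = 1)%E.
Proof.
move=> r0; rewrite (@ge0_integral_affine _ r p)//; last 2 first.
- by apply/measurable_EFinP; exact: mrho.
- by move=> x; rewrite lee_fin rho_ge0.
rewrite (_ : (\int[leb]_x (rho p r (r * x + p))%:E = \int[leb]_x (r^-1%:E * (bumpf x)%:E))%E).
  rewrite integralZl//; last exact: ibl_bump.
  have bi := integrable_fin_num measurableT (@ibl_bump R).
  rewrite -(fineK bi) -!EFinM -[fine _]/(\int[leb]_x bumpf x) Rint_bump mulr1 divff//.
  by rewrite gt_eqF.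
apply: eq_integral => x _; rewrite -EFinM; congr EFin; rewrite /rho addrK mulrAC divff ?mul1r//.
by rewrite gt_eqF.
Qed.

Let rho_ibl p r : 0 < r -> ibl leb (rho p r).
Proof.
move=> r0; apply: ge0_ibl; [exact: mrho|by move=> x; exact: rho_ge0|].
by rewrite rho_int// ltry.
Qed.

Let rho_bound p r M x : 0 < r -> (forall y, bumpf y <= M) -> rho p r x <= r^-1 * M.
Proof. by move=> r0 bM; rewrite ler_wpM2l// invr_ge0 ltW. Qed.

Let rho_mul_ibl a b f p r : lint a b f -> 0 < r -> Iab a b (p - r) -> Iab a b (p + r) ->
  ibl leb (fun x => f x * rho p r x).
Proof.
move=> fl r0 h1 h2; have [M bM] := @bump_bounded R.
apply: (@mul_supp_ibl _ _ _ leb `[p - r, p + r]%classic (r^-1 * M)) => //.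
- exact: fl.
- exact: mrho.
- by move=> x; rewrite ger0_norm ?rho_ge0// rho_bound.
- move=> x h; apply: rho_out => //; apply: contra_not h.
  by rewrite /ball/= ltr_distlC in_itv/= => /andP[h3 h4]; rewrite !ltW.
Qed.

Let near_inv (e : R) : 0 < e -> \forall n \near \oo, n.+1%:R^-1 < e :> R.
Proof.
move=> e0; exists (Num.truncn e^-1) => // n /= nn.
rewrite invf_plt ?posrE// (lt_le_trans (truncnS_gt _))// ler_nat ltnS//.
Qed.

Let rho_cvg a b f p : lint a b f -> Iab a b p -> Lpt f p ->
  (fun n => \int[leb]_x (f x * rho p n.+1%:R^-1 x)) @ \oo --> f p.
Proof.
move=> fl abp fp; have [M0 bM0] := @bump_bounded R.
pose M := `|M0| + 1; have M_gt0 : 0 < M by rewrite ltr_wpDl.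
have bM y : bumpf y <= M.
  by rewrite (le_trans (bM0 y))// (le_trans (ler_norm _))// lerDl.
apply/cvgrPdist_le => e e0.
have eM : 0 < e / M by rewrite divr_gt0.
have [d d0 dP] := fp _ eM.
have [p1 [p2 [ap1 bp2 p1p pp2]]] := Iab_rat abp.
have d1 : 0 < p - ratr p1 by lra.
have d2 : 0 < ratr p2 - p by lra.
near=> n.
have rd : n.+1%:R^-1 < d by near: n; exact: near_inv.
have r1 : n.+1%:R^-1 < p - ratr p1 by near: n; exact: near_inv.
have r2 : n.+1%:R^-1 < ratr p2 - p by near: n; exact: near_inv.
move: rd r1 r2; set r := n.+1%:R^-1 => rd r1 r2; have r0 : 0 < r by rewrite invr_gt0.
have h1 : Iab a b (p - r) by apply: (Iab_mid ap1 abp); apply/andP; split; lra.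
have h2 : Iab a b (p + r) by apply: (Iab_mid abp bp2); apply/andP; split; lra.
have fi := rho_mul_ibl fl r0 h1 h2.
have ci : ibl leb (fun x => f p * rho p r x) by apply: iblZ; exact: rho_ibl.
have -> : f p - \int[leb]_x (f x * rho p r x) = \int[leb]_x ((f p - f x) * rho p r x).
  under [RHS]eq_Rintegral do rewrite mulrBl.
  rewrite RintegralB// RintegralZl//; last exact: rho_ibl.
  by rewrite [X in f p * X](_ : _ = 1) ?mulr1// /Rintegral rho_int.
have di : ibl leb (fun x => (f p - f x) * rho p r x).
  by under eq_fun do rewrite mulrBl; exact: iblB.
rewrite (le_trans (le_normr_Rintegral measurableT di))//.
rewrite -lee_fin /Rintegral fineK; last first.
  by apply: integrable_fin_num => //; exact: ibl_norm di.
have mf : measurable_fun (ball p r) f.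
  have /integrableP[/measurable_EFinP mf _] := fl _ _ h1 h2.
  apply: measurable_funS mf => // x; rewrite /ball/= ltr_distlC in_itv/= => /andP[? ?].
  by rewrite !ltW.
have mb : measurable (ball p r : set R) by exact: measurable_ball.
rewrite (@le_trans _ _ (\int[leb]_(x in ball p r) ((r^-1 * M)%:E * (`|f x - f p|)%:E))%E)//.
  rewrite [leRHS]integral_mkcond; apply: ge0_le_integral => //=.
  - apply/measurable_EFinP; apply: measurableT_comp => //; exact: ibl_mfun di.
  - apply/(measurable_restrictT _ _).1 => //.
    apply/measurable_EFinP; apply: measurable_funM => //; apply: measurableT_comp => //.
    exact: measurable_funB.
  - move=> x _; rewrite patchE; case: ifPn => xb.
      by rewrite -EFinM lee_fin normrM mulrC distrC ler_wpM2r// ger0_norm ?rho_ge0// rho_bound.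
    by rewrite rho_out ?mulr0 ?normr0//; move/negP : xb; rewrite inE.
rewrite ge0_integralZl//; last 2 first.
- apply/measurable_EFinP; apply: measurableT_comp => //; exact: measurable_funB.
- by rewrite lee_fin mulr_ge0 ?invr_ge0 ?(ltW r0)// ltW.
rewrite (le_trans (lee_wpmul2l _ (dP r r0 rd)))//.
  by rewrite lee_fin mulr_ge0 ?invr_ge0 ?(ltW r0)// ltW.
rewrite -EFinM lee_fin le_eqVlt; apply/orP; left; apply/eqP; field.
by rewrite !gt_eqF.
Unshelve. all: by end_near. Qed.

Lemma cutoff_int_cvg a b (B : R -> R) p q : lint a b B -> p < q ->
  Iab a b p -> Iab a b q ->
  (fun n => \int[leb]_x (B x * cutoff p q n.+1%:R^-1 x)) @ \oo -->
    \int[leb]_(x in `]p, q[) B x.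
Proof.
move=> Bl pq abp abq.
have [p1 [_ [ap1 _ p1p _]]] := Iab_rat abp.
have [_ [q1 [_ bq1 _ qq1]]] := Iab_rat abq.
have d1 : 0 < p - ratr p1 by lra.
have d2 : 0 < ratr q1 - q by lra.
pose e := Num.min (p - ratr p1) (ratr q1 - q).
have e0 : 0 < e by rewrite lt_min d1.
pose B1 := B \_ `[ratr p1, ratr q1].
have B1i : ibl leb B1 by apply: ibl_patch; [exact: measurable_itv|exact: Bl].
have mB1 := ibl_mfun B1i.
have E (h : R -> R) : (forall x, ~ (ratr p1 < x < ratr q1) -> h x = 0) ->
    \int[leb]_x (B x * h x) = \int[leb]_x (h x * B1 x).
  move=> h0; apply: eq_Rintegral => x _; rewrite /B1 patchE mem_setE in_itv/= mulrC.
  case: ifPn => // xn; rewrite h0 ?mul0r// => /andP[h1 h2].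
  by move/negP : xn; apply; rewrite !ltW.
rewrite (_ : \int[leb]_(x in `]p, q[) B x = \int[leb]_x (\1_(`]p, q[) x * B1 x)); last first.
  rewrite -E.
    rewrite Rintegral_mkcond; apply: eq_Rintegral => x _; rewrite patchE indicE.
    by case: ifP; rewrite ?mulr1 ?mulr0.
  move=> x h; rewrite indicE mem_setE in_itv/=; case: (boolP (_ && _)) => // /andP[h1 h2].
  by exfalso; apply: h; apply/andP; split; lra.
have cB1 : (fun n => \int[leb]_x (cutoff p q n.+1%:R^-1 x * B1 x)) @ \oo -->
    \int[leb]_x (\1_(`]p, q[) x * B1 x).
  apply: (@Rint_dominated _ _ _ leb _ _ (fun x => `|B1 x|)).
  - by move=> n; apply: measurable_funM => //; exact: measurable_cutoff.
  - by apply: measurable_funM => //; exact: measurable_indic.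
  - apply: ae_imp (ae_and (ae_neq p) (ae_neq q)) => x [xp xq].
    by apply: cvgM; [apply: cutoff_cvg => //; exact: ltW|exact: cvg_cst].
  - exact: ibl_norm.
  - move=> n; apply: nearW => x; by rewrite normrM ler_piMl// cutoff_norm_le1// ltW.
apply: cvg_trans cB1; apply: near_eq_cvg; near=> n.
have re : n.+1%:R^-1 < e by near: n; exact: near_inv.
move: re; rewrite lt_min => /andP[r1 r2].
rewrite -E// => x h; apply: cutoff_out; [by rewrite invr_gt0|exact: ltW|].
by move=> h'; apply: h; move: h' r1 r2; set r := n.+1%:R^-1; lra.
Unshelve. all: by end_near. Qed.

(** Test with cutoffs that converge to the indicator function of the interval: their
    derivatives concentrate at the endpoints, where the averages of [A] converge. *)
Lemma weak_derivative_ftc a b (A B : R -> R) : lint a b A -> lint a b B ->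
  (forall p q r : R, 0 < r -> p <= q -> Iab a b (p - r) -> Iab a b (q + r) ->
    \int[leb]_x (A x * dcutoff p q r x) = - \int[leb]_x (B x * cutoff p q r x)) ->
  forall p q : R, p < q -> Iab a b p -> Iab a b q -> Lpt A p -> Lpt A q ->
  A q - A p = \int[leb]_(x in `]p, q[) B x.
Proof.
move=> Al Bl w p q pq abp abq Ap Aq.
have [p1 [_ [ap1 _ p1p _]]] := Iab_rat abp.
have [_ [q1 [_ bq1 _ qq1]]] := Iab_rat abq.
have d1 : 0 < p - ratr p1 by lra.
have d2 : 0 < ratr q1 - q by lra.
pose e := Num.min (p - ratr p1) (ratr q1 - q).
have e0 : 0 < e by rewrite lt_min d1.
have cA : (fun n => \int[leb]_x (A x * rho p n.+1%:R^-1 x) -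
    \int[leb]_x (A x * rho q n.+1%:R^-1 x)) @ \oo --> A p - A q.
  by apply: cvgB; [exact: rho_cvg Al abp Ap|exact: rho_cvg Al abq Aq].
have cB : (fun n => - \int[leb]_x (B x * cutoff p q n.+1%:R^-1 x)) @ \oo -->
    - \int[leb]_(x in `]p, q[) B x.
  by apply: cvgN; exact: cutoff_int_cvg Bl pq abp abq.
suff : A p - A q = - \int[leb]_(x in `]p, q[) B x by move=> h; rewrite -opprB h opprK.
rewrite -(cvg_lim _ cA)//; apply: cvg_lim => //; apply: cvg_trans cB; apply: near_eq_cvg.
near=> n.
have re : n.+1%:R^-1 < e by near: n; exact: near_inv.
move: re; set r := n.+1%:R^-1; rewrite lt_min => /andP[r1 r2].
have r0 : 0 < r by rewrite invr_gt0.
have h1 : Iab a b (p - r) by apply: (Iab_mid ap1 abp); apply/andP; split; lra.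
have h2 : Iab a b (q + r) by apply: (Iab_mid abq bq1); apply/andP; split; lra.
have h3 : Iab a b (p + r) by apply: (Iab_mid abp h2); apply/andP; split; lra.
have h4 : Iab a b (q - r) by apply: (Iab_mid h1 abq); apply/andP; split; lra.
rewrite -w//; last exact: ltW.
rewrite -RintegralB//; [|exact: rho_mul_ibl Al r0 h1 h3|exact: rho_mul_ibl Al r0 h4 h2].
by apply: eq_Rintegral => x _; rewrite -mulrBr.
Unshelve. all: by end_near. Qed.

(** Countably many tests suffice, as every ball around a Lebesgue point contains a
    rational interval of comparable length. *)
Lemma zero_of_tests c d (w : R -> R) : lint c d w ->
  (forall (s t : rat) (n : nat), (ratr s : R) < ratr t ->
     Iab c d (ratr s - n.+1%:R^-1) -> Iab c d (ratr t + n.+1%:R^-1) ->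
     \int[leb]_x (w x * cutoff (ratr s) (ratr t) n.+1%:R^-1 x) = 0) ->
  {ae leb, forall x, Iab c d x -> w x = 0}.
Proof.
move=> wl w0; apply: ae_imp (ae_Lpt wl) => x xL cdx; have {}xL := xL cdx.
have i0 (s t : rat) : (ratr s : R) < ratr t -> Iab c d (ratr s) -> Iab c d (ratr t) ->
    \int[leb]_(x in `](ratr s), (ratr t)[) w x = 0.
  move=> st cs dt; have [p1 [_ [ap1 _ p1p _]]] := Iab_rat cs.
  have [_ [q1 [_ bq1 _ qq1]]] := Iab_rat dt.
  have d1 : 0 < ratr s - ratr p1 :> R by lra.
  have d2 : 0 < ratr q1 - ratr t :> R by lra.
  rewrite -(cvg_lim _ (cutoff_int_cvg wl st cs dt))//.
  apply: cvg_lim => //; apply: cvg_near_cst; near=> n.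
  have r1 : n.+1%:R^-1 < ratr s - ratr p1 :> R by near: n; exact: near_inv.
  have r2 : n.+1%:R^-1 < ratr q1 - ratr t :> R by near: n; exact: near_inv.
  have r0 : 0 < n.+1%:R^-1 :> R by rewrite invr_gt0.
  apply: w0 => //.
    by apply: (Iab_mid ap1 cs); apply/andP; split; move: r1 r0; set r := _^-1; lra.
  by apply: (Iab_mid dt bq1); apply/andP; split; move: r2 r0; set r := _^-1; lra.
apply/eqP; rewrite -normr_le0; apply/ler_addgt0Pl => e e0; rewrite addr0.
have [dd d0 dP] := xL _ e0.
have [p1 [p2 [ap1 bp2 p1x xp2]]] := Iab_rat cdx.
pose r := Num.min (dd / 2) (Num.min (x - ratr p1) (ratr p2 - x)).
have r0 : 0 < r by rewrite !lt_min divr_gt0//= !subr_gt0 p1x.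
have [rd rp1 rp2] : [/\ r < dd, r <= x - ratr p1 & r <= ratr p2 - x].
  have : r <= r by []. rewrite {2}/r !le_min => /and3P[h1 h2 h3]; split => //; lra.
have h1 : x - r < x - r / 2 by lra.
have h2 : x + r / 2 < x + r by lra.
have [s] := rat_in_itvoo h1; rewrite in_itv/= => /andP[s1 s2].
have [t] := rat_in_itvoo h2; rewrite in_itv/= => /andP[t1 t2].
have cs : Iab c d (ratr s) by apply: (Iab_mid ap1 cdx); apply/andP; split; lra.
have dt : Iab c d (ratr t) by apply: (Iab_mid cdx bp2); apply/andP; split; lra.
have st : (ratr s : R) < ratr t by lra.
have wi : leb.-integrable `](ratr s), (ratr t)[ (EFin \o w).
  apply: (integrableS _ _ _ (wl _ _ cs dt)) => //; exact: subset_itvW.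
have ci : leb.-integrable `](ratr s), (ratr t)[ (EFin \o (fun=> w x)).
  apply: measurable_bounded_integrable => //.
    rewrite /= lebesgue_measure_itv/=; case: ifP => _; by rewrite -?EFinB ltry.
  by exists `|w x|; split; [exact: num_real|move=> M xM y _ /=; exact: ltW].
have E : w x * (ratr t - ratr s) = \int[leb]_(y in `](ratr s), (ratr t)[) (w x - w y).
  rewrite RintegralB// i0// subr0 Rintegral_cst//; congr (_ * _).
  by rewrite /= lebesgue_measure_itv/= lte_fin st.
have di : leb.-integrable `](ratr s), (ratr t)[ (EFin \o (fun y => w x - w y)).
  by apply: (integrableB _ ci wi).
have : `|w x| * (ratr t - ratr s) <= e * r.
  rewrite -[X in _ * X]ger0_norm ?subr_ge0 ?(ltW st)// -normrM E.
  rewrite (le_trans (le_normr_Rintegral _ di))//.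
  rewrite -lee_fin /Rintegral fineK; last first.
    by apply: integrable_fin_num => //; exact: integrable_norm di.
  apply: le_trans (dP r r0 rd).
  under eq_integral do rewrite distrC.
  apply: ge0_subset_integral => //.
  - exact: measurable_ball.
  - have /integrableP[/measurable_EFinP mw _] := wl _ _ ap1 bp2.
    apply/measurable_EFinP; apply: measurableT_comp => //; apply: measurable_funB => //.
    apply: measurable_funS mw => // y; rewrite /ball/= ltr_distlC in_itv/= => /andP[? ?].
    by apply/andP; split; lra.
  - by move=> y; rewrite /= in_itv/= /ball/= ltr_distlC => /andP[? ?]; apply/andP; split; lra.
have rst : r <= ratr t - ratr s by lra.
move=> h; rewrite -(ler_pM2r r0) (le_trans _ h)// ler_wpM2l//.
Unshelve. all: by end_near. Qed.

End weak_derivative.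

Section slices.
Context {R : realType}.
Local Notation leb := (@lebesgue_measure R).
Local Notation leb2 := (leb \x leb)%E.
Variables (a b c d : \bar R) (f g : R * R -> R).

Definition testp (c d : \bar R) (s t r : R) : Prop :=
  [/\ 0 < r, s <= t, Iab c d (s - r) & Iab c d (t + r)].

Hypothesis gi : forall p q s t : R, Iab a b p -> Iab a b q -> Iab c d s -> Iab c d t ->
  leb2.-integrable (`[p, q]%classic `*` `[s, t]%classic) (EFin \o g).

Let rect (p q s t : R) : set (R * R) := `[p, q]%classic `*` `[s, t]%classic.

Let mrect p q s t : measurable (rect p q s t : set (measurableTypeR R * measurableTypeR R)).
Proof. by apply: measurableX; exact: measurable_itv. Qed.

Let gQ p q s t (r : R) (z : R * R) : R :=
  (g \_ (rect p q (s - r) (t + r))) z * cutoff s t r z.2.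

Let gQi p q s t r : Iab a b p -> Iab a b q -> testp c d s t r -> ibl leb2 (gQ p q s t r).
Proof.
move=> abp abq [r0 st cs dt].
have h := ibl_patch (mrect p q (s - r) (t + r)) (gi abp abq cs dt).
have := @ibl_mulb _ _ _ leb2 1 (fun z : R * R => cutoff s t r z.2) _ _ _ h.
under [X in _ -> _ -> integrable _ _ (_ \o X)]eq_fun do rewrite mulrC.
apply; last by move=> z; exact: cutoff_norm_le1.
by apply: (@measurableT_comp _ _ _ _ _ _ (cutoff s t r)) => //; exact: measurable_cutoff.
Qed.

Let gQE p q s t r x y : testp c d s t r ->
  gQ p q s t r (x, y) = \1_(`[p, q]) x * (g (x, y) * cutoff s t r y).
Proof.
move=> [r0 st _ _]; rewrite /gQ patchE indicE.
have [xin|xout] := boolP (x \in `[p, q]%classic); last first.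
  by rewrite memNset ?mul0r// => -[h _]; move/negP : xout; apply; rewrite inE.
rewrite mul1r; case: ifPn => // h; rewrite mul0r cutoff_out ?mulr0// => /andP[h1 h2].
move/negP : h; apply; rewrite inE; split; first by rewrite inE in xin.
by rewrite /= in_itv/= (ltW h1) (ltW h2).
Qed.

Definition Bint (s t r : R) (x : R) : R := \int[leb]_y (g (x, y) * cutoff s t r y).

Let BintE p q s t r x : testp c d s t r ->
  \int[leb]_y gQ p q s t r (x, y) = (Bint s t r \_ `[p, q]) x.
Proof.
move=> tst; under eq_Rintegral do rewrite gQE//.
rewrite patchE indicE; case: ifP => _; first by under eq_Rintegral do rewrite mul1r.
by under eq_Rintegral do rewrite mul0r; rewrite Rintegral_cst// mul0r.
Qed.

Let Bint_lint s t r : testp c d s t r -> lint a b (Bint s t r).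
Proof.
move=> tst p q abp abq; apply: ibl_unpatch; first exact: measurable_itv.
have := ibl_F (gQi abp abq tst); congr (leb.-integrable _ (_ \o _)).
by apply/funext => x; rewrite BintE.
Qed.

Definition Aint (s t r : R) (x : R) : R := \int[leb]_y (f (x, y) * cutoff s t r y).

Hypothesis fl : {ae leb, forall x, Iab a b x -> lint c d (fun y => f (x, y))}.
Hypothesis Al : forall s t r, testp c d s t r -> lint a b (Aint s t r).
Hypothesis weak : forall p q r s t r', testp a b p q r -> testp c d s t r' ->
  \int[leb]_x (Aint s t r' x * dcutoff p q r x) =
  - \int[leb]_x (Bint s t r' x * cutoff p q r x).

Let Good (x : R) : Prop := lint c d (fun y => f (x, y)) /\
  forall i : rat * rat * nat, let: (s, t, n) := i in
    testp c d (ratr s) (ratr t) n.+1%:R^-1 -> Lpt (Aint (ratr s) (ratr t) n.+1%:R^-1) x.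

Let Good_ae : {ae leb, forall x, Iab a b x -> Good x}.
Proof.
have : {ae leb, forall x, forall i : rat * rat * nat, Iab a b x -> let: (s, t, n) := i in
    testp c d (ratr s) (ratr t) n.+1%:R^-1 -> Lpt (Aint (ratr s) (ratr t) n.+1%:R^-1) x}.
  apply: ae_countable => -[[s t] n].
  have [tst|ntst] := pselect (testp c d (ratr s) (ratr t) n.+1%:R^-1); last first.
    by apply: nearW => x _ /ntst.
  by apply: ae_imp (ae_Lpt (Al tst)) => x h abx _; exact: h.
move=> h; apply: ae_imp (ae_and fl h) => x [h1 h2] abx; split; first exact: h1.
by move=> i; have := h2 i abx.
Qed.

(** Tested with products, the weak formulation says that the averages of [f] in the
    second variable against a fixed cutoff have a one-dimensional weak derivative.
    Countably many cutoffs determine a function, and [G] asks for a Lebesgue point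
    of each of the corresponding averages; hence the exceptional set can be chosen
    before [p] and [q]. *)
Lemma weak_slices : exists G : R -> Prop,
  [/\ {ae leb, forall x, Iab a b x -> G x},
      (forall x, G x -> lint c d (fun y => f (x, y))) &
      forall p q, p < q -> Iab a b p -> Iab a b q -> G p -> G q ->
        {ae leb, forall y, Iab c d y ->
           f (q, y) - f (p, y) = \int[leb]_(x in `]p, q[) g (x, y)}].
Proof.
exists Good; split; [exact: Good_ae|by move=> x []|].
move=> p q pq abp abq [fp Lp] [fq Lq].
pose J y := \int[leb]_(x in `]p, q[) g (x, y).
pose h s t (z : R * R) := \1_(`]p, q[) z.1 * (g \_ (rect p q s t)) z.
have hi s t : Iab c d s -> Iab c d t -> ibl leb2 (h s t).
  move=> cs dt; apply: (@ibl_mulb _ _ _ leb2 1).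
  - have mI : measurable_fun setT (\1_(`]p, q[) : measurableTypeR R -> R).
      exact: measurable_indic.
    exact: (measurableT_comp mI measurable_fst).
  - by move=> z; rewrite indicE; case: (_ \in _); rewrite ?normr1 ?normr0.
  - by apply: ibl_patch => //; exact: gi.
have hE s t x y : h s t (x, y) = \1_(`[s, t]) y * (\1_(`]p, q[) x * g (x, y)).
  rewrite /h patchE !indicE; have [xin|_] := boolP (x \in `]p, q[%classic); last first.
    by rewrite !mul0r mulr0.
  have [yin|yout] := boolP (y \in `[s, t]%classic).
    rewrite ifT ?mul1r// inE; rewrite !inE in xin yin; split => //=.
    by move: xin; rewrite /= !in_itv/= => /andP[/ltW -> /ltW ->].
  by rewrite memNset ?mul1r ?mul0r// => -[_ hy]; move/negP : yout; apply; rewrite inE.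
have JE s t y : \int[leb]_x h s t (x, y) = (J \_ `[s, t]) y.
  under eq_Rintegral do rewrite hE.
  rewrite patchE indicE; case: ifP => _; last first.
    by under eq_Rintegral do rewrite mul0r; rewrite Rintegral_cst// mul0r.
  rewrite /J [RHS]Rintegral_mkcond; apply: eq_Rintegral => x _.
  by rewrite mul1r patchE indicE; case: ifP; rewrite ?mul1r ?mul0r.
have Jl : lint c d J.
  move=> s t cs dt; apply: ibl_unpatch; first exact: measurable_itv.
  have := ibl_G (hi s t cs dt); congr (leb.-integrable _ (_ \o _)).
  by apply/funext => y; rewrite JE.
pose w y := f (q, y) - f (p, y) - J y.
suff : {ae leb, forall y, Iab c d y -> w y = 0}.
  by apply: ae_imp => y hy /hy /eqP; rewrite subr_eq0 => /eqP.
apply: zero_of_tests; first by apply: lintB => //; exact: lintB.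
move=> s t n st cs dt; set r := n.+1%:R^-1; set th := cutoff _ _ r.
have tst : testp c d (ratr s) (ratr t) r by split => //; [rewrite invr_gt0|exact: ltW].
have mth : measurable_fun setT th by exact: measurable_cutoff.
have th1 x : `|th x| <= 1.
  by apply: cutoff_norm_le1; [rewrite invr_gt0|exact: ltW].
have th0 x : ~ `[ratr s - r, ratr t + r]%classic x -> th x = 0.
  move=> hx; apply: cutoff_out; [by rewrite invr_gt0|exact: ltW|].
  by move=> /andP[h1 h2]; apply: hx; rewrite /= in_itv/= !ltW.
have Fi (F : R -> R) : lint c d F -> ibl leb (fun y => F y * th y).
  by move=> Fl; apply: (@mul_supp_ibl _ _ _ leb _ 1 F th _ (Fl _ _ cs dt)).
have ftc := weak_derivative_ftc (Al tst) (Bint_lint tst) _ pq abp abq.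
have {}ftc : Aint (ratr s) (ratr t) r q - Aint (ratr s) (ratr t) r p =
    \int[leb]_(x in `]p, q[) Bint (ratr s) (ratr t) r x.
  apply: ftc; [|exact: (Lp (s, t, n))|exact: (Lq (s, t, n))].
  by move=> p' q' r' r0' pq' h1 h2; exact: weak.
under eq_Rintegral do rewrite !mulrBl.
rewrite RintegralB//; [|exact: iblB (Fi _ fq) (Fi _ fp)|exact: Fi].
rewrite RintegralB//; [|exact: Fi|exact: Fi].
rewrite -[X in X - _]/(Aint _ _ _ q - Aint _ _ _ p) ftc.
apply/eqP; rewrite subr_eq0; apply/eqP.
have h1i := hi _ _ cs dt.
have h2i : ibl leb2 (fun z => th z.2 * h (ratr s - r) (ratr t + r) z).
  by apply: (@ibl_mulb _ _ _ leb2 1) => //; exact: (@measurableT_comp _ _ _ _ _ _ th).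
transitivity (\int[leb2]_z (th z.2 * h (ratr s - r) (ratr t + r) z)).
  rewrite -(Rint12 h2i) [LHS]Rintegral_mkcond; apply: eq_Rintegral => x _ /=.
  rewrite patchE; case: ifPn => xin.
    apply: eq_Rintegral => y _; rewrite hE !indicE xin mul1r.
    have [yin|yout] := boolP (y \in _); first by rewrite mul1r mulrC.
    rewrite -[cutoff _ _ _ _]/(th y) th0 ?mulr0 ?mul0r//.
    by move/negP : yout; apply: contra_not; rewrite inE.
  under eq_Rintegral do rewrite hE [\1_(`]p, q[) _]indicE (negbTE xin) mul0r !mulr0.
  by rewrite Rintegral_cst// mul0r.
rewrite -(Rint21 h2i); apply: Rint_ae.
- exact: ibl_mfun (ibl_G h2i).
- exact: ibl_mfun (Fi _ Jl).
apply: ae_imp (ibl_sec2 h1i) => y hy /=.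
rewrite RintegralZl// JE patchE mulrC; case: ifPn => // yout.
rewrite th0 ?mulr0 ?mul0r//.
by move/negP : yout; apply: contra_not; rewrite inE.
Qed.

End slices.

(** * Interval integrals *)

Section interval_integrals.
Context {R : realType}.
Local Notation leb := (@lebesgue_measure R).
Implicit Types (h : R -> R) (x y z p q : R).

(** The interval is encoded by its indicator function, so that the integral is one
    over the whole line and enters Fubini's theorem as such. *)
Definition ii h x y : R := \int[leb]_s (\1_(`]x, y[) s * h s).

Lemma iiE h x y : ii h x y = \int[leb]_(s in `]x, y[) h s.
Proof.
rewrite [RHS]Rintegral_mkcond; apply: eq_Rintegral => s _; rewrite patchE indicE.
by case: ifP; rewrite ?mul1r ?mul0r.
Qed.

(** Local integrability on the whole line. *)
Definition lib h := forall p q, ibl leb (fun s => \1_(`[p, q]) s * h s).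

Lemma measurable_oo x y : measurable_fun setT (\1_(`]x, y[%classic) : measurableTypeR R -> R).
Proof. by []. Qed.

Lemma indic_le1 (A : set R) (s : R) : `|\1_A s| <= 1 :> R.
Proof. by rewrite indicE; case: (_ \in _); rewrite ?normr1 ?normr0. Qed.

Lemma indic_ge0 (A : set R) (s : R) : 0 <= \1_A s :> R.
Proof. by rewrite indicE; case: (_ \in _). Qed.

Lemma RintZ_indic (A : set R) (s : R) (f : R -> R) :
  \int[leb]_t (\1_A s * f t) = \1_A s * \int[leb]_t f t.
Proof.
rewrite indicE; case: (_ \in _) => /=.
  by rewrite mul1r; apply: eq_Rintegral => t _; rewrite mul1r.
by rewrite mul0r; under eq_Rintegral do rewrite mul0r; rewrite Rintegral_cst// mul0r.
Qed.

Lemma ibl_oo h x y : lib h -> ibl leb (fun s => \1_(`]x, y[) s * h s).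
Proof.
move=> /(_ x y) hi; have := @ibl_mulb _ _ _ leb 1 _ _ (measurable_oo x y) (@indic_le1 _) hi.
congr (leb.-integrable _ (_ \o _)); apply/funext => s; rewrite mulrA; congr (_ * _).
rewrite !indicE !mem_setE !in_itv/=; case: (boolP (x < s < y)); rewrite ?mul0r ?mul1r//.
by move=> /andP[/ltW -> /ltW ->].
Qed.

Lemma lib_ibl h : ibl leb h -> lib h.
Proof.
by move=> hi p q; apply: (@ibl_mulb _ _ _ leb 1) => // s; exact: indic_le1.
Qed.

Lemma libD h g : lib h -> lib g -> lib (fun s => h s + g s).
Proof. by move=> hi gi p q; under eq_fun do rewrite mulrDr; exact: iblD. Qed.

Lemma lib_cst (k : R) : lib (fun=> k).
Proof.
move=> p q; under eq_fun do rewrite mulrC.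
by apply: iblZ; exact: integrable_indic_itv.
Qed.

Lemma ii_split h x z y : lib h -> x <= z -> z <= y -> ii h x y = ii h x z + ii h z y.
Proof.
move=> hi xz zy; rewrite /ii -RintegralD//; [|exact: ibl_oo|exact: ibl_oo].
apply: Rint_ae.
- exact: ibl_mfun (ibl_oo _ _ hi).
- by apply: ibl_mfun (iblD _ _); exact: ibl_oo.
apply: ae_imp (ae_neq z) => s sz; rewrite -mulrDl; congr (_ * _).
rewrite !indicE !mem_setE !in_itv/=.
case: (ltgtP s z) sz => // [sz|zs] _; rewrite ?andbT ?andbF.
  by rewrite (lt_le_trans sz zy) andbT addr0.
by rewrite (le_lt_trans xz zs) add0r.
Qed.

Lemma ii_xx h x : ii h x x = 0.
Proof. by rewrite iiE set_itvoo0 Rintegral_set0. Qed.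

Lemma ii_ge0 h x y : (forall s, 0 <= h s) -> 0 <= ii h x y.
Proof. by move=> h0; apply: Rintegral_ge0 => s _; rewrite mulr_ge0// indic_ge0. Qed.

Lemma ii_mono h x y x' y' : lib h -> (forall s, 0 <= h s) -> x' <= x -> y <= y' ->
  ii h x y <= ii h x' y'.
Proof.
move=> hi h0 xx yy; apply: Rint_le_ae; [exact: ibl_oo|exact: ibl_oo|apply: nearW => s].
rewrite ler_wpM2r// !indicE !mem_setE !in_itv/=.
case: (boolP (x < s < y)) => [/andP[xs sy]|_]; last by case: (_ && _).
by rewrite (le_lt_trans xx xs) (lt_le_trans sy yy).
Qed.

Lemma ii_le h g x y : lib h -> lib g ->
  {ae leb, forall s, x < s < y -> h s <= g s} -> ii h x y <= ii g x y.
Proof.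
move=> hi gi hg; apply: Rint_le_ae; [exact: ibl_oo|exact: ibl_oo|].
apply: ae_imp hg => s; rewrite indicE mem_setE in_itv/=.
by case: (x < s < y) => [/(_ isT)|_]; rewrite ?mul1r ?mul0r.
Qed.

Lemma ii_cst (k x y : R) : x <= y -> ii (fun=> k) x y = k * (y - x).
Proof.
move=> xy; rewrite iiE Rintegral_cst//; congr (_ * _).
rewrite /= lebesgue_measure_itv/= lte_fin; case: ltP => //= yx.
by apply/eqP; rewrite eq_sym subr_eq0 eq_le xy yx.
Qed.

Lemma iiZ (k : R) h x y : lib h -> ii (fun s => k * h s) x y = k * ii h x y.
Proof.
by move=> hi; rewrite /ii -RintegralZl//; [apply: eq_Rintegral => s _; ring|exact: ibl_oo].
Qed.

Lemma iiDf h g x y : lib h -> lib g -> ii (fun s => h s + g s) x y = ii h x y + ii g x y.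
Proof.
move=> hi gi; rewrite /ii -RintegralD//; [|exact: ibl_oo|exact: ibl_oo].
by apply: eq_Rintegral => s _; ring.
Qed.

Lemma ii_norm h x y : lib h -> `|ii h x y| <= ii (fun s => `|h s|) x y.
Proof.
move=> hi; rewrite (le_trans (le_normr_Rintegral measurableT (ibl_oo _ _ hi)))//.
rewrite le_eqVlt; apply/orP; left; apply/eqP; apply: eq_Rintegral => s _.
by rewrite normrM (ger0_norm (indic_ge0 _ _)).
Qed.

Lemma lib_norm h : lib h -> lib (fun s => `|h s|).
Proof.
move=> hi p q; have := ibl_norm (hi p q); congr (leb.-integrable _ (_ \o _)).
by apply/funext => s; rewrite normrM (ger0_norm (indic_ge0 _ _)).
Qed.

Lemma ii_continuous h x y : lib h -> x <= y -> {within `[x, y], continuous (ii h x)}.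
Proof.
move=> hi xy.
have hi' : leb.-integrable `[x, y] (EFin \o h).
  apply: ibl_unpatch; first exact: measurable_itv.
  have := hi x y; congr (leb.-integrable _ (_ \o _)); apply/funext => s.
  by rewrite patchE indicE; case: ifP; rewrite ?mul1r ?mul0r.
have := parameterized_integral_continuous xy hi'.
rewrite (_ : (fun z => _) = ii h x)//; apply/funext => z.
rewrite iiE /parameterized_integral.
rewrite /Rintegral integral_itv_bndoo//.
have : leb.-integrable `]x, z[ (EFin \o h).
  apply: ibl_unpatch; first exact: measurable_itv.
  have := ibl_oo x z hi; congr (leb.-integrable _ (_ \o _)); apply/funext => s.
  by rewrite patchE indicE; case: ifP; rewrite ?mul1r ?mul0r.
exact: measurable_int.
Qed.

Lemma ii_small h z (eps : R) : lib h -> 0 < eps ->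
  exists2 d : R, 0 < d & ii h (z - d) (z + d) < eps.
Proof.
move=> hi e0; have z1 : z - 1 < z + 1 by lra.
have [cz _ _] := (continuous_within_itvP _ z1).1 (ii_continuous hi (ltW z1)).
have /cz cz' : z \in `]z - 1, z + 1[ by rewrite in_itv/=; apply/andP; split; lra.
have e20 : 0 < eps / 2 by lra.
have /cvgrPdist_lt/(_ _ e20)/nbhs_ballP[d /= d0 dP] := cz'.
pose r := Num.min (d / 2) (1 / 2).
have rd : r <= d / 2 by rewrite ge_min lexx.
have r1 : r <= 1 / 2 by rewrite ge_min lexx orbT.
have r0 : 0 < r by rewrite lt_min; apply/andP; split; lra.
exists r => //.
have B1 : ball z d (z - r) by rewrite /ball/= opprB addrCA subrr addr0 gtr0_norm//; lra.
have B2 : ball z d (z + r) by rewrite /ball/= opprD addNKr normrN gtr0_norm//; lra.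
have := dP _ B1; have := dP _ B2; rewrite !ltr_norml => /andP[h1 h2] /andP[h3 h4].
have h5 : z - 1 <= z - r by lra.
have h6 : z - r <= z + r by lra.
have := ii_split hi h5 h6; lra.
Qed.

(** Cut the interval where [e] has made between one and two thirds of its increment;
    such points of [Gd] exist as they fill an interval. Since (1/3)^2 + (2/3)^2 = 5/9,
    every subdivision multiplies the sum of the quadratic errors by 5/9 at most. *)
Lemma quadratic_monotone (Gd : R -> Prop) (Phi e : R -> R) (C x0 y0 : R) :
  {ae leb, forall x, x0 < x < y0 -> Gd x} ->
  {within `[x0, y0], continuous e} ->
  (forall x y, x0 <= x -> x < y -> y <= y0 -> e x < e y) ->
  (forall x y, x0 <= x -> x < y -> y <= y0 -> Gd x -> Gd y ->
     - (C * (e y - e x) ^+ 2) <= Phi y - Phi x) ->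
  0 <= C -> x0 < y0 -> Gd x0 -> Gd y0 -> Phi x0 <= Phi y0.
Proof.
move=> aeG ce ie PhiC C0 xy0 Gx0 Gy0.
have step n : forall x y, x0 <= x -> x < y -> y <= y0 -> Gd x -> Gd y ->
    - (C * (5 / 9) ^+ n * (e y - e x) ^+ 2) <= Phi y - Phi x.
  elim: n => [|n IH] x y xx xy yy Gx Gy; first by rewrite expr0 mulr1; exact: PhiC.
  have exy := ie x y xx xy yy.
  have cxy : {within `[x, y], continuous e}.
    apply: continuous_subspaceW ce => z /=; rewrite !in_itv/= => /andP[h1 h2].
    by apply/andP; split; lra.
  have mid (k : R) : 0 <= k <= 1 -> exists2 z, x <= z <= y & e z = e x + k * (e y - e x).
    move=> /andP[k0 k1].
    have : Num.min (e x) (e y) <= e x + k * (e y - e x) <= Num.max (e x) (e y).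
      have exy' := ltW exy; rewrite min_l// max_r//; apply/andP; split; first by rewrite lerDl mulr_ge0//; lra.
      by rewrite -lerBrDl ler_piMl//; lra.
    move=> /(@IVT _ e x y _ (ltW xy) cxy)[z zin ez].
    by exists z => //; rewrite in_itv/= in zin.
  have [z1 /andP[xz1 z1y] e1] := mid (1/3) ltac:(apply/andP; split; lra).
  have [z2 /andP[xz2 z2y] e2] := mid (2/3) ltac:(apply/andP; split; lra).
  have z12 : z1 < z2.
    rewrite ltNge; apply/negP => z21.
    have : e z2 <= e z1.
      move: z21; rewrite le_eqVlt => /predU1P[->//|z21]; apply/ltW/ie => //; lra.
    by rewrite e1 e2; lra.
  have aeGz : {ae leb, forall s, z1 < s < z2 -> Gd s}.
    by apply: ae_imp aeG => s + /andP[h1 h2]; apply; apply/andP; split; lra.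
  have [z [/andP[z1z zz2] Gz]] := ae_pick aeGz z12.
  have h1 : e z1 < e z by apply: ie; lra.
  have h2 : e z < e z2 by apply: ie; lra.
  have i1 := IH x z xx ltac:(lra) ltac:(lra) Gx Gz.
  have i2 := IH z y ltac:(lra) ltac:(lra) yy Gz Gy.
  rewrite exprS; set A := C * (5 / 9) ^+ n in i1 i2.
  have A0 : 0 <= A by rewrite mulr_ge0// exprn_ge0//; lra.
  have -> : C * (5 / 9 * (5 / 9) ^+ n) * (e y - e x) ^+ 2 = A * (5 / 9 * (e y - e x) ^+ 2).
    by rewrite /A; ring.
  have : A * ((e z - e x) ^+ 2 + (e y - e z) ^+ 2) <= A * (5 / 9 * (e y - e x) ^+ 2).
    rewrite ler_wpM2l//; rewrite e1 in h1; rewrite e2 in h2.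
    set X := e z - e x; set Y := e y - e x.
    have -> : e y - e z = Y - X by rewrite /X /Y; ring.
    have : 0 <= (X - Y / 3) * (2 * Y / 3 - X).
      by rewrite mulr_ge0// /X /Y; lra.
    by rewrite !expr2; nra.
  rewrite mulrDr; lra.
rewrite leNgt; apply/negP => PP.
have e0 : 0 < Phi x0 - Phi y0 by lra.
pose B := C * (e y0 - e x0) ^+ 2.
have cv : (fun n => (5 / 9 : R) ^+ n * B) @ \oo --> (0 : R).
  rewrite -[X in _ --> X](mul0r B); apply: cvgM; last exact: cvg_cst.
  by apply: cvg_expr; rewrite ger0_norm; lra.
have [n _ /(_ n (leqnn n))] := (cvgrPdist_lt _ _).1 cv _ e0; rewrite sub0r normrN.
have := step n x0 y0 (lexx _) xy0 (lexx _) Gx0 Gy0.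
rewrite /B => h1 h2; have := le_lt_trans (ler_norm _) h2.
have -> : (5 / 9) ^+ n * (C * (e y0 - e x0) ^+ 2) = C * (5 / 9) ^+ n * (e y0 - e x0) ^+ 2 by ring.
lra.
Qed.

End interval_integrals.

(** * The energy inequality *)

Section energy.
Context {R : realType}.
Local Notation leb := (@lebesgue_measure R).
Local Notation leb2 := (leb \x leb)%E.
Variables (q T : R).
Hypotheses (q1 : -1 < q) (q2 : q < - 2^-1).
Local Notation k := (kcut (q + q + 1) T).

Let ki : ibl leb k.
Proof. by move: q1 => h; apply: ibl_kcut; lra. Qed.

(** The left-sided fractional integral in time, up to a constant factor. *)
Definition fint (f : R -> R) (t : R) : R := \int[leb]_r (k (t - r) * f r).

Lemma fint_kernel_ibl f : ibl leb f -> ibl leb2 (fun z => f z.1 * k (z.2 - z.1)).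
Proof.
move=> fi.
have ki' : ibl leb (fun y => k (0 - y)) by apply: ibl_reflect.
have := @conv_ibl _ _ _ (fun=> 1) 1 ki' fi (measurable_cst _) (fun=> ltac:(rewrite normr1//)).
congr (leb2.-integrable _ (_ \o _)); apply/funext => z; rewrite mulr1 sub0r opprB//.
Qed.

Lemma fint_ibl f : ibl leb f -> ibl leb (fint f).
Proof.
move=> fi; have := ibl_G (fint_kernel_ibl fi).
by congr (leb.-integrable _ (_ \o _)); apply/funext => t; apply: eq_Rintegral => r _; rewrite mulrC.
Qed.

(** The left-sided and the right-sided fractional integral are adjoint, by Fubini's
    theorem. *)
Lemma fint_adjoint (f w : R -> R) (M : R) : ibl leb f -> measurable_fun setT w -> (forall t, `|w t| <= M) ->
  \int[leb]_t (w t * fint f t) = \int[leb]_r (f r * \int[leb]_t (w t * k (t - r))).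
Proof.
move=> fi mw wM; have zi := fint_kernel_ibl fi.
have mw2 : measurable_fun setT (fun z : R * R => w z.2) by exact: measurableT_comp.
have wzi := @ibl_mulb _ _ _ leb2 M _ _ mw2 (fun z => wM z.2) zi.
transitivity (\int[leb2]_z (w z.2 * (f z.1 * k (z.2 - z.1)))).
  rewrite -(Rint21 wzi); apply: Rint_ae.
  - by apply: measurable_funM => //; exact: ibl_mfun (fint_ibl fi).
  - exact: ibl_mfun (ibl_G wzi).
  apply: ae_imp (ibl_sec2 zi) => t ti /=; rewrite RintegralZl//; congr (_ * _).
  by apply: eq_Rintegral => r _; rewrite mulrC.
rewrite -(Rint12 wzi); apply: eq_Rintegral => r _ /=.
rewrite -RintegralZl//; first by apply: eq_Rintegral => t _; ring.
exact: (@ibl_mulb _ _ _ leb M _ _ mw wM (@ibl_shift _ (- r) _ ki)).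
Qed.

(** Below, [u] stands for the difference of two solutions on a shortened cylinder,
    [v] for the difference of their potentials and [V] for its space derivative, all
    extended by zero. The points of [G] are those at which slices behave well.
    [GV], [Gv] and [GW] say that the slices of [V] are integrable, that [v] is a primitive of [V]
    in the interval from [a] to [b], and that the fractional integral of [V] is a
    primitive of [c * u] on the whole line. As [V] vanishes beyond a finite endpoint,
    the last statement contains the boundary condition there. *)
Variables (a b : \bar R) (c : R) (u v V : R * R -> R) (m : R -> R) (L : R -> R).
Variable G : R -> Prop.
Hypotheses (T0 : 0 < T) (c0 : 0 < c).
Hypotheses (mu : measurable_fun setT u) (mv : measurable_fun setT v)
  (mV : measurable_fun setT V) (mm : measurable_fun setT m).
Hypotheses (um : forall z, `|u z| <= m z.1) (vm : forall z, `|v z| <= L (m z.1)).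
Hypotheses (ut : forall x t, ~ (0 < t < T) -> u (x, t) = 0)
  (vt : forall x t, ~ (0 < t < T) -> v (x, t) = 0).
Hypotheses (ml : lib m) (uv0 : forall z, 0 <= u z * v z).
Hypothesis Vl : forall x y, ibl leb2 (fun z => \1_(`[x, y]) z.1 * V z).
Hypothesis Gae : {ae leb, forall x, G x}.
Hypothesis GV : forall x, G x -> ibl leb (fun t => V (x, t)).
Hypothesis Gv : forall x y, x < y -> Iab a b x -> Iab a b y -> G x -> G y ->
  {ae leb, forall t, v (y, t) - v (x, t) = ii (fun s => V (s, t)) x y}.
Hypothesis GW : forall x y, x < y -> G x -> G y ->
  {ae leb, forall t, 0 < t < T ->
     fint (fun r => V (y, r)) t - fint (fun r => V (x, r)) t = c * ii (fun s => u (s, t)) x y}.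

Let N (s : R) : R := \int[leb]_t `|V (s, t)|.
Let W (x t : R) : R := fint (fun r => V (x, r)) t.

Let m0 x : 0 <= m x. Proof. by rewrite (le_trans _ (um (x, 0))). Qed.

Let N0 s : 0 <= N s. Proof. exact: Rintegral_ge0. Qed.

Let Nl : lib N.
Proof.
move=> x y; have := ibl_F (ibl_norm (Vl x y)).
congr (leb.-integrable _ (_ \o _)); apply/funext => s /=.
by rewrite -RintZ_indic; apply: eq_Rintegral => t _; rewrite normrM (ger0_norm (indic_ge0 _ _)).
Qed.

Let Voo x y : ibl leb2 (fun z => \1_(`]x, y[) z.1 * V z).
Proof.
have mi : measurable_fun setT (fun z : R * R => (\1_(`]x, y[) z.1 : R)).
  by apply: (@measurableT_comp _ _ _ _ _ _ (\1_(`]x, y[%classic) : _ -> R)).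
have := @ibl_mulb _ _ _ leb2 1 _ _ mi (fun z => indic_le1 _ _) (Vl x y).
congr (leb2.-integrable _ (_ \o _)); apply/funext => z; rewrite mulrA; congr (_ * _).
rewrite !indicE !mem_setE !in_itv/=; case: (boolP (x < z.1 < y)); rewrite ?mul0r ?mul1r//.
by move=> /andP[/ltW -> /ltW ->].
Qed.


Let D x y t := v (y, t) - v (x, t).

Let mvs x : measurable_fun setT (fun t => v (x, t)).
Proof. exact: mfun_sec1. Qed.

Let mD x y : measurable_fun setT (D x y).
Proof. by apply: measurable_funB. Qed.

Let DM x y t : `|D x y t| <= L (m y) + L (m x).
Proof. by rewrite (le_trans (ler_normB _ _))// lerD// (vm (_, t)). Qed.

Let Dt x y t : ~ (0 < t < T) -> D x y t = 0.
Proof. by move=> h; rewrite /D !vt// subrr. Qed.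

Let vi x : ibl leb (fun t => v (x, t)).
Proof. exact: (@bounded_supp_ibl R T _ (L (m x)) (mvs x) (fun t => vm (x, t)) (fun t => @vt x t)). Qed.

Let Di x y : ibl leb (D x y).
Proof. exact: iblB. Qed.

Let increment_bound x y : x < y -> Iab a b x -> Iab a b y -> G x -> G y ->
  \int[leb]_t `|D x y t| <= ii N x y.
Proof.
move=> xy ax ay Gx Gy; have Vi := Voo x y; have nVi := ibl_norm Vi.
have -> : ii N x y = \int[leb]_t \int[leb]_s `|\1_(`]x, y[) s * V (s, t)|.
  rewrite (Rint21 nVi) -(Rint12 nVi); apply: eq_Rintegral => s _ /=.
  by rewrite -RintZ_indic; apply: eq_Rintegral => t _; rewrite normrM (ger0_norm (indic_ge0 _ _)).
apply: Rint_le_ae; [by apply: ibl_norm|exact: ibl_G nVi|].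
apply: ae_imp (ae_and (Gv xy ax ay Gx Gy) (ibl_sec2 Vi)) => t [Dxy ti]; rewrite /D Dxy.
exact: le_normr_Rintegral.
Qed.

Let UM x y t : `|ii (fun s => u (s, t)) x y| <= ii m x y.
Proof.
have ul : lib (fun s => u (s, t)).
  move=> p r; apply: (@ibl_le _ _ _ leb (fun s => \1_(`[p, r]) s * m s)) => //.
    by apply: measurable_funM => //; exact: mfun_sec2.
  by move=> s; rewrite normrM (ger0_norm (indic_ge0 _ _)) ler_wpM2l ?indic_ge0// (um (s, t)).
apply: le_trans (ii_norm _ _ ul) _; apply: ii_le => //; first exact: lib_norm.
by apply: nearW => s _; exact: (um (s, t)).
Qed.

Let uoo x y : ibl leb2 (fun z => \1_(`]x, y[) z.1 * u z).
Proof.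
have i1 := ibl_oo x y ml; have i2 : ibl leb (\1_(`]0, T[) : R -> R) by exact: integrable_indic_itv.
apply: (@ibl_le _ _ _ leb2 _ _ _ _ (ibl_prod i1 i2)).
  by apply: measurable_funM => //; apply: (@measurableT_comp _ _ _ _ _ _ (\1_(`]x, y[%classic) : _ -> R)).
move=> [s t] /=; rewrite normrM (ger0_norm (indic_ge0 _ _)) -mulrA ler_wpM2l ?indic_ge0//.
rewrite indicE mem_setE in_itv/=.
by have [_|/negP/ut ->] := boolP (0 < t < T); rewrite ?mulr1 ?normr0 ?mulr0//; exact: (um (s, t)).
Qed.

Let UMi (w : R -> R) x y : ibl leb w -> ibl leb (fun t => w t * ii (fun s => u (s, t)) x y).
Proof.
move=> wi; have mii := ibl_mfun (ibl_G (uoo x y)).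
have := @ibl_mulb _ _ _ leb (ii m x y) _ _ mii (UM x y) wi.
by congr (leb.-integrable _ (_ \o _)); apply/funext => t; rewrite mulrC.
Qed.

Let P x y s := \int[leb]_t (D x y t * W s t).

Let DWi x y s : G s -> ibl leb (fun t => D x y t * W s t).
Proof.
move=> Gs; exact: (@ibl_mulb _ _ _ leb _ _ _ (mD x y) (DM x y) (fint_ibl (GV Gs))).
Qed.

Let P_diff x y r s : r < s -> G r -> G s ->
  P x y s - P x y r = c * \int[leb]_t (D x y t * ii (fun s => u (s, t)) r s).
Proof.
move=> rs Gr Gs; have Ui := UMi r s (Di x y).
rewrite /P -RintegralB//; [|exact: DWi|exact: DWi]; rewrite -RintegralZl//.
apply: Rint_ae; first by apply: ibl_mfun (iblB _ _); exact: DWi.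
  exact: ibl_mfun (iblZ c Ui).
apply: ae_imp (GW rs Gr Gs) => t Wt; rewrite -mulrBr mulrCA.
by have [/Wt ->//|/negP/Dt ->] := boolP (0 < t < T); rewrite !mul0r.
Qed.

Let DU_le x y r s : `|\int[leb]_t (D x y t * ii (fun s => u (s, t)) r s)| <=
  ii m r s * \int[leb]_t `|D x y t|.
Proof.
have Ui := UMi r s (Di x y); have nDi := ibl_norm (Di x y).
rewrite -RintegralZl//; apply: Rint_norm_le => //; first exact: iblZ.
by apply: nearW => t; rewrite normrM mulrC ler_wpM2r.
Qed.

(* The increment of [v] being the integral of [V], positivity of the kernel applied to
   the increment says that the pairings [P x y s] have nonnegative mean over [s]. *)
Let P_mean x y : x < y -> Iab a b x -> Iab a b y -> G x -> G y ->
  exists2 Pt : R -> R, ibl leb Pt & 0 <= \int[leb]_s Pt s /\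
    {ae leb, forall s, Pt s = \1_(`]x, y[) s * P x y s}.
Proof.
move=> xy ax ay Gx Gy; pose M := L (m y) + L (m x).
pose H r := \int[leb]_t (D x y t * k (t - r)).
have mH : measurable_fun setT H.
  have := @conv_ibl _ _ _ (fun=> 1) 1 ki (Di x y) (measurable_cst _) (fun=> ltac:(rewrite normr1//)).
  move=> /ibl_G/ibl_mfun; congr (measurable_fun _ _); apply/funext => r.
  by apply: eq_Rintegral => t _ /=; rewrite mulr1.
have M0 : 0 <= M by rewrite (le_trans _ (DM x y 0)).
have HM r : `|H r| <= M * \int[leb]_t `|k t|.
  have kr := @ibl_shift _ (- r) _ ki; have nkr := ibl_norm kr.
  have <- : M * \int[leb]_t `|k (t - r)| = M * \int[leb]_t `|k t|.
    have mk : measurable_fun setT (fun t => (`|k t|)%:E).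
      by apply/measurable_EFinP; apply: measurableT_comp => //; exact: ibl_mfun ki.
    by rewrite /Rintegral (@ge0_integral_shift _ (- r) _ mk).
  rewrite -RintegralZl//; apply: Rint_norm_le; last first.
  - by apply: nearW => t; rewrite normrM ler_wpM2r// DM.
  - exact: iblZ.
  - exact: (@ibl_mulb _ _ _ leb _ _ _ (mD x y) (DM x y) kr).
have mH2 : measurable_fun setT (fun z : R * R => H z.2) by exact: measurableT_comp.
have Zi := @ibl_mulb _ _ _ leb2 _ _ _ mH2 (fun z => HM z.2) (Voo x y).
exists (fun s => \int[leb]_r (H r * (\1_(`]x, y[) s * V (s, r)))); first exact: ibl_F Zi.
split; last first.
  apply: ae_imp Gae => s Gs; rewrite /P (fint_adjoint (GV Gs) (mD x y) (DM x y)).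
  by rewrite -RintZ_indic; apply: eq_Rintegral => r _; rewrite /H; ring.
have := @frac_kernel_ge0 _ _ T M _ q1 q2 (mD x y) (DM x y) (fun t => @Dt x y t).
rewrite (fint_adjoint (Di x y) (mD x y) (DM x y)).
move=> /le_trans; apply; rewrite (Rint12 Zi) -(Rint21 Zi) le_eqVlt; apply/orP; left; apply/eqP.
apply: Rint_ae; [|exact: ibl_mfun (ibl_G Zi)|].
  exact: measurable_funM (mD x y) mH.
apply: ae_imp (ae_and (Gv xy ax ay Gx Gy) (ibl_sec2 (Voo x y))) => r [Dr ri].
by rewrite -/(H r) {1}/D Dr mulrC /= RintegralZl.
Qed.

(* The pairings for [s] in the interval differ from the one at [x] by a product of two
   increments at most. *)
Let P_bound x y : x < y -> Iab a b x -> Iab a b y -> G x -> G y ->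
  - (c * (ii m x y * ii N x y)) <= P x y x.
Proof.
move=> xy ax ay Gx Gy; have [Pt Pti [Pt0 PtE]] := P_mean xy ax ay Gx Gy.
have UM0 : 0 <= ii m x y by exact: ii_ge0.
rewrite -subr_ge0 opprK -(@pmulr_rge0 _ (y - x)) ?subr_gt0//.
apply: (le_trans Pt0); rewrite mulrC -(ii_cst _ (ltW xy)).
apply: Rint_le_ae => //; first by apply: ibl_oo; exact: lib_cst.
apply: ae_imp (ae_and PtE Gae) => s [-> Gs].
rewrite indicE mem_setE in_itv/=.
have [/andP[xs sy]|_] := boolP (x < s < y); last by rewrite !mul0r.
rewrite !mul1r -lerBlDl P_diff// ler_wpM2l ?(ltW c0)//.
apply: (le_trans (ler_norm _)); apply: (le_trans (DU_le _ _ _ _)).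
rewrite ler_pM// ?ii_ge0//; first exact: Rintegral_ge0.
  by apply: ii_mono => //; exact: ltW.
exact: increment_bound.
Qed.

(* The energy, and its expected growth rate [c * S]. *)
Let F x := \int[leb]_t (v (x, t) * W x t).
Let S s := \int[leb]_t (u (s, t) * v (s, t)).

Let vWi x s : G s -> ibl leb (fun t => v (x, t) * W s t).
Proof.
by move=> Gs; exact: (@ibl_mulb _ _ _ leb (L (m x)) (fun t => v (x, t)) _ (mvs x) (fun t => vm (x, t)) (fint_ibl (GV Gs))).
Qed.

Let wui (w : R -> R) s : ibl leb w -> ibl leb (fun t => u (s, t) * w t).
Proof. by apply: (@ibl_mulb _ _ _ leb (m s)); [exact: mfun_sec1|move=> t; exact: (um (s, t))]. Qed.

Let wu_le (w : R -> R) s : ibl leb w ->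
  \int[leb]_t `|u (s, t) * w t| <= m s * \int[leb]_t `|w t|.
Proof.
move=> wi; have nwi := ibl_norm wi; rewrite -RintegralZl//; apply: Rint_le_ae.
- by apply: ibl_norm; exact: wui.
- exact: iblZ.
by apply: nearW => t; rewrite normrM ler_wpM2r// (um (s, t)).
Qed.

Let SI x y : x < y -> Iab a b x -> Iab a b y -> G x -> G y ->
  ibl leb2 (fun z => \1_(`]x, y[) z.1 * (u z * v z)).
Proof.
move=> xy ax ay Gx Gy.
pose B := \int[leb]_t `|v (x, t)| + ii N x y.
apply: (@tonelli_ibl_ae _ _ _ _ _ leb leb _ (fun s => B * (\1_(`]x, y[) s * m s))).
- by apply: measurable_funM; [apply: (@measurableT_comp _ _ _ _ _ _ (\1_(`]x, y[%classic) : _ -> R))|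
    exact: measurable_funM].
- by apply: iblZ; exact: ibl_oo.
apply: ae_imp Gae => s Gs /=.
under eq_integral do rewrite normrM (ger0_norm (indic_ge0 _ _)).
have uvi := ibl_norm (wui s (vi s)).
have := integrable_fin_num measurableT (iblZ (\1_(`]x, y[) s) uvi) => /fineK <-.
rewrite lee_fin -[fine _]/(\int[leb]_t (\1_(`]x, y[) s * `|u (s, t) * v (s, t)|)).
rewrite RintZ_indic mulrCA; rewrite indicE mem_setE in_itv/=.
have [/andP[xs sy]|_] := boolP (x < s < y); last by rewrite !mul0r.
rewrite !mul1r; apply: (le_trans (wu_le _ (vi s))); rewrite mulrC ler_wpM2r//.
apply: (@le_trans _ _ (\int[leb]_t (`|v (x, t)| + `|D x s t|))).
  apply: Rint_le_ae; [exact: ibl_norm|by apply: iblD; exact: ibl_norm|apply: nearW => t].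
  by rewrite (le_trans _ (ler_normD _ _))// /D addrCA subrr addr0.
rewrite RintegralD//; [|exact: ibl_norm|exact: ibl_norm]; rewrite lerD2l.
have as_ : Iab a b s by apply: (Iab_mid ax ay); rewrite !ltW.
by apply: (le_trans (increment_bound xs ax as_ Gx Gs)); apply: ii_mono => //; exact: ltW.
Qed.

(* The formal identity is F' = \int V * (k * V) + c * S. Its first term, which is
   nonnegative, need not be finite; increments replace derivatives, at the expense of
   an error that is a product of two increments. *)
Let F_inc x y : x < y -> Iab a b x -> Iab a b y -> G x -> G y ->
  c * ii S x y - 3 * c * (ii m x y * ii N x y) <= F y - F x.
Proof.
move=> xy ax ay Gx Gy; pose UV := ii m x y * ii N x y.
pose Q := \int[leb]_t (v (x, t) * ii (fun s => u (s, t)) x y).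
have UM0 : 0 <= ii m x y by exact: ii_ge0.
have FE : F y - F x = P x y y + c * Q.
  have -> : F y = P x y y + \int[leb]_t (v (x, t) * W y t).
    rewrite -RintegralD//; [|exact: DWi|exact: vWi].
    by apply: eq_Rintegral => t _; rewrite -mulrDl /D subrK.
  rewrite -addrA; congr (_ + _); rewrite /Q -RintegralB//; [|exact: vWi|exact: vWi].
  have Ui := UMi x y (vi x); rewrite -RintegralZl//; apply: Rint_ae.
  - by apply: ibl_mfun (iblB _ _); exact: vWi.
  - exact: ibl_mfun (iblZ c Ui).
  apply: ae_imp (GW xy Gx Gy) => t Wt; rewrite -mulrBr mulrCA.
  by have [/Wt ->//|/negP/(@vt x) ->] := boolP (0 < t < T); rewrite !mul0r.
have Py : - (2 * c * UV) <= P x y y.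
  pose I := \int[leb]_t (D x y t * ii (fun s => u (s, t)) x y).
  have /andP[I_ge _] : - UV <= I <= UV.
    rewrite -ler_norml; apply: (le_trans (DU_le _ _ _ _)).
    by apply: ler_wpM2l => //; exact: increment_bound.
  have -> : P x y y = P x y x + c * I by rewrite -(P_diff x y xy Gx Gy) addrC subrK.
  have -> : - (2 * c * UV) = - (c * UV) + c * - UV by ring.
  by apply: lerD; [exact: P_bound|rewrite (ler_pM2l c0)].
have SQ : ii S x y <= Q + UV.
  have mv2 : measurable_fun setT (fun z : R * R => v (x, z.2)).
    by apply: (@measurableT_comp _ _ _ _ _ _ (fun t => v (x, t))).
  have Zi := @ibl_mulb _ _ _ leb2 (L (m x)) (fun z => v (x, z.2)) _ mv2 (fun z => vm (x, z.2)) (uoo x y).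
  have -> : Q = \int[leb]_s \int[leb]_t (v (x, t) * (\1_(`]x, y[) s * u (s, t))).
    rewrite (Rint12 Zi) -(Rint21 Zi); apply: Rint_ae.
    - by apply: ibl_mfun; exact: UMi.
    - exact: ibl_mfun (ibl_G Zi).
    by apply: ae_imp (ibl_sec2 (uoo x y)) => t ti /=; rewrite RintegralZl.
  have Si := ibl_F (SI xy ax ay Gx Gy).
  have mi := ibl_oo x y ml.
  have -> : UV = \int[leb]_s (ii N x y * (\1_(`]x, y[) s * m s)) by rewrite RintegralZl// mulrC.
  rewrite -RintegralD//; [|exact: ibl_F Zi|exact: iblZ].
  apply: Rint_le_ae.
  - move: Si; congr (leb.-integrable _ (_ \o _)); apply/funext => s /=.
    by rewrite RintZ_indic.
  - by apply: iblD; [exact: ibl_F Zi|exact: iblZ].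
  apply: ae_imp Gae => s Gs.
  have -> : \int[leb]_t (v (x, t) * (\1_(`]x, y[) s * u (s, t))) =
      \1_(`]x, y[) s * \int[leb]_t (u (s, t) * v (x, t)).
    by rewrite -RintZ_indic; apply: eq_Rintegral => t _; ring.
  rewrite indicE mem_setE in_itv/=.
  have [/andP[xs sy]|_] := boolP (x < s < y); last by rewrite !mul0r mulr0 addr0.
  have as_ : Iab a b s by apply: (Iab_mid ax ay); rewrite !ltW.
  rewrite !mul1r -lerBlDl /S -RintegralB//; [|by apply: wui|by apply: wui].
  under eq_Rintegral do rewrite -mulrBr.
  apply: (le_trans (ler_norm _)).
  apply: (le_trans (le_normr_Rintegral measurableT (wui s (Di x s)))).
  apply: (le_trans (wu_le s (Di x s))); rewrite [leRHS]mulrC; apply: ler_wpM2l; first exact: m0.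
  by apply: (le_trans (increment_bound xs ax as_ Gx Gs)); apply: ii_mono => //; exact: ltW.
have -> : c * ii S x y - 3 * c * (ii m x y * ii N x y) =
    - (2 * c * UV) + c * (ii S x y - UV) by rewrite /UV; ring.
by rewrite FE; apply: lerD => //; rewrite (ler_pM2l c0) lerBlDr.
Qed.

Let F_mono x0 y0 : x0 < y0 -> Iab a b x0 -> Iab a b y0 -> G x0 -> G y0 ->
  c * ii S x0 y0 <= F y0 - F x0.
Proof.
move=> xy0 ax0 ay0 Gx0 Gy0.
pose S' s := \1_(`]x0, y0[) s * S s.
have S'l : lib S'.
  apply: lib_ibl; move: (ibl_F (SI xy0 ax0 ay0 Gx0 Gy0)).
  by congr (leb.-integrable _ (_ \o _)); apply/funext => s /=; rewrite RintZ_indic.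
have SS' x y : x0 <= x -> y <= y0 -> ii S' x y = ii S x y.
  move=> xx yy; apply: eq_Rintegral => s _; rewrite /S' mulrA; congr (_ * _).
  rewrite !indicE !mem_setE !in_itv/=; have [/andP[xs sy]|_] := boolP (x < s < y); last by rewrite mul0r.
  by rewrite mul1r (le_lt_trans xx xs) (lt_le_trans sy yy).
have l1 : lib (fun=> 1 : R) by exact: lib_cst.
have mNl := libD ml Nl.
(* the summand 1 makes [e] strictly increasing *)
pose e x := ii (fun s => 1 + (m s + N s)) x0 x.
have el : lib (fun s => 1 + (m s + N s)) by exact: libD.
have einc x y : x0 <= x -> x < y -> y <= y0 -> e y - e x = (y - x) + (ii m x y + ii N x y).
  move=> xx xy yy; rewrite /e (ii_split el xx (ltW xy)) addrAC subrr add0r !iiDf//.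
  by rewrite ii_cst ?mul1r// ltW.
have mge x y : 0 <= ii m x y by exact: ii_ge0.
have Nge x y : 0 <= ii N x y by exact: ii_ge0.
have C0 : 0 <= 3 * c by rewrite mulr_ge0// ltW.
have : F x0 - c * ii S' x0 x0 <= F y0 - c * ii S' x0 y0; last first.
  rewrite ii_xx mulr0 subr0 (SS' _ _ (lexx x0) (lexx y0)) => h.
  by rewrite lerBrDr addrC -lerBrDr.
apply: (@quadratic_monotone _ G (fun x => F x - c * ii S' x0 x) e (3 * c) x0 y0) => //.
- by apply: ae_imp Gae => x Gx _.
- exact: ii_continuous (ltW xy0).
- by move=> x y xx xy yy; rewrite -subr_gt0 einc// ltr_wpDr ?addr_ge0// subr_gt0.
move=> x y xx xy yy Gx Gy; rewrite einc//.
have ax : Iab a b x by apply: (Iab_mid ax0 ay0); rewrite xx/=; lra.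
have ay : Iab a b y by apply: (Iab_mid ax0 ay0); rewrite yy andbT; lra.
have -> : F y - c * ii S' x0 y - (F x - c * ii S' x0 x) = F y - F x - c * ii S x y.
  rewrite (ii_split S'l xx (ltW xy)) (SS' x y xx yy).
  by move: (F y) (F x) (ii S' x0 x) (ii S x y) => *; ring.
have := F_inc xy ax ay Gx Gy; move: C0 (mge x y) (Nge x y).
set C := 3 * c; set mm_ := ii m x y; set NN := ii N x y => C0' m0' N0' FF.
have : C * (mm_ * NN) <= C * (y - x + (mm_ + NN)) ^+ 2.
  rewrite ler_wpM2l//; move: xy; rewrite -subr_gt0; set d := y - x => /ltW d0.
  have h1 := mulr_ge0 m0' N0'; have h2 := mulr_ge0 d0 m0'; have h3 := mulr_ge0 d0 N0'.
  by have h4 := sqr_ge0 d; have h5 := sqr_ge0 mm_; have h6 := sqr_ge0 NN; nra.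
move=> h; rewrite lerBrDr; apply: le_trans FF; rewrite [leLHS]addrC; apply: lerD => //.
by rewrite lerN2.
Qed.

Let ae_G x y : x < y -> exists s, [/\ x < s, s < y & G s].
Proof.
move=> xy; have [|s [/andP[xs sy] Gs]] := @ae_pick _ G x y _ xy; last by exists s.
by apply: ae_imp Gae => s Gs _.
Qed.

Let nv x := \int[leb]_t `|v (x, t)|.

Let F_bound p x : G p -> G x -> `|F x| <=
  \int[leb]_t `|v (x, t) * W p t| + c * ii m (Num.min x p) (Num.max x p) * nv x.
Proof.
move=> Gp Gx; pose I := ii m (Num.min x p) (Num.max x p).
have I0 : 0 <= I by exact: ii_ge0.
have Wle : {ae leb, forall t, 0 < t < T -> `|W x t| <= `|W p t| + c * I}.
  have [xp|px|xp] := ltgtP x p.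
  - apply: ae_imp (GW xp Gx Gp) => t + tT => /(_ tT) h.
    have -> : W x t = W p t - c * ii (fun s => u (s, t)) x p by rewrite -h /W; ring.
    rewrite (le_trans (ler_normB _ _))// lerD2l normrM (gtr0_norm c0) ler_wpM2l ?(ltW c0)//.
    by have xp' := ltW xp; apply: (le_trans (UM _ _ _)); rewrite /I min_l// max_r.
  - apply: ae_imp (GW px Gp Gx) => t + tT => /(_ tT) h.
    have -> : W x t = W p t + c * ii (fun s => u (s, t)) p x by rewrite -h /W; ring.
    rewrite (le_trans (ler_normD _ _))// lerD2l normrM (gtr0_norm c0) ler_wpM2l ?(ltW c0)//.
    by have px' := ltW px; apply: (le_trans (UM _ _ _)); rewrite /I min_r// max_l.
  - by apply: nearW => t _; rewrite xp lerDl mulr_ge0// ltW.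
rewrite /nv -RintegralZl//; last exact: ibl_norm.
rewrite -RintegralD//; last 2 first.
- by apply: ibl_norm; exact: vWi.
- by apply: iblZ; exact: ibl_norm.
apply: Rint_norm_le; first exact: vWi.
  by apply: iblD; [apply: ibl_norm; exact: vWi|apply: iblZ; exact: ibl_norm].
apply: ae_imp Wle => t Wt; have [/Wt tT|/negP/(@vt x) ->] := boolP (0 < t < T); last first.
  by rewrite !mul0r normr0 mulr0 addr0.
by rewrite !normrM -/I [c * I * _]mulrC -mulrDr ler_wpM2l.
Qed.

(* At a finite endpoint [z]: beyond it there is a point [p] with [W p = 0], and [W x]
   differs from [W p] by an integral of [m] over a short interval. *)
Let finite_end (z : R) (B eps : R) : 0 < eps -> 0 <= B -> exists2 d : R, 0 < d &
  forall p x : R, z - d < p < z + d -> z - d < x < z + d -> G p -> G x ->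
    (forall t, V (p, t) = 0) -> nv x <= B -> `|F x| <= eps.
Proof.
move=> e0 B0; have cB : 0 < c * B + 1 by rewrite ltr_wpDl// mulr_ge0// ltW.
have [|d d0 dP] := @ii_small _ _ z (eps / (c * B + 1)) ml; first by rewrite divr_gt0.
exists d => // p x /andP[p1 p2] /andP[x1 x2] Gp Gx Vp nB.
apply: (le_trans (F_bound Gp Gx)).
have W0 t : W p t = 0.
  by rewrite /W /fint; under eq_Rintegral do rewrite Vp mulr0; rewrite Rintegral_cst// mul0r.
under eq_Rintegral do rewrite W0 mulr0 normr0.
rewrite Rintegral_cst// mul0r add0r.
set I := ii m _ _.
have I0 : 0 <= I by exact: ii_ge0.
have : I <= eps / (c * B + 1).
  apply: (le_trans _ (ltW dP)); apply: ii_mono => //.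
    by rewrite le_min; apply/andP; split; lra.
  by rewrite ge_max; apply/andP; split; lra.
rewrite ler_pdivlMr// => h; apply: le_trans h.
have : I * (c * nv x) <= I * (c * B) by rewrite !ler_wpM2l// ltW.
lra.
Qed.

Hypotheses (hab : (a < b)%E) (m2 : ibl leb (fun x => m x ^+ 2)).
Hypothesis mout : forall x, ~ Iab a b x -> m x = 0.
Hypothesis Vout : forall x t, ~ Iab a b x -> V (x, t) = 0.
Variable C : R.
Hypotheses (C0 : 0 <= C) (LC : forall z, 0 <= z <= 1 -> L z <= C * z).

Let m2_ge0 x : 0 <= m x ^+ 2. Proof. exact: sqr_ge0. Qed.

Let m2l : lib (fun x => m x ^+ 2). Proof. exact: lib_ibl. Qed.

Let pick_small x y (d : R) : x < y -> 0 <= d -> ii (fun s => m s ^+ 2) x y < (y - x) * d ^+ 2 ->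
  exists s, [/\ x < s, s < y, G s & m s <= d].
Proof.
move=> xy d0 mxy; apply: contrapT => nex; move: mxy; rewrite ltNge => /negP; apply.
rewrite mulrC -(ii_cst _ (ltW xy)); apply: ii_le => //; first exact: lib_cst.
apply: ae_imp Gae => s Gs /andP[xs sy]; rewrite ler_pXn2r ?nnegrE// leNgt; apply/negP => ms.
by apply: nex; exists s; rewrite ltW.
Qed.

Let far_small (J : nat -> R) (len : nat -> R) :
  (forall s, \forall k \near \oo, ~ (J k < s < J k + len k)) ->
  (fun k => ii (fun s => m s ^+ 2) (J k) (J k + len k)) @ \oo --> (0 : R).
Proof.
move=> Jfar.
have -> : 0 = \int[leb]_s (0 : R) by rewrite Rintegral_cst// mul0r.
apply: (@Rint_dominated _ _ _ leb _ _ (fun s => m s ^+ 2)) => //.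
- by move=> k; exact: ibl_mfun (ibl_oo _ _ m2l).
- apply: nearW => s; apply: cvg_near_cst; apply: filterS (Jfar s) => k /negP/negbTE Jk.
  by rewrite indicE mem_setE in_itv/= Jk mul0r.
- move=> k; apply: nearW => s; rewrite normrM (ger0_norm (indic_ge0 _ _)) ger0_norm//.
  by rewrite ler_piMl// (le_trans (ler_norm _))// indic_le1.
Qed.

(* Towards an infinite endpoint: as the square of [m] is integrable, an interval of
   length k^2 far away contains a point with [m] smaller than [eta / k], whereas the
   integral of [m] up to that point is of order [k]. As [L] is linear near zero, [F] is
   of order [eta] at that point. *)
Let far_end (J : nat -> R) (eps : R) : 0 < eps ->
  (forall k, - (2 * k%:R ^+ 2) <= J k /\ J k + k%:R ^+ 2 <= 2 * k%:R ^+ 2) ->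
  (forall s, \forall k \near \oo, ~ (J k < s < J k + k%:R ^+ 2)) ->
  \forall k \near \oo, exists x, [/\ J k < x, x < J k + k%:R ^+ 2, G x & `|F x| <= eps].
Proof.
move=> e0 J2 Jfar.
have [p [p0 p1 Gp]] := @ae_G 0 1 ltr01.
pose Q := \int[leb]_s (m s ^+ 2); pose A := \int[leb]_t `|W p t|.
have Q0 : 0 <= Q by exact: Rintegral_ge0.
have A0 : 0 <= A by exact: Rintegral_ge0.
pose E := C * (A + c * T * ((3 + Q) / 2)).
have E0 : 0 <= E.
  by rewrite mulr_ge0// addr_ge0// mulr_ge0 ?mulr_ge0 ?divr_ge0 ?addr_ge0// ltW.
pose eta := Num.min 1 (eps / (E + 1)).
have eta1 : eta <= 1 by rewrite ge_min lexx.
have E10 : 0 < E + 1 by rewrite ltr_wpDl.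
have etaE : eta * (E + 1) <= eps by rewrite -ler_pdivlMr// ge_min lexx orbT.
have eta0 : 0 < eta by rewrite lt_min ltr01 divr_gt0.
have eta20 : 0 < eta ^+ 2 by rewrite exprn_gt0.
have /cvgrPdist_lt/(_ _ eta20) far := far_small Jfar.
have k1 : \forall k \near \oo, (0 < k)%N by exists 1%N.
apply: filterS2 far k1 => k; rewrite sub0r normrN => /(le_lt_trans (ler_norm _)) mk k0.
have kR0 : 0 < k%:R :> R by rewrite ltr0n.
have kR1 : 1 <= k%:R :> R by rewrite ler1n.
have [J2a J2b] := J2 k.
have k20 : 0 < (k%:R : R) ^+ 2 by rewrite exprn_gt0.
have k21 : 1 <= (k%:R : R) ^+ 2 by rewrite exprn_ege1.
have [|||x [Jx xJ Gx mx]] := @pick_small (J k) (J k + k%:R ^+ 2) (eta / k%:R).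
- by rewrite ltrDl.
- by rewrite ltW// divr_gt0.
- by rewrite addrAC subrr add0r expr_div_n mulrC divfK// gt_eqF.
exists x; split => //.
apply: (le_trans (F_bound Gp Gx)).
set I := ii m _ _.
have I0 : 0 <= I by exact: ii_ge0.
have Ik : I <= k%:R * ((3 + Q) / 2).
  pose x' := Num.min x p; pose y' := Num.max x p.
  have x'y' : x' <= y' by rewrite /x' /y' ge_min le_max lexx.
  have yx3 : y' - x' <= 3 * k%:R ^+ 2.
    by rewrite /x' /y'; case: (leP x p) => _; lra.
  have lg : lib (fun s => (2 * k%:R)^-1 + k%:R / 2 * m s ^+ 2).
    apply: libD; first exact: lib_cst.
    by apply: lib_ibl; exact: iblZ.
  apply: (@le_trans _ _ (ii (fun s => (2 * k%:R)^-1 + k%:R / 2 * m s ^+ 2) x' y')).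
    apply: ii_le => //; apply: nearW => s _.
    have : 0 <= (k%:R * m s - 1) ^+ 2 / (2 * k%:R).
      by rewrite mulr_ge0 ?sqr_ge0// invr_ge0 mulr_ge0// ltW.
    have -> : (k%:R * m s - 1) ^+ 2 / (2 * k%:R) = (2 * k%:R)^-1 + k%:R / 2 * m s ^+ 2 - m s.
      by field; rewrite gt_eqF.
    by rewrite subr_ge0.
  rewrite iiDf//; last 2 first.
  - exact: lib_cst.
  - by apply: lib_ibl; exact: iblZ.
  rewrite ii_cst// iiZ//.
  have mQ : ii (fun s => m s ^+ 2) x' y' <= Q.
    apply: Rint_le_ae => //; first exact: ibl_oo.
    apply: nearW => s; rewrite ler_piMl// (le_trans (ler_norm _))// indic_le1//.
  have : k%:R / 2 * ii (fun s => m s ^+ 2) x' y' <= k%:R / 2 * Q.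
    by rewrite ler_wpM2l// divr_ge0// ltW.
  have : (2 * k%:R)^-1 * (y' - x') <= (2 * k%:R)^-1 * (3 * k%:R ^+ 2).
    by rewrite ler_wpM2l// invr_ge0 mulr_ge0// ltW.
  have -> : (2 * k%:R)^-1 * (3 * k%:R ^+ 2) = 3 / 2 * k%:R :> R by field; rewrite gt_eqF.
  lra.
have Lm : L (m x) <= C * (eta / k%:R).
  apply: (le_trans (LC _)); last by rewrite ler_wpM2l.
  by rewrite m0/= (le_trans mx)// ler_pdivrMr// mul1r (le_trans eta1).
have L0 : 0 <= L (m x) by rewrite (le_trans _ (vm (x, 0))).
have h1 : \int[leb]_t `|v (x, t) * W p t| <= L (m x) * A.
  have Wi := fint_ibl (GV Gp); rewrite -RintegralZl//; last exact: ibl_norm.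
  apply: Rint_le_ae; [by apply: ibl_norm; exact: vWi|by apply: iblZ; exact: ibl_norm|].
  by apply: nearW => t; rewrite normrM ler_wpM2r// (vm (x, t)).
have h2 : nv x <= L (m x) * T.
  have -> : L (m x) * T = ii (fun=> L (m x)) 0 T by rewrite (ii_cst _ (ltW T0)) subr0.
  apply: Rint_le_ae; [exact: ibl_norm|by apply: ibl_oo; exact: lib_cst|apply: nearW => t].
  rewrite indicE mem_setE in_itv/=; have [_|/negP/(@vt x) ->] := boolP (0 < t < T).
    by rewrite mul1r (vm (x, t)).
  by rewrite normr0 mul0r.
have h3 : c * I * nv x <= c * (k%:R * ((3 + Q) / 2)) * (L (m x) * T).
  rewrite ler_pM//; [by rewrite mulr_ge0// ltW|exact: Rintegral_ge0|].
  by rewrite ler_wpM2l// ltW.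
apply: (@le_trans _ _ (L (m x) * (A + c * T * (k%:R * ((3 + Q) / 2))))).
  by rewrite mulrDr lerD// (le_trans h3)// le_eqVlt; apply/orP; left; apply/eqP; ring.
pose Z := c * T * ((3 + Q) / 2).
have Z0 : 0 <= Z by rewrite /Z !mulr_ge0 ?divr_ge0 ?addr_ge0// ltW.
have -> : c * T * (k%:R * ((3 + Q) / 2)) = k%:R * Z by rewrite /Z; ring.
apply: (@le_trans _ _ (C * (eta / k%:R) * (k%:R * (A + Z)))).
  apply: ler_pM => //; first by rewrite addr_ge0// mulr_ge0.
  by rewrite mulrDr lerD2r ler_peMl.
have -> : C * (eta / k%:R) * (k%:R * (A + Z)) = eta * E.
  by rewrite /E /Z; field; rewrite gt_eqF.
by apply: le_trans etaE; rewrite ler_wpM2l// ?ltW// ltrDl.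
Qed.

Let nv_le x y : x < y -> Iab a b x -> Iab a b y -> G x -> G y ->
  nv x <= nv y + ii N x y /\ nv y <= nv x + ii N x y.
Proof.
move=> xy ax ay Gx Gy; have inc := increment_bound xy ax ay Gx Gy.
have i1 := ibl_norm (vi x); have i2 := ibl_norm (vi y); have i3 := ibl_norm (Di x y).
split; rewrite -(lerD2l (\int[leb]_t `|D x y t|)).
  apply: (@le_trans _ _ (\int[leb]_t `|D x y t| + (nv y + \int[leb]_t `|D x y t|))).
    rewrite lerD2l /nv -RintegralD//; apply: Rint_le_ae => //; first exact: iblD.
    apply: nearW => t; have := ler_normB (v (y, t)) (D x y t).
    by rewrite /D opprB addrCA subrr addr0.
  by rewrite !lerD2l.
apply: (@le_trans _ _ (\int[leb]_t `|D x y t| + (nv x + \int[leb]_t `|D x y t|))).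
  rewrite lerD2l /nv -RintegralD//; apply: Rint_le_ae => //; first exact: iblD.
  apply: nearW => t; have := ler_normD (v (x, t)) (D x y t).
  by rewrite /D addrCA subrr addr0.
by rewrite !lerD2l.
Qed.

Let nN x y : 0 <= ii N x y. Proof. exact: ii_ge0. Qed.

Let nv0 x : 0 <= nv x. Proof. exact: Rintegral_ge0. Qed.

Let kfar (s : R) : \forall k \near \oo, `|s| < k%:R ^+ 2.
Proof.
exists (Num.truncn `|s|).+1 => // k /= ks.
have h1 : `|s| < k%:R by rewrite (lt_le_trans (truncnS_gt _))// ler_nat.
by rewrite (lt_le_trans h1)// expr2 ler_peMl// ler1n (leq_trans _ ks).
Qed.

Let end_left p eps : 0 < eps -> Iab a b p -> G p ->
  exists x, [/\ x < p, Iab a b x, G x & `|F x| <= eps].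
Proof.
move=> e0 abp Gp; case: (abp) => ap pb.
have sub x : (a < x%:E)%E -> x < p -> Iab a b x.
  by move=> ax xp; split => //; rewrite (lt_trans _ pb)// lte_fin.
move: ap sub; case aE : a => [z||] //.
  rewrite lte_fin => zp sub.
  have B0 : 0 <= nv p + ii N z p by exact: addr_ge0.
  have [d d0 dP] := @finite_end z _ _ e0 B0.
  have [p' [p'1 p'2 Gp']] := @ae_G (z - d) z ltac:(lra).
  have [|x [x1 x2 Gx]] := @ae_G z (Num.min p (z + d)).
    by rewrite lt_min zp/=; lra.
  move: x2; rewrite lt_min => /andP[x2 x3].
  have abx : Iab a b x by rewrite aE; apply: sub => //; rewrite lte_fin.
  exists x; split => //; first by rewrite -aE.
  apply: (dP p' x) => //; [apply/andP; split; lra|apply/andP; split; lra| |].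
    by move=> t; apply: Vout => -[+ _]; rewrite aE lte_fin => /(lt_trans p'2); rewrite ltxx.
  apply: (le_trans (nv_le x2 abx abp Gx Gp).1); rewrite lerD2l.
  by apply: ii_mono => //; exact: ltW.
move=> _ sub.
have sq (k : nat) : 0 <= (k%:R : R) ^+ 2 by exact: sqr_ge0.
pose J (k : nat) : R := - (2 * k%:R ^+ 2).
have J1 k : - (2 * k%:R ^+ 2) <= J k /\ J k + k%:R ^+ 2 <= 2 * k%:R ^+ 2.
  by rewrite /J; have := sq k; lra.
have J2 s : \forall k \near \oo, ~ (J k < s < J k + k%:R ^+ 2).
  apply: filterS (kfar s) => k; rewrite /J ltr_norml => /andP[h _] /andP[_ h2]; lra.
have [k [[x [x1 x2 Gx Fx]]]] := filter_ex (filterI (far_end e0 J1 J2) (kfar p)).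
rewrite ltr_norml => /andP[pk _]; have xp : x < p by move: x2; rewrite /J; lra.
by exists x; split => //; apply: sub => //; rewrite ltNyr.
Qed.

Let end_right p eps : 0 < eps -> Iab a b p -> G p ->
  exists x, [/\ p < x, Iab a b x, G x & `|F x| <= eps].
Proof.
move=> e0 abp Gp; case: (abp) => ap pb.
have sub x : (x%:E < b)%E -> p < x -> Iab a b x.
  by move=> bx px; split => //; rewrite (lt_trans ap)// lte_fin.
move: pb sub; case bE : b => [z||] //.
  rewrite lte_fin => pz sub.
  have B0 : 0 <= nv p + ii N p z by exact: addr_ge0.
  have [d d0 dP] := @finite_end z _ _ e0 B0.
  have [p' [p'1 p'2 Gp']] := @ae_G z (z + d) ltac:(lra).
  have [|x [x1 x2 Gx]] := @ae_G (Num.max p (z - d)) z.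
    by rewrite gt_max pz/=; lra.
  move: x1; rewrite gt_max => /andP[x1 x3].
  have abx : Iab a b x by rewrite bE; apply: sub => //; rewrite lte_fin.
  exists x; split => //; first by rewrite -bE.
  apply: (dP p' x) => //; [apply/andP; split; lra|apply/andP; split; lra| |].
    by move=> t; apply: Vout => -[_]; rewrite bE lte_fin => /(lt_trans p'1); rewrite ltxx.
  apply: (le_trans (nv_le x1 abp abx Gp Gx).2); rewrite lerD2l.
  by apply: ii_mono => //; exact: ltW.
move=> _ sub.
have sq (k : nat) : 0 <= (k%:R : R) ^+ 2 by exact: sqr_ge0.
pose J (k : nat) : R := k%:R ^+ 2.
have J1 k : - (2 * k%:R ^+ 2) <= J k /\ J k + k%:R ^+ 2 <= 2 * k%:R ^+ 2.
  by rewrite /J; have := sq k; lra.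
have J2 s : \forall k \near \oo, ~ (J k < s < J k + k%:R ^+ 2).
  apply: filterS (kfar s) => k; rewrite /J ltr_norml => /andP[_ h] /andP[h2 _]; lra.
have [k [[x [x1 x2 Gx Fx]]]] := filter_ex (filterI (far_end e0 J1 J2) (kfar p)).
rewrite ltr_norml => /andP[_ pk]; have xp : p < x by move: x1; rewrite /J; lra.
by exists x; split => //; apply: sub => //; rewrite ltry.
Qed.

(* [F] is nondecreasing and comes close to zero towards both ends. *)
Let uv_zero p r : p < r -> Iab a b p -> Iab a b r -> G p -> G r ->
  {ae leb2, forall z, p < z.1 < r -> u z * v z = 0}.
Proof.
move=> pr ap ar Gp Gr; have pri := SI pr ap ar Gp Gr.
suff S0 : ii S p r <= 0.
  have : {ae leb2, forall z, \1_(`]p, r[) z.1 * (u z * v z) = 0}.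
    apply: Rint_eq0_ae => //; first by apply: nearW => z; rewrite mulr_ge0// indic_ge0.
    apply/eqP; rewrite eq_le; apply/andP; split; last first.
      by apply: Rintegral_ge0 => z _; rewrite mulr_ge0// indic_ge0.
    rewrite -(Rint12 pri); under eq_Rintegral do rewrite /= RintZ_indic.
    exact: S0.
  by apply: ae_imp => z + pzr; rewrite indicE mem_setE in_itv/= pzr mul1r.
suff H eps : 0 < eps -> c * ii S p r <= 2 * eps.
  rewrite leNgt; apply/negP => S0; have cS0 : 0 < c * ii S p r by rewrite mulr_gt0.
  have := H (c * ii S p r / 4) ltac:(lra); lra.
move=> e0.
have [x [xp abx Gx Fx]] := end_left e0 ap Gp.
have [y [ry aby Gy Fy]] := end_right e0 ar Gr.
have xy : x < y by apply: (lt_trans xp); exact: lt_trans ry.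
apply: (@le_trans _ _ (c * ii S x y)).
  rewrite ler_wpM2l ?(ltW c0)//; apply: Rint_le_ae.
  - move: (ibl_F pri); congr (leb.-integrable _ (_ \o _)); apply/funext => s /=.
    by rewrite RintZ_indic.
  - move: (ibl_F (SI xy abx aby Gx Gy)); congr (leb.-integrable _ (_ \o _)).
    by apply/funext => s /=; rewrite RintZ_indic.
  apply: nearW => s; rewrite ler_wpM2r//; first by apply: Rintegral_ge0 => t _.
  rewrite !indicE !mem_setE !in_itv/=; have [/andP[ps sr]|_] := boolP (p < s < r).
    by rewrite (lt_trans xp ps) (lt_trans sr ry).
  by case: (x < s < y).
apply: (le_trans (F_mono xy abx aby Gx Gy)).
have /andP[F1 _] : - eps <= F x <= eps by rewrite -ler_norml.
have F2 := le_trans (ler_norm _) Fy.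
by apply: (le_trans (lerB F2 F1)); rewrite opprK mulr_natl mulr2n.
Qed.

(** The energy has no room to grow, so the growth rate vanishes. *)
Lemma energy_zero : {ae leb2, forall z, u z * v z = 0}.
Proof.
pose Q (i : rat * rat) (z : R * R) := (ratr i.1 : R) < ratr i.2 -> Iab a b (ratr i.1) ->
  Iab a b (ratr i.2) -> ratr i.1 < z.1 < ratr i.2 -> u z * v z = 0.
have : {ae leb2, forall z, forall i, Q i z}.
  apply: ae_countable => -[r s]; rewrite /Q/=.
  have [[rs [ar as_]]|nrs] := pselect ((ratr r : R) < ratr s /\ Iab a b (ratr r) /\ Iab a b (ratr s));
    last by apply: nearW => z h1 h2 h3; exfalso; apply: nrs.
  have [r' [_ [ar' _ r'r _]]] := Iab_rat ar.
  have [_ [s' [_ as' _ ss']]] := Iab_rat as_.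
  have [p [p1 p2 Gp]] := ae_G r'r; have [y [y1 y2 Gy]] := ae_G ss'.
  have ap : Iab a b p by apply: (Iab_mid ar' ar); rewrite !ltW.
  have ay : Iab a b y by apply: (Iab_mid as_ as'); rewrite !ltW.
  have py : p < y by lra.
  apply: ae_imp (uv_zero py ap ay Gp Gy) => z h _ _ _ /andP[h1 h2].
  by apply: h; apply/andP; split; lra.
apply: ae_imp => z zQ; have [abz|/mout mz] := pselect (Iab a b z.1); last first.
  by have := um z; rewrite mz normr_le0 => /eqP ->; rewrite mul0r.
have [r [s [ar as_ rz zs]]] := Iab_rat abz.
by apply: (zQ (r, s)) => //=; [exact: lt_trans zs|rewrite rz zs].
Qed.

End energy.

(** * The diffusivity and its primitive *)

Section diffusivity_facts.
Context {R : realType}.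
Local Notation leb := (@lebesgue_measure R).
Variables (D : R -> R) (hD : diffusivity D).

Lemma diffusivity_increasing (x y : R) : 0 <= x -> x < y -> D x < D y.
Proof.
move=> x0 xy; have y0 : 0 < y by exact: le_lt_trans xy.
have cD : {within `[0, y], continuous D}.
  by apply: continuous_subspaceW (diff_cont hD) => z /=; rewrite !in_itv/= andbT => /andP[].
apply: (gtr0_derive1_lt_cc _ _ cD) => //.
- by move=> z; rewrite in_itv/= => /andP[z0 _]; exact: (Defs.diff_derivable hD).
- by move=> z; rewrite in_itv/= => /andP[z0 _]; exact: (Defs.diff_deriv_pos hD).
- by rewrite in_itv/= x0 ltW.
- by rewrite in_itv/= ltW/=.
Qed.

Lemma diffusivity_ge0 (x : R) : 0 <= x -> 0 <= D x.
Proof.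
rewrite le_eqVlt => /predU1P[<-|/(diff_pos hD)/ltW//].
by rewrite (diff_at0 hD).
Qed.

Let Di (z : R) : leb.-integrable `[0, z] (EFin \o D).
Proof.
apply: continuous_compact_integrable; first exact: segment_compact.
by apply: continuous_subspaceW (diff_cont hD) => s /=; rewrite !in_itv/= andbT => /andP[].
Qed.

Let KE (z : R) : Kfun D z = \int[leb]_s (D \_ `[0, z]) s.
Proof. by rewrite /Kfun Rintegral_mkcond. Qed.

Lemma Kfun_neg (z : R) : z <= 0 -> Kfun D z = 0.
Proof.
rewrite le_eqVlt => /predU1P[->|z0]; rewrite /Kfun; first by rewrite set_itv1 Rintegral_set1.
by rewrite set_itv_ge ?Rintegral_set0// bnd_simp -ltNge.
Qed.

Lemma Kfun_lt (x y : R) : 0 <= x -> x < y -> Kfun D x < Kfun D y.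
Proof.
move=> x0 xy; rewrite -subr_gt0 !KE -RintegralB//; [|exact: ibl_patch|exact: ibl_patch].
apply: (@Rint_gt0 _ _ x y xy); first by apply: iblB; exact: ibl_patch.
  move=> s; rewrite !patchE !mem_setE !in_itv/=.
  case: (boolP (0 <= s <= x)) => [/andP[s0 sx]|_]; first by rewrite s0 (le_trans sx (ltW xy)) subrr.
  by case: ifP => [/andP[s0 _]|]; rewrite subr0// diffusivity_ge0.
move=> s /andP[xs sy]; rewrite !patchE !mem_setE !in_itv/=.
have s0 : 0 < s by exact: le_lt_trans xs.
by rewrite (ltW s0) (ltW sy) (leNgt s x) xs/= subr0; exact: (diff_pos hD).
Qed.

Lemma Kfun_nd (x y : R) : x <= y -> Kfun D x <= Kfun D y.
Proof.
move=> xy; have [x0|x0] := leP 0 x.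
  by move: xy; rewrite le_eqVlt => /predU1P[->//|xy]; exact/ltW/Kfun_lt.
rewrite (Kfun_neg (ltW x0)); have [y0|y0] := leP y 0; first by rewrite Kfun_neg.
by rewrite -(Kfun_neg (lexx 0)) ltW// Kfun_lt.
Qed.

Lemma measurable_Kfun : measurable_fun setT (Kfun D).
Proof. by apply: nondecreasing_measurable => // x y; exact: Kfun_nd. Qed.

Lemma Kfun_ge0 (z : R) : 0 <= Kfun D z.
Proof.
have [z0|z0] := leP z 0; first by rewrite Kfun_neg.
by rewrite -(Kfun_neg (lexx 0)) Kfun_nd// ltW.
Qed.

(** The linear bound near zero controls the potential towards an infinite endpoint. *)
Lemma Kfun_le (z : R) : 0 <= z <= 1 -> Kfun D z <= D 1 * z.
Proof.
move=> /andP[z0 z1].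
have -> : D 1 * z = \int[leb]_(s in `[0, z]) D 1.
  rewrite Rintegral_cst//; congr (_ * _); rewrite /= lebesgue_measure_itv/= lte_fin.
  by case: ltP => h /=; [rewrite subr0|apply/eqP; rewrite eq_le z0 h].
apply: le_Rintegral => //.
  apply: continuous_compact_integrable; first exact: segment_compact.
  by apply: continuous_subspaceT => s; exact: cst_continuous.
move=> s; rewrite /= in_itv/= => /andP[s0 sz].
have := le_trans sz z1; rewrite le_eqVlt => /predU1P[->//|s1].
exact/ltW/diffusivity_increasing.
Qed.

End diffusivity_facts.

(** * Test functions with an explicit fractional integral *)

Section kernel_average.
Context {R : realType}.
Local Notation leb := (@lebesgue_measure R).
Variables (k th th' : R -> R) (M : R).
Hypotheses (ki : ibl leb k) (k0 : forall y, 0 <= k y) (th0 : forall x, 0 <= th x).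
Hypotheses (dth : forall x : R, is_derive x 1 th (th' x)) (cth' : continuous th').
Hypotheses (thM : forall x, `|th x| <= M) (th'M : forall x, `|th' x| <= M).

(** The right-sided fractional integral, up to a constant factor, when [k] is a
    truncated power. *)
Definition eta (r : R) : R := \int[leb]_x (th x * k (x - r)).

Definition deta (r : R) : R := \int[leb]_y (th' (y + r) * k y).

Let cth : continuous th.
Proof. by move=> x; have [d _] := dth x; exact/differentiable_continuous/derivable1_diffP. Qed.

(** The substitution moves the singularity of the kernel away from the variable with
    respect to which [eta] is differentiated. *)
Lemma etaE r : eta r = \int[leb]_y (th (y + r) * k y).
Proof.
have mth : measurable_fun setT th by exact: continuous_mfun.
have mF : measurable_fun setT (fun x => (th x * k (x - r))%:E).
  apply/measurable_EFinP; apply: measurable_funM => //.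
  exact: ibl_mfun (@ibl_shift _ (- r) _ ki).
rewrite /eta /Rintegral -(ge0_integral_shift r mF).
  by congr fine; apply: eq_integral => y _; rewrite addrK.
by move=> x; rewrite lee_fin mulr_ge0.
Qed.

Let shift_ibl (h : R -> R) : continuous h -> (forall x, `|h x| <= M) -> forall r,
  ibl leb (fun y => h (y + r) * k y).
Proof.
move=> ch hM r; apply: (@ibl_mulb _ _ _ leb M) => //.
apply: (@measurableT_comp _ _ _ _ _ _ h); first exact: continuous_mfun.
exact: measurable_funD.
Qed.

Let dsh (y x : R) : is_derive x 1 (fun r => th (y + r) * k y) (th' (y + x) * k y).
Proof.
have -> : (fun r => th (y + r) * k y) = (fun r => k y * th (1 * r + y)).
  by apply/funext => r; rewrite mul1r addrC mulrC.
have h : is_derive (1 * x + y) 1 th (th' (1 * x + y)) by exact: dth.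
apply: (is_derive_eq (is_deriveZ (k y) (is_derive_affine h))).
by rewrite !mul1r -[_ *: _]/(_ * _) mulrC addrC.
Qed.

Let eta_fun : eta = fun r => \int[leb]_y (th (y + r) * k y).
Proof. by apply/funext => r; exact: etaE. Qed.

Lemma is_derive_eta (r : R) : is_derive r 1 eta (deta r).
Proof.
have Ir : `]r - 1, r + 1[%classic r by rewrite /= in_itv/=; apply/andP; split; lra.
have intf x : `]r - 1, r + 1[%classic x -> leb.-integrable setT
    (EFin \o (fun y => th (y + x) * k y)) by move=> _; exact: shift_ibl.
have derf x y : `]r - 1, r + 1[%classic x -> setT y ->
    derivable (fun x => th (y + x) * k y) x 1 by move=> _ _; have [] := dsh y x.
have p1E x y : partial1of2 (fun x y => th (y + x) * k y) x y = th' (y + x) * k y.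
  by rewrite partial1of2E; have [] := dsh y x.
have G0 y : 0 <= M * k y by rewrite mulr_ge0// (le_trans _ (thM 0)).
have Gi : leb.-integrable setT (EFin \o (fun y => M * k y)) by exact: iblZ.
have Gub x y : `]r - 1, r + 1[%classic x -> setT y ->
    `|partial1of2 (fun x y => th (y + x) * k y) x y| <= M * k y.
  by move=> _ _; rewrite p1E normrM (ger0_norm (k0 y)) ler_wpM2r.
rewrite eta_fun; apply: DeriveDef.
  exact: (derivable_under_integral measurableT Ir intf derf G0 Gi Gub).
rewrite -derive1E (differentiation_under_integral measurableT Ir intf derf G0 Gi Gub).
by apply: eq_Rintegral => y _; rewrite p1E.
Qed.

Lemma continuous_deta : continuous deta.
Proof.
move=> r; have Ir : r \in `]r - 1, r + 1[%classic.
  by rewrite inE /= in_itv/=; apply/andP; split; lra.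
apply: (@continuity_under_integral _ _ _ leb (fun x y => th' (y + x) * k y) setT
  measurableT (r - 1) (r + 1) _ _ (fun y => M * k y)) => //.
- by move=> x _; exact: shift_ibl.
- apply: nearW => y _ x _; apply: cvgM; last exact: cvg_cst.
  apply: (@continuous_comp _ _ _ (fun x => y + x) th'); last exact: cth'.
  by apply: cvgD; [exact: cvg_cst|exact: cvg_id].
- exact: iblZ.
- by move=> x _; apply: nearW => y _; rewrite normrM (ger0_norm (k0 y)) ler_wpM2r.
Qed.

Lemma continuous_eta : continuous eta.
Proof. by move=> x; have [d _] := is_derive_eta x; exact/differentiable_continuous/derivable1_diffP. Qed.

Lemma eta_ge0 r : 0 <= eta r.
Proof. by apply: Rintegral_ge0 => x _; rewrite mulr_ge0. Qed.

Lemma eta_bounded r : `|eta r| <= M * \int[leb]_y k y.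
Proof.
rewrite etaE -RintegralZl//; apply: Rint_norm_le; [exact: shift_ibl|exact: iblZ|].
by apply: nearW => y; rewrite normrM (ger0_norm (k0 y)) ler_wpM2r.
Qed.

Lemma eta_gt0 (r x y : R) : x < y -> (forall s, x < s < y -> 0 < th s /\ 0 < k (s - r)) ->
  0 < eta r.
Proof.
move=> xy h; apply: (Rint_gt0 xy).
- apply: (@ibl_mulb _ _ _ leb M) => //; [exact: continuous_mfun|exact: ibl_shift].
- by move=> s; rewrite mulr_ge0.
- by move=> s /h[h1 h2]; rewrite mulr_gt0.
Qed.

Lemma eta_eq0 (r : R) : (forall s, th s * k (s - r) = 0) -> eta r = 0.
Proof.
by move=> h; rewrite /eta; under eq_Rintegral do rewrite h; rewrite Rintegral_cst// mul0r.
Qed.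

End kernel_average.

Section gamma.
Context {R : realType}.
Local Notation leb := (@lebesgue_measure R).

(** A divergent integral of this kind has value zero, so positivity comes with
    convergence. *)
Lemma Gamma_gt0 (p : R) : 0 < p -> p <= 1 -> 0 < Gamma p.
Proof.
move=> p0 p1; rewrite /Gamma Rintegral_mkcond.
pose F := (fun s : R => s `^ (p - 1) * expR (- s)) \_ `]0, +oo[.
have FE s : F s = if 0 < s then s `^ (p - 1) * expR (- s) else 0.
  by rewrite /F patchE mem_setE in_itv/= andbT.
have F0 s : 0 <= F s.
  by rewrite FE; case: ifP => // _; rewrite mulr_ge0 ?powR_ge0 ?expR_ge0.
have i2 : ibl leb ((fun w : R => w `^ (-2)) \_ `[1, +oo[) by apply: ibl_powy; lra.
have i1 : ibl leb (kcut (p - 1) 1) by apply: ibl_kcut; lra.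
apply: (@Rint_gt0 _ F 0 1 ltr01) => //.
  apply: (@ibl_le _ _ _ leb _ _ _ _ (iblD i1 (iblZ 2 i2))).
    apply/(measurable_restrictT _ _).1 => //; apply: measurable_funTS.
    apply: measurable_funM; first exact: measurable_powR.
    by apply: measurableT_comp => //; exact: measurable_funN.
  move=> s; rewrite (ger0_norm (F0 s)) FE /kcut /kpow patchE mem_setE in_itv/= andbT.
  case: ifP => s0; last first.
    by rewrite (_ : (if s < 1 then 0 else 0) = 0) ?if_same// add0r mulr_ge0//; case: ifP => //; rewrite powR_ge0.
  case: (ltP s 1) => s1.
    by rewrite mulr0 addr0 ler_piMr ?powR_ge0// -expR0 ler_expR; lra.
  rewrite add0r; rewrite -[leRHS]mul1r; apply: ler_pM; [exact: powR_ge0|exact: expR_ge0| |].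
    by have := @ler_powR_neg _ (p - 1) 1 s ltac:(lra) ltr01 s1; rewrite powR1.
  have s2 : 0 < s ^+ 2 by rewrite exprn_gt0.
  rewrite expRN powRN powR_mulrn ?(ltW s0)// ler_pdivlMr// mulrC ler_pdivrMr ?expR_gt0//.
  by have := @expR_ge1Dxn _ s 1 (ltW s0); rewrite -[2`!%N]/2%N; lra.
by move=> s /andP[s0 _]; rewrite FE s0 mulr_gt0// ?powR_gt0// expR_gt0.
Qed.

End gamma.

Section fractional_test_functions.
Context {R : realType}.
Local Notation leb := (@lebesgue_measure R).
Variables (al T S M : R) (th th' : R -> R).
Hypotheses (al0 : 0 < al) (al1 : al < 1) (ST : S <= T).
Hypotheses (dth : forall x : R, is_derive x 1 th (th' x)) (cth' : continuous th').
Hypotheses (thM : forall x, `|th x| <= M) (th'M : forall x, `|th' x| <= M).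
Hypotheses (th0 : forall x, 0 <= th x) (thS : forall x, ~ (0 < x < S) -> th x = 0).

Local Notation k := (kcut (al - 1) S).

Let ki : ibl leb k. Proof. by move: al0 => h; apply: ibl_kcut; lra. Qed.

Let cth : continuous th.
Proof. by move=> x; have [d _] := dth x; exact/differentiable_continuous/derivable1_diffP. Qed.

Let mth : measurable_fun setT th. Proof. exact: continuous_mfun. Qed.

Let thi : ibl leb th. Proof. exact: (@bounded_supp_ibl _ S _ M). Qed.

Let tail (t : R) : R := \int[leb]_r (th r * kpow 0 (r - t)).

Let is_derive_tail (t : R) : is_derive t 1 tail (- th t).
Proof.
have tt : t < t + 1 by rewrite ltrDl.
have bi : leb.-integrable [set` Interval -oo%O (BRight (t + 1))] (EFin \o th).
  by apply: integrableS thi => //; exact: measurable_itv.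
have [d e] := continuous_FTC1 tt bi (ltNyr t) (@cth t).
have tailE : tail = fun t => \int[leb]_x th x - \int[leb]_(x in `]-oo, t]) th x.
  apply/funext => s; rewrite [X in _ - X]Rintegral_mkcond -RintegralB//; last first.
    by apply: ibl_patch => //; apply: integrableS thi => //; exact: measurable_itv.
  apply: eq_Rintegral => r _; rewrite patchE mem_setE in_itv/= /kpow subr_gt0 powRr0 leNgt.
  by case: (s < r); rewrite /= ?mulr1 ?subr0// mulr0 subrr.
rewrite tailE -[- th t]add0r; apply: is_deriveB.
by apply: DeriveDef; [exact: d|rewrite -derive1E e].
Qed.

(** The constant by which the composition of the two fractional integrals differs from
    the plain integral. *)
Definition jconst : R := (Gamma (1 - al))^-1 * Beta (- al) (al - 1).

Lemma jconst_gt0 : 0 < jconst.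
Proof.
by rewrite mulr_gt0 ?invr_gt0 ?Gamma_gt0 ?Beta_gt0//; move: al0 al1 => h1 h2; lra.
Qed.

Lemma eta_out s : S <= s -> eta k th s = 0.
Proof.
move=> Ss; apply: eta_eq0 => r; have [/andP[r0 rS]|/negP/thS ->] := boolP (0 < r < S).
  by rewrite /kcut /kpow subr_gt0 (ltNge s) (ltW (lt_le_trans rS Ss))/= if_same mulr0.
by rewrite mul0r.
Qed.

(* Two fractional integrals whose orders sum to one compose to a plain integral. *)
Let Jt_eta (t : R) : 0 < t ->
  \int[leb]_(s in `]t, T[) ((s - t) `^ (- al) * eta k th s) = Beta (- al) (al - 1) * tail t.
Proof.
move=> t0; rewrite Rintegral_mkcond.
have e0 s : 0 <= eta k th s by apply: eta_ge0 => // y; exact: kcut_ge0.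
transitivity (\int[leb]_s (kpow (- al) (s - t) * eta k th s)).
  apply: eq_Rintegral => s _; rewrite patchE mem_setE in_itv/= /kpow subr_gt0.
  case: ltP => //= ts; last by rewrite mul0r.
  by case: ltP => // Ts; rewrite eta_out ?mulr0// (le_trans ST).
have mk1 : measurable_fun setT (fun z : R * R => kpow (- al) (z.1 - t)).
  apply: measurableT_comp; first exact: measurable_kpow.
  exact: measurable_funB.
have mk2 : measurable_fun setT (fun z : R * R => k (z.2 - z.1)).
  apply: measurableT_comp; first exact: measurable_kcut.
  exact: measurable_funB.
pose f z := kpow (- al) (z.1 - t) * (th z.2 * k (z.2 - z.1)).
have mf : measurable_fun setT f.
  apply: measurable_funM => //; apply: measurable_funM => //.
  exact: measurableT_comp.
have f0 z : 0 <= f z by rewrite !mulr_ge0 ?kpow_ge0 ?kcut_ge0.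
have thki s : ibl leb (fun r => th r * k (r - s)).
  by apply: (@ibl_mulb _ _ _ leb M) => //; exact: ibl_shift.
transitivity (fine (\int[leb]_s \int[leb]_r (f (s, r))%:E)).
  congr fine; apply: eq_integral => s _; rewrite /f/=.
  under [RHS]eq_integral do rewrite EFinM.
  rewrite ge0_integralZl//; last 3 first.
  - by apply/measurable_EFinP; exact: ibl_mfun (thki s).
  - by move=> r _; rewrite lee_fin mulr_ge0// kcut_ge0.
  - by rewrite lee_fin kpow_ge0.
  rewrite EFinM; congr (_ * _)%E; rewrite /eta /Rintegral fineK//.
  by apply: integrable_fin_num => //; exact: thki.
rewrite (@fubini_tonelli _ _ _ _ _ leb leb (fun z => (f z)%:E)); last 2 first.
- exact/measurable_EFinP.
- by move=> z; rewrite lee_fin.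
have ti : ibl leb (fun r => th r * kpow 0 (r - t)).
  under eq_fun do rewrite mulrC.
  apply: (@ibl_mulb _ _ _ leb 1) => //.
    apply: measurableT_comp; first exact: measurable_kpow.
    exact: measurable_funB.
  by move=> r; rewrite /kpow; case: ifP; rewrite ?powRr0 ?normr1 ?normr0.
rewrite /tail -RintegralZl//; congr fine; apply: eq_integral => r _; rewrite /f/=.
have [/andP[r0 rS]|/negP/thS thr] := boolP (0 < r < S); last first.
  by rewrite thr integral0_eq ?mul0r ?mulr0// => s _; rewrite mul0r mulr0.
transitivity (\int[leb]_s ((th r)%:E * (kpow (- al) (s - t) * kpow (al - 1) (r - s))%:E))%E.
  apply: eq_integral => s _; rewrite -EFinM mulrCA; congr (_ * _)%:E.
  rewrite /kcut; case: ltP => // Srs.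
  have st : s <= t by lra.
  by rewrite {1 2}/kpow subr_gt0 (ltNge t s) st/= !mul0r.
rewrite ge0_integralZl//; last 3 first.
- apply/measurable_EFinP; apply: measurable_funM; apply: measurableT_comp;
    by first [exact: measurable_kpow|exact: measurable_funB].
- by move=> s _; rewrite lee_fin mulr_ge0// kpow_ge0.
- by rewrite lee_fin.
have [h1 h2 h3 h4] : [/\ -1 < - al, - al <= 0, -1 < al - 1 & al - 1 <= 0].
  by move: al0 al1 => h1 h2; split; lra.
rewrite kpow_beta//.
rewrite -EFinM; congr EFin; rewrite (_ : - al + (al - 1) + 1 = 0); last by ring.
by rewrite mulrCA.
Qed.

Lemma Jt_tensor_eta (phi : R -> R) (x t : R) : 0 < t ->
  Jt T (1 - al) (tensor phi (eta k th)) (x, t) = phi x * (jconst * tail t).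
Proof.
move=> t0; rewrite /Jt /tensor/= addrAC subrr add0r.
have -> : \int[leb]_(s in `]t, T[) ((s - t) `^ (- al) * (phi x * eta k th s)) =
   phi x * \int[leb]_(s in `]t, T[) ((s - t) `^ (- al) * eta k th s).
  have E (h : R -> R) : \int[leb]_(s in `]t, T[) ((s - t) `^ (- al) * h s) =
      \int[leb]_s (h s * kcut (- al) (T - t) (s - t)).
    rewrite Rintegral_mkcond; apply: eq_Rintegral => s _.
    rewrite patchE mem_setE in_itv/= /kcut /kpow subr_gt0 ltrD2r mulrC.
    by case: (ltP t s) => _; case: (ltP s T) => _; rewrite ?mul0r ?mulr0// mulrC.
  have kt : ibl leb (fun s => kcut (- al) (T - t) (s - t)).
    by apply: ibl_shift; apply: ibl_kcut; move: al1 => h; lra.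
  apply: (etrans (E (fun s => phi x * eta k th s))); rewrite [X in _ * X](E (eta k th)).
  under eq_Rintegral do rewrite -mulrA.
  apply: RintegralZl => //.
  apply: (@ibl_mulb _ _ _ leb (M * \int[leb]_y k y)) => //.
    by apply: continuous_mfun; apply: (continuous_eta (th' := th') (M := M)) => // y; exact: kcut_ge0.
  by move=> s; apply: eta_bounded => // y; exact: kcut_ge0.
by rewrite Jt_eta// /jconst; ring.
Qed.

Lemma pt_Jt_tensor (phi : R -> R) (z : R * R) : 0 < z.2 ->
  pt (Jt T (1 - al) (tensor phi (eta k th))) z = - (jconst * (phi z.1 * th z.2)).
Proof.
case: z => x t /= t0; rewrite /pt/= derive1E.
have h : is_derive t 1 (fun s => phi x * jconst * tail s) (phi x * jconst * - th t).
  exact: is_deriveZ (is_derive_tail t).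
rewrite -(@near_eq_derive _ _ _ (fun s => phi x * jconst * tail s)).
  by rewrite derive_val; ring.
near=> s; have s0 : 0 < s by near: s; exact: lt_nbhsr.
by apply/esym; rewrite -mulrA; exact: Jt_tensor_eta.
Unshelve. all: by end_near. Qed.

End fractional_test_functions.

(** * Sobolev functions on the cylinder *)

Section cylinder.
Context {R : realType}.
Local Notation leb := (@lebesgue_measure R).
Local Notation leb2 := (leb \x leb)%E.
Implicit Types (f g : R * R -> R).

Lemma measurable_Iab (a b : \bar R) : measurable (Iab a b : set (measurableTypeR R)).
Proof.
apply: is_interval_measurable => x y abx aby z xzy.
exact: (Iab_mid abx aby).
Qed.

Lemma measurable_OmegaT (a b : \bar R) (T : R) :
  measurable (OmegaT a b T : set (measurableTypeR R * measurableTypeR R)).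
Proof. by apply: measurableX; [exact: measurable_Iab|exact: measurable_itv]. Qed.

Lemma measurable_le2 (f g : R * R -> R) : measurable_fun setT f -> measurable_fun setT g ->
  measurable ([set z | f z <= g z] : set (measurableTypeR R * measurableTypeR R)).
Proof.
move=> mf mg.
have : measurable_fun setT (fun z : measurableTypeR R * measurableTypeR R => f z <= g z).
  exact: measurable_fun_ler.
by move=> /(_ measurableT [set true]); rewrite setTI; apply.
Qed.

Variables (a b : \bar R) (T : R).
Hypothesis T0 : 0 < T.
Local Notation O := (OmegaT a b T).

Lemma OmegaTE (z : R * R) : O z <-> Iab a b z.1 /\ 0 < z.2 < T.
Proof. by rewrite /OmegaT /= in_itv. Qed.

Lemma OmegaT_rect (p q s t : R) : Iab a b p -> Iab a b q -> 0 < s -> t < T ->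
  `[p, q]%classic `*` `[s, t]%classic `<=` O.
Proof.
move=> ap aq s0 tT z [/= h1 h2]; rewrite !in_itv/= in h1 h2; apply/OmegaTE; split.
  exact: (Iab_mid ap aq).
by case/andP : h2 => h2 h3; rewrite (lt_le_trans s0 h2) (le_lt_trans h3 tT).
Qed.

Let L2_sq f : L2 O f -> measurable_fun setT (f \_ O) /\ ibl leb2 (fun z => (f \_ O) z ^+ 2).
Proof.
move=> [mf fi]; have mO := measurable_OmegaT a b T; split.
  by apply/(measurable_restrictT _ _).1.
have := ibl_patch mO fi; congr (leb2.-integrable _ (_ \o _)); apply/funext => z.
by rewrite !patchE; case: ifP; rewrite ?expr0n.
Qed.

Let Tout f x t : ~ (0 < t < T) -> (f \_ O) (x, t) = 0.
Proof. by move=> h; rewrite patchE memNset// => /OmegaTE[]. Qed.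

Let le1sq (x : R) : `|x| <= 1 + x ^+ 2.
Proof.
rewrite -(@real_normK _ _ (num_real x)); have : 0 <= (`|x| - 1) ^+ 2 by exact: sqr_ge0.
by have := normr_ge0 x; move: `|x| => y; rewrite !expr2; nra.
Qed.

Lemma L2_mul_ibl f (h : R * R -> R) (M p q : R) : L2 O f -> measurable_fun setT h ->
  (forall z, `|h z| <= M) -> (forall z, ~ (p <= z.1 <= q) -> h z = 0) ->
  ibl leb2 (fun z => (f \_ O) z * h z).
Proof.
move=> /L2_sq[mf fi] mh hM h0.
have i1 : ibl leb (\1_(`[p, q]) : R -> R) by exact: integrable_indic_itv.
have i2 : ibl leb (\1_(`[0, T]) : R -> R) by exact: integrable_indic_itv.
have M0 : 0 <= M by rewrite (le_trans _ (hM (0, 0))).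
apply: (@ibl_le _ _ _ leb2 _ _ _ _ (iblZ M (iblD (ibl_prod i1 i2) fi))).
  exact: measurable_funM.
move=> [x t] /=; rewrite !indicE !mem_setE !in_itv/=.
have [xpq|/negP xpq] := boolP (p <= x <= q); last first.
  by rewrite h0// mulr0 normr0 mulr_ge0// addr_ge0 ?sqr_ge0// mul0r.
have [/andP[t1 t2]|/negP tT] := boolP (0 < t < T); last first.
  by rewrite Tout// mul0r normr0 mulr_ge0// expr0n addr0 mulr_ge0//; case: (_ && _).
rewrite (ltW t1) (ltW t2) /= mulr1 normrM mulrC.
by rewrite ler_pM.
Qed.

Let L2_slices f g : L2 O f -> L2 O g -> (forall phi, Cc_infty O phi ->
     \int[leb2]_(z in O) (f z * pt phi z) = - \int[leb2]_(z in O) (g z * phi z)) ->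
  exists G : R -> Prop,
  [/\ {ae leb, forall t, Iab 0%:E T%:E t -> G t},
      (forall t, G t -> lint a b (fun x => (f \_ O) (x, t))) &
      forall p q, p < q -> Iab 0%:E T%:E p -> Iab 0%:E T%:E q -> G p -> G q ->
        {ae leb, forall x, Iab a b x ->
           (f \_ O) (x, q) - (f \_ O) (x, p) = \int[leb]_(s in `]p, q[) (g \_ O) (x, s)}].
Proof.
move=> f2 g2 wk; have [mF Fi] := L2_sq f2; have [mG Gi] := L2_sq g2.
have mO := measurable_OmegaT a b T.
have mc1 p q r : measurable_fun setT (fun z : R * R => cutoff p q r z.1).
  by apply: measurableT_comp => //; exact: measurable_cutoff.
have Ai (h : R * R -> R) p q r : 0 < r -> p <= q -> L2 O h ->
    ibl leb2 (fun z => (h \_ O) z * cutoff p q r z.1).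
  move=> r0 pq h2; apply: (@L2_mul_ibl _ _ 1 (p - r) (q + r)) => //.
    by move=> z; exact: cutoff_norm_le1.
  move=> z hz; apply: cutoff_out => // /andP[h3 h4]; apply: hz.
  by rewrite (ltW h3) (ltW h4).
apply: (@weak_slices R 0%:E T%:E a b (fun z => (f \_ O) (z.2, z.1))
    (fun z => (g \_ O) (z.2, z.1))).
- move=> p q s t _ _ _ _; apply: ibl_unpatch; first by apply: measurableX; exact: measurable_itv.
  pose h (z : R * R) : R := \1_(`[s, t]) z.1 * \1_(`[p, q]) z.2.
  have mi (x y : R) : measurable_fun setT (\1_(`[x, y]%classic) : measurableTypeR R -> R) by [].
  have mh : measurable_fun setT h.
    apply: measurable_funM.
      by apply: (@measurableT_comp _ _ _ _ _ _ (\1_(`[s, t]%classic) : _ -> R)).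
    by apply: (@measurableT_comp _ _ _ _ _ _ (\1_(`[p, q]%classic) : _ -> R)).
  have := ibl_swap (@L2_mul_ibl g h 1 s t g2 mh _ _).
  have h1 z : `|h z| <= 1.
    by rewrite /h !indicE; case: (_ \in _); case: (_ \in _); rewrite ?mulr1 ?mulr0 ?normr0 ?normr1.
  have h0 z : ~ (s <= z.1 <= t) -> h z = 0.
    by rewrite /h indicE mem_setE in_itv/= => /negP/negbTE ->; rewrite mul0r.
  move=> /(_ h1 h0); congr (leb2.-integrable _ (_ \o _)); apply/funext => -[x y].
  rewrite [RHS]patchE /h /= !indicE; set b1 := y \in _; set b2 := x \in _.
  have -> : ((x, y) \in `[p, q]%classic `*` `[s, t]%classic) = b1 && b2.
    apply/idP/idP; first by rewrite inE => -[h3 h4]; apply/andP; split; rewrite inE.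
    by move=> /andP[]; rewrite /b1 /b2 !inE.
  by case: b1; case: b2; rewrite /= ?mulr1 ?mulr0.
- apply: ae_imp (ibl_sec2 Fi) => t ti _ p q _ _; apply: ibl_unpatch; first exact: measurable_itv.
  have i2 : ibl leb (\1_(`[p, q]) : R -> R) by exact: integrable_indic_itv.
  apply: (@ibl_le _ _ _ leb _ _ _ _ (iblD i2 ti)).
    by apply/(measurable_restrictT _ _).1 => //; apply: measurable_funTS; exact: mfun_sec2.
  move=> x /=; rewrite patchE indicE; case: ifP => _; first exact: le1sq.
  by rewrite normr0 add0r sqr_ge0.
- move=> s t r [r0 st _ _] p q _ _.
  by apply: (integrableS measurableT _ _ (ibl_G (Ai f s t r r0 st f2))).
move=> p q r s t r' [r0 pq p0 qT] [r'0 st as_ bt].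
have phiC : Cc_infty O (tensor (cutoff s t r') (cutoff p q r)).
  apply: Cc_infty_tensor => //; apply: OmegaT_rect => //.
    by case: p0; rewrite lte_fin.
  by case: qT; rewrite lte_fin.
have Fub (h : R * R -> R) (w : R -> R) : L2 O h -> measurable_fun setT w ->
    (exists M, forall x, `|w x| <= M) ->
    \int[leb]_x (Aint (fun z => (h \_ O) (z.2, z.1)) s t r' x * w x) =
    \int[leb2]_(z in O) (h z * (cutoff s t r' z.1 * w z.2)).
  move=> h2 mw [M wM]; rewrite [RHS]Rintegral_mkcond.
  have mw2 : measurable_fun setT (fun z : R * R => w z.2) by exact: measurableT_comp.
  have Hi := Ai h s t r' r'0 st h2.
  have Hwi := @ibl_mulb _ _ _ leb2 M _ _ mw2 (fun z => wM z.2) Hi.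
  transitivity (\int[leb2]_z (w z.2 * ((h \_ O) z * cutoff s t r' z.1))); last first.
    by apply: eq_Rintegral => z _; rewrite !patchE; case: ifP => _; [ring|rewrite mul0r mulr0].
  rewrite -(Rint21 Hwi); apply: Rint_ae.
  - by apply: measurable_funM => //; exact: ibl_mfun (ibl_G Hi).
  - exact: ibl_mfun (ibl_G Hwi).
  by apply: ae_imp (ibl_sec2 Hi) => y yi /=; rewrite RintegralZl// mulrC.
rewrite (Fub f)//; [|exact: measurable_dcutoff|exact: dcutoff_bounded].
rewrite -[Bint _]/(Aint (fun z => (g \_ O) (z.2, z.1))).
rewrite (Fub g)//; [|exact: measurable_cutoff|by exists 1 => x; exact: cutoff_norm_le1].
rewrite -(wk _ phiC); apply: eq_Rintegral => z _; congr (_ * _).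
by rewrite (pt_tensor (cutoff s t r') (is_derive_cutoff p q r z.2)).
Qed.

(** As functions of time, the slices of a Sobolev function are absolutely continuous;
    one time slice together with the integral of the norm of the time derivative bounds
    them all. Both bounds are square integrable in space. *)
Lemma H1_dominated f g : L2 O f -> L2 O g -> weak_pt O f g -> exists m : R -> R,
  [/\ measurable_fun setT m, (forall x, 0 <= m x), (forall x, ~ Iab a b x -> m x = 0),
      ibl leb (fun x => m x ^+ 2) & {ae leb2, forall z, `|(f \_ O) z| <= m z.1}].
Proof.
move=> f2 g2 [_ _ wk]; have [mF Fi] := L2_sq f2; have [mG Gi] := L2_sq g2.
set F := f \_ O in mF Fi *; set G_ := g \_ O in mG Gi *.
have mO := measurable_OmegaT a b T.
have [G [aeG _ inc]] := L2_slices f2 g2 wk; rewrite -/F -/G_ in inc.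
have Iab0 t : Iab 0%:E T%:E t <-> 0 < t < T.
  by rewrite /Iab /= !lte_fin; split => [[-> ->]|/andP[]].
have aeGT : {ae leb, forall t, 0 < t < T -> G t /\ ibl leb (fun x => F (x, t) ^+ 2)}.
  by apply: ae_imp (ae_and aeG (ibl_sec2 Fi)) => t [h1 h2] /Iab0 tT; split => //; exact: h1.
have [t0 [t0T [Gt0 F0i]]] := ae_pick aeGT T0.
have gi_sec : {ae leb, forall x, ibl leb (fun t => G_ (x, t)) /\ ibl leb (fun t => G_ (x, t) ^+ 2)}.
  apply: ae_imp (ibl_sec1 Gi) => x xi; split => //.
  have i2 : ibl leb (\1_(`[0, T]) : R -> R) by exact: integrable_indic_itv.
  apply: (@ibl_le _ _ _ leb _ _ _ _ (iblD i2 xi)); first exact: mfun_sec1.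
  move=> t; rewrite indicE mem_setE in_itv/=.
  have [/andP[t1 t2]|/negP tT] := boolP (0 < t < T); last first.
    by rewrite /G_ Tout// normr0 expr0n addr0; case: (_ && _).
  by rewrite (ltW t1) (ltW t2) /=; exact: le1sq.
pose N x := \int[leb]_t `|G_ (x, t)|.
have N0 x : 0 <= N x by exact: Rintegral_ge0.
have mN : measurable_fun setT N by exact: measurable_norm_int.
have m0 x : 0 <= `|F (x, t0)| + N x by rewrite addr_ge0.
have mm : measurable_fun setT (fun x => `|F (x, t0)| + N x).
  by apply: measurable_funD => //; apply: measurableT_comp => //; exact: mfun_sec2.
exists (fun x => `|F (x, t0)| + N x); split => //.
- move=> x abx; have E h t : (h \_ O) (x, t) = 0 :> R by rewrite patchE memNset// => /OmegaTE[].
  rewrite /F /N /G_ E normr0 add0r; under eq_Rintegral do rewrite E normr0.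
  by rewrite Rintegral_cst// mul0r.
- have NE : {ae leb, forall x, N x ^+ 2 <= T * \int[leb]_t (G_ (x, t) ^+ 2)}.
    apply: ae_imp gi_sec => x [i1 i2].
    set Q := \int[leb]_t (G_ (x, t) ^+ 2).
    (* the Cauchy-Schwarz inequality, as an optimum over [l] *)
    have h (l : R) : 0 <= l -> 2 * l * N x <= l ^+ 2 * T + Q.
      move=> l0.
      have -> : l ^+ 2 * T = ii (fun=> l ^+ 2) 0 T by rewrite (ii_cst _ (ltW T0)) subr0.
      have li : ibl leb (fun t => \1_(`]0, T[) t * l ^+ 2) by apply: ibl_oo; exact: lib_cst.
      rewrite /N /Q /ii -RintegralD// -RintegralZl//; last exact: ibl_norm.
      apply: Rint_le_ae; [by apply: iblZ; exact: ibl_norm|exact: iblD|apply: nearW => t].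
      rewrite indicE mem_setE in_itv/=.
      have [tT|/negP tT] := boolP (0 < t < T); last by rewrite /G_ Tout// normr0 !(mulr0, mul0r, expr0n, addr0).
      rewrite mul1r -(@real_normK _ _ (num_real (G_ _))); have : 0 <= (l - `|G_ (x, t)|) ^+ 2 by exact: sqr_ge0.
      by move: (`|G_ (x, t)|) => y; rewrite !expr2; nra.
    have := h (N x / T) ltac:(by rewrite divr_ge0// ltW).
    have -> : 2 * (N x / T) * N x = 2 * (N x ^+ 2 / T) by ring.
    have -> : (N x / T) ^+ 2 * T = N x ^+ 2 / T by field; rewrite gt_eqF.
    by rewrite [T * Q]mulrC -ler_pdivrMr//; lra.
  have Bi := iblZ 2 (iblD F0i (iblZ T (ibl_F Gi))).
  apply: (ibl_le_ae _ _ Bi); first exact: measurable_funX.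
  apply: ae_imp NE => x /= NEx; rewrite ger0_norm ?sqr_ge0//.
  rewrite -(@real_normK _ _ (num_real (F (x, t0)))); move: NEx (N0 x); move: (`|F (x, t0)|) (N x) => y n.
  move: (T * _) => B nB n0.
  have : 0 <= (y - n) ^+ 2 by exact: sqr_ge0.
  by move: nB; rewrite !expr2; nra.
pose A : set (measurableTypeR R * measurableTypeR R) :=
  [set z | `|F z| <= `|F (z.1, t0)| + N z.1].
apply: (@prod_ae2 _ _ _ _ _ leb leb A).
  apply: measurable_le2; first exact: measurableT_comp.
  by apply: (@measurableT_comp _ _ _ _ _ _ (fun x => `|F (x, t0)| + N x)).
apply: ae_imp aeGT => t Gt.
have [tT|/negP tT] := boolP (0 < t < T); last first.
  by apply: nearW => x; rewrite /A/=; rewrite {1}/F Tout// normr0 addr_ge0.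
have {Gt} [Gt _] := Gt tT.
have iiN (p q x : R) : ibl leb (fun t => G_ (x, t)) ->
    `|\int[leb]_(s in `]p, q[) G_ (x, s)| <= N x.
  move=> xi; rewrite -(iiE (fun s => G_ (x, s))).
  apply: Rint_norm_le; [by apply: ibl_oo; exact: lib_ibl|exact: ibl_norm|].
  by apply: nearW => s; rewrite normrM ler_piMl// indic_le1.
have out x : ~ Iab a b x -> `|F (x, t)| <= `|F (x, t0)| + N x.
  by move=> abx; rewrite {1}/F patchE memNset ?normr0 ?addr_ge0// => /OmegaTE[].
have [tt0|tt0|->] := ltgtP t t0; last by apply: nearW => x; rewrite /A/=; rewrite lerDl.
- have [/Iab0 h1 /Iab0 h2] := (tT, t0T).
  apply: ae_imp (ae_and (inc _ _ tt0 h1 h2 Gt Gt0) gi_sec) => x [incx [xi _]].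
  rewrite /A/=; have [/incx e|/out//] := pselect (Iab a b x).
  have -> : F (x, t) = F (x, t0) - \int[leb]_(s in `]t, t0[) G_ (x, s) by rewrite -e; ring.
  by rewrite (le_trans (ler_normB _ _))// lerD2l iiN.
- have [/Iab0 h1 /Iab0 h2] := (tT, t0T).
  apply: ae_imp (ae_and (inc _ _ tt0 h2 h1 Gt0 Gt) gi_sec) => x [incx [xi _]].
  rewrite /A/=; have [/incx e|/out//] := pselect (Iab a b x).
  have -> : F (x, t) = F (x, t0) + \int[leb]_(s in `]t0, t[) G_ (x, s) by rewrite -e; ring.
  by rewrite (le_trans (ler_normD _ _))// lerD2l iiN.
Qed.

End cylinder.

(** * Differences of weak solutions *)

Section weak_identity.
Context {R : realType}.
Local Notation leb := (@lebesgue_measure R).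
Local Notation leb2 := (leb \x leb)%E.

(** The bounded interval makes Fubini's theorem applicable to functions that are
    integrable locally in space only. *)
Lemma slice_int (h : R * R -> R) (w phi : R -> R) (M p q : R) :
  ibl leb2 (fun z => \1_(`[p, q]) z.1 * (h z * w z.2)) ->
  measurable_fun setT phi -> (forall x, `|phi x| <= M) ->
  (forall x, ~ (p <= x <= q) -> phi x = 0) ->
  \int[leb]_x ((\int[leb]_t (h (x, t) * w t)) * phi x) =
  \int[leb2]_z (h z * (phi z.1 * w z.2)).
Proof.
move=> hi mphi phiM phi0.
have mphi1 : measurable_fun setT (fun z : R * R => phi z.1) by exact: measurableT_comp.
have Hi := @ibl_mulb _ _ _ leb2 M _ _ mphi1 (fun z => phiM z.1) hi.
have phi1 x y : phi x * (\1_(`[p, q]) x * y) = phi x * y.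
  rewrite indicE mem_setE in_itv/=; have [_|/negP/phi0 ->] := boolP (p <= x <= q).
    by rewrite mul1r.
  by rewrite !mul0r.
transitivity (\int[leb2]_z (phi z.1 * (\1_(`[p, q]) z.1 * (h z * w z.2)))); last first.
  by apply: eq_Rintegral => z _; rewrite phi1; ring.
rewrite -(Rint12 Hi).
have E x : (\int[leb]_t (h (x, t) * w t)) * phi x =
    phi x * \int[leb]_t (\1_(`[p, q]) x * (h (x, t) * w t)).
  by rewrite RintZ_indic phi1 mulrC.
under eq_Rintegral do rewrite E.
apply: Rint_ae.
- by apply: measurable_funM => //; exact: ibl_mfun (ibl_F hi).
- exact: ibl_mfun (ibl_F Hi).
apply: ae_imp (ibl_sec1 hi) => x xi; apply/esym; exact: (RintegralZl (phi x) measurableT xi).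
Qed.

Variables (al T S M : R) (a b : \bar R) (th th' : R -> R).
Hypotheses (al0 : 0 < al) (al1 : al < 1) (ST : S <= T) (S0 : 0 < S).
Hypotheses (dth : forall x : R, is_derive x 1 th (th' x)) (cth' : continuous th').
Hypotheses (thM : forall x, `|th x| <= M) (th'M : forall x, `|th' x| <= M).
Hypotheses (th0 : forall x, 0 <= th x) (thS : forall x, ~ (0 < x < S) -> th x = 0).

Local Notation k := (kcut (al - 1) S).
Local Notation O := (OmegaT a b T).

Let k0 y : 0 <= k y. Proof. exact: kcut_ge0. Qed.

Let ki : ibl leb k. Proof. by move: al0 => h; apply: ibl_kcut; lra. Qed.

Let cth : continuous th.
Proof. by move=> x; have [d _] := dth x; exact/differentiable_continuous/derivable1_diffP. Qed.

Let mth : measurable_fun setT th. Proof. exact: continuous_mfun. Qed.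

Let deta_k (r : R) : is_derive r 1 (eta k th) (deta k th' r).
Proof. exact: (is_derive_eta ki k0 th0 dth thM th'M). Qed.

Let ceta : continuous (eta k th).
Proof. exact: (continuous_eta ki k0 th0 dth thM th'M). Qed.

Lemma test_tensor_eta (p q r : R) : 0 < r -> p <= q ->
  test_fun a b T (tensor (cutoff p q r) (eta k th)).
Proof.
move=> r0 pq; split; last first.
  exists (`|p - r| + `|q + r|) => z _ zM; rewrite /tensor cutoff_out ?mul0r// => /andP[h1 h2].
  move: zM; apply/negP; rewrite -leNgt ler_norml; apply/andP; split.
    have := ler_norm (- (p - r)); have := normr_ge0 (q + r); rewrite normrN; lra.
  have := ler_norm (q + r); have := normr_ge0 (p - r); lra.
have cphi := @continuous_cutoff R p q r.
split.
- by apply: continuous_subspaceT; exact: continuous_tensor cphi ceta.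
- move=> z _; apply: has_partials_tensor; first by have [] := is_derive_cutoff p q r z.1.
  by have [] := deta_k z.2.
exists (tensor (dcutoff p q r) (eta k th)), (tensor (cutoff p q r) (deta k th')); split.
- apply: continuous_subspaceT.
  by apply: continuous_tensor; [exact: continuous_dcutoff|exact: ceta].
- apply: continuous_subspaceT; apply: continuous_tensor; first exact: cphi.
  exact: (continuous_deta ki k0 cth' th'M).
move=> z _; split.
  by rewrite (px_tensor _ (is_derive_cutoff p q r z.1)).
by rewrite (pt_tensor _ (deta_k z.2)).
Qed.

Lemma weak_integrand_tensor (u Kux : R * R -> R) (p q r : R) (z : R * R) : O z ->
  weak_integrand al T u Kux (tensor (cutoff p q r) (eta k th)) z =
  Kux z * (dcutoff p q r z.1 * eta k th z.2) +
  jconst al * (u z * (cutoff p q r z.1 * th z.2)).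
Proof.
move=> /OmegaTE[_ /andP[z0 _]]; rewrite /weak_integrand.
rewrite (px_tensor _ (is_derive_cutoff p q r z.1)).
rewrite (pt_Jt_tensor al0 al1 ST dth thM th'M th0 thS _ z0) /tensor; ring.
Qed.

(** The test functions need not vanish on the lateral boundary, so that the identity
    for [V] and [u], extended by zero, holds on the whole line in space; it contains
    the boundary condition. *)
Lemma weak_difference (u1 u2 V1 V2 : R * R -> R) (p q r : R) : 0 < T ->
  L2 O u1 -> L2 O u2 ->
  (forall chi, test_fun a b T chi ->
    [/\ leb2.-integrable O (EFin \o weak_integrand al T u1 V1 chi),
        leb2.-integrable O (EFin \o weak_integrand al T u2 V2 chi) &
        \int[leb2]_(z in O) weak_integrand al T u1 V1 chi z =
        \int[leb2]_(z in O) weak_integrand al T u2 V2 chi z]) ->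
  0 < r -> p <= q ->
  let V := (fun z => V1 z - V2 z) \_ O in let u := (fun z => u1 z - u2 z) \_ O in
  ibl leb2 (fun z => V z * (dcutoff p q r z.1 * eta k th z.2)) /\
  \int[leb2]_z (V z * (dcutoff p q r z.1 * eta k th z.2)) =
  - (jconst al * \int[leb2]_z (u z * (cutoff p q r z.1 * th z.2))).
Proof.
move=> T0 u1L u2L id12 r0 pq V u.
have [i1 i2 e12] := id12 _ (test_tensor_eta r0 pq).
have mO := measurable_OmegaT a b T.
set chi := tensor _ _ in i1 i2 e12.
have {}i1 := ibl_patch mO i1; have {}i2 := ibl_patch mO i2.
have ui w : L2 O w -> ibl leb2 (fun z => (w \_ O) z * (cutoff p q r z.1 * th z.2)).
  move=> wL; have M0 : 0 <= M by rewrite (le_trans _ (thM 0)).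
  apply: (@L2_mul_ibl _ a b T w _ M (p - r) (q + r)) => //.
  - apply: measurable_funM; apply: measurableT_comp => //; exact: measurable_cutoff.
  - move=> z; rewrite normrM -[leRHS]mul1r; apply: ler_pM => //; exact: cutoff_norm_le1.
  move=> z hz; rewrite cutoff_out ?mul0r// => /andP[h1 h2]; apply: hz.
  by rewrite (ltW h1) (ltW h2).
have du := iblB (ui _ u1L) (ui _ u2L); have di := iblB i1 i2.
have E z : V z * (dcutoff p q r z.1 * eta k th z.2) =
    ((weak_integrand al T u1 V1 chi \_ O) z - (weak_integrand al T u2 V2 chi \_ O) z) -
    jconst al * ((u1 \_ O) z * (cutoff p q r z.1 * th z.2) -
                 (u2 \_ O) z * (cutoff p q r z.1 * th z.2)).
  rewrite /V !patchE; case: ifPn => zO; last by rewrite !(mul0r, mulr0, subr0).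
  by rewrite inE in zO; rewrite !weak_integrand_tensor//; ring.
have uE z : u z * (cutoff p q r z.1 * th z.2) =
    (u1 \_ O) z * (cutoff p q r z.1 * th z.2) - (u2 \_ O) z * (cutoff p q r z.1 * th z.2).
  by rewrite /u !patchE; case: ifP => _; [ring|rewrite !mul0r subr0].
split.
  by have := iblB di (iblZ (jconst al) du); congr (leb2.-integrable _ (_ \o _)); apply/funext => z; rewrite E.
under eq_Rintegral do rewrite E; under [in RHS]eq_Rintegral do rewrite uE.
rewrite RintegralB//; last exact: iblZ.
rewrite RintegralB// RintegralZl//; move: e12.
by rewrite [X in X = _]Rintegral_mkcond [X in _ = X]Rintegral_mkcond => ->; rewrite subrr sub0r.
Qed.

End weak_identity.

(** * Uniqueness *)

Section uniqueness.
Context {R : realType}.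
Local Notation leb := (@lebesgue_measure R).
Local Notation leb2 := (leb \x leb)%E.
Variables (al T : R) (a b : \bar R) (D : R -> R) (u1 u2 V1 V2 : R * R -> R).
Local Notation O := (OmegaT a b T).
Hypotheses (al0 : 0 < al) (al1 : al < 1) (T0 : 0 < T) (hab : (a < b)%E) (hD : diffusivity D).
Hypotheses (u1L : L2 O u1) (u2L : L2 O u2).
Hypotheses (u1t : exists2 g, L2 O g & weak_pt O u1 g) (u2t : exists2 g, L2 O g & weak_pt O u2 g).
Hypotheses (u1p : {ae leb2, forall z, O z -> 0 <= u1 z}) (u2p : {ae leb2, forall z, O z -> 0 <= u2 z}).
Hypotheses (V1x : weak_px O (Kfun D \o u1) V1) (V2x : weak_px O (Kfun D \o u2) V2).
Hypothesis id12 : forall chi, test_fun a b T chi ->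
    [/\ leb2.-integrable O (EFin \o weak_integrand al T u1 V1 chi),
        leb2.-integrable O (EFin \o weak_integrand al T u2 V2 chi) &
        \int[leb2]_(z in O) weak_integrand al T u1 V1 chi z =
        \int[leb2]_(z in O) weak_integrand al T u2 V2 chi z].

Let V := (fun z => V1 z - V2 z) \_ O.

Let cutoff_bounds (p q r : R) : 0 < r -> p <= q -> exists M : R,
  (forall x, `|cutoff p q r x| <= M) /\ (forall x, `|dcutoff p q r x| <= M).
Proof.
move=> r0 pq; have [M hM] := @dcutoff_bounded R p q r r0; exists (Num.max 1 M).
by split=> x; rewrite le_max ?hM ?orbT// cutoff_norm_le1.
Qed.

Let positive_min (f : R -> R) (p q : R) : p <= q -> {within `[p, q], continuous f} ->
  (forall x, p <= x <= q -> 0 < f x) -> exists2 d : R, 0 < d & forall x, p <= x <= q -> d <= f x.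
Proof.
move=> pq cf f0; have [c cin cmin] := EVT_min pq cf.
exists (f c); first by apply: f0; rewrite in_itv/= in cin.
by move=> x xin; apply: cmin; rewrite in_itv.
Qed.

Let inv_max (f : R -> R) (d : R) : 0 < d -> continuous f ->
  measurable_fun setT (fun x => (Num.max d (f x))^-1) /\ forall x, `|(Num.max d (f x))^-1| <= d^-1.
Proof.
move=> d0 cf; have m0 x : 0 < Num.max d (f x) by rewrite lt_max d0.
split; last first.
  by move=> x; rewrite gtr0_norm ?invr_gt0// lef_pV2 ?posrE// le_max lexx.
apply: continuous_mfun => x; apply: cvgV; first by rewrite gt_eqF.
by apply: continuous_max; [exact: cvg_cst|exact: cf].
Qed.

(* The weak formulation includes integrability against every test function, which
   gives integrability up to the lateral boundary: choose a product whose space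
   derivative stays away from zero on the given rectangle. *)
Let V_loc (p q S : R) : p <= q -> 0 < S -> S < T ->
  ibl leb2 (fun z => \1_(`[p, q]) z.1 * (\1_(`]0, S[) z.2 * V z)).
Proof.
move=> pq S0 ST.
have [h h0 Th] : exists2 h, 0 < h & T = S + 8 * h by exists ((T - S) / 8); [lra|field].
(* This cutoff equals 1 somewhere between [S] and [T], so its right-sided fractional
   integral is positive up to time [S]. *)
pose s := S + 2 * h; pose t := S + 6 * h.
have st : s <= t by rewrite /s /t; lra.
have [M [cM dM]] := cutoff_bounds h0 st.
have thT x : ~ (0 < x < T) -> cutoff s t h x = 0.
  move=> hx; apply: cutoff_out => // /andP[h1 h2]; apply: hx; apply/andP.
  by move: h1 h2; rewrite /s /t => h1 h2; split; lra.
(* The derivative of the cutoff from [P] to [Q] is a bump that is positive on [p, q]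
   minus one that lives to the right of [q]. *)
pose P := (p + q) / 2; pose r := q - p + 1; pose Q := P + 2 * r.
have r0 : 0 < r by rewrite /r; lra.
have PQ : P <= Q by rewrite /Q; lra.
have [+ _] := weak_difference al0 al1 (lexx T) (is_derive_cutoff s t h)
  (@continuous_dcutoff _ s t h) cM dM (fun x => cutoff_ge0 x h0 st) thT T0 u1L u2L id12 r0 PQ.
set k := kcut (al - 1) T => iV.
have ki : ibl leb k by move: al0 => ?; apply: ibl_kcut; lra.
have k0 y : 0 <= k y by exact: kcut_ge0.
have ceta : continuous (eta k (cutoff s t h)).
  by apply: (continuous_eta ki k0 (fun x => cutoff_ge0 x h0 st) (is_derive_cutoff s t h) cM dM).
have [d d0 dP] : exists2 d : R, 0 < d & forall x, p <= x <= q -> d <= dcutoff P Q r x.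
  apply: positive_min => //.
    by apply: continuous_subspaceT; exact: continuous_dcutoff.
  move=> x /andP[px xq]; rewrite /dcutoff [X in _ - _ * X]bump_out; last first.
    rewrite ltr_pdivlMr// => /andP[+ _]; rewrite /Q /P /r; lra.
  rewrite mulr0 subr0 mulr_gt0 ?invr_gt0// bump_gt0//.
  by rewrite ltr_pdivlMr// ltr_pdivrMr// /P /r; apply/andP; split; lra.
have [e e0 eP] : exists2 e : R, 0 < e & forall x, 0 <= x <= S -> e <= eta k (cutoff s t h) x.
  apply: positive_min; [exact: ltW|exact: continuous_subspaceT|].
  move=> x /andP[x0 xS].
  apply: (eta_gt0 ki k0 (fun x => cutoff_ge0 x h0 st) (is_derive_cutoff s t h) cM (x := S + 3 * h) (y := S + 5 * h)).
    lra.
  move=> y /andP[y1 y2]; rewrite cutoff_in//; last by rewrite /s /t; apply/andP; split; lra.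
  split => //; rewrite /k /kcut ifT; last by rewrite Th; lra.
  by apply: kpow_gt0; lra.
have [m1 b1] := inv_max d0 (@continuous_dcutoff _ P Q r).
have [m2 b2] := inv_max e0 ceta.
pose g (z : R * R) : R := (\1_(`[p, q]) z.1 * (Num.max d (dcutoff P Q r z.1))^-1) *
  (\1_(`]0, S[) z.2 * (Num.max e (eta k (cutoff s t h) z.2))^-1).
have mi b1' b2' (x y : R) : measurable_fun setT (\1_[set` Interval (BSide b1' x) (BSide b2' y)] : measurableTypeR R -> R) by [].
have mg : measurable_fun setT g.
  apply: measurable_funM.
    apply: (@measurableT_comp _ _ _ _ _ _ (fun x => \1_(`[p, q]) x * (Num.max d (dcutoff P Q r x))^-1)) => //.
    exact: measurable_funM.
  apply: (@measurableT_comp _ _ _ _ _ _ (fun x => \1_(`]0, S[) x * (Num.max e (eta k (cutoff s t h) x))^-1)) => //.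
  exact: measurable_funM.
have gM z : `|g z| <= d^-1 * e^-1.
  rewrite /g normrM; apply: ler_pM => //.
    by rewrite normrM -[leRHS]mul1r ler_pM// indic_le1.
  by rewrite normrM -[leRHS]mul1r ler_pM// indic_le1.
have := @ibl_mulb _ _ _ leb2 _ _ _ mg gM iV.
congr (leb2.-integrable _ (_ \o _)); apply/funext => z; rewrite /g -/V.
rewrite !indicE !mem_setE !in_itv/=.
have [pzq|_] := boolP (p <= z.1 <= q); last by rewrite !mul0r.
have [zS|_] := boolP (0 < z.2 < S); last by rewrite !(mul0r, mulr0).
have dz := dP _ pzq; have ez : e <= eta k (cutoff s t h) z.2.
  by apply: eP; case/andP : zS => /ltW -> /ltW ->.
rewrite !mul1r (max_r dz) (max_r ez); field.
by rewrite (gt_eqF (lt_le_trans d0 dz)) (gt_eqF (lt_le_trans e0 ez)).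
Qed.

Section truncated.
(** Before a time [S < T] the kernel may be truncated at [S], and test functions that
    vanish after [S] see all of the equation. *)
Variables (S : R) (m1 m2 : R -> R).
Hypotheses (S0 : 0 < S) (ST : S < T).
Hypotheses (mm1 : measurable_fun setT m1) (mm2 : measurable_fun setT m2).
Hypotheses (m1_ge0 : forall x, 0 <= m1 x) (m2_ge0 : forall x, 0 <= m2 x).
Hypotheses (m1_out : forall x, ~ Iab a b x -> m1 x = 0) (m2_out : forall x, ~ Iab a b x -> m2 x = 0).
Hypotheses (m1i : ibl leb (fun x => m1 x ^+ 2)) (m2i : ibl leb (fun x => m2 x ^+ 2)).
Hypotheses (dom1 : {ae leb2, forall z, `|(u1 \_ O) z| <= m1 z.1})
           (dom2 : {ae leb2, forall z, `|(u2 \_ O) z| <= m2 z.1}).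

Local Notation O' := (OmegaT a b S).
Local Notation K := (Kfun D).
Local Notation k := (kcut (al - 1) S).

Let m x := m1 x + m2 x.
Let F1 := u1 \_ O.
Let F2 := u2 \_ O.

Let m0 x : 0 <= m x. Proof. by rewrite addr_ge0. Qed.

Let mm : measurable_fun setT m. Proof. exact: measurable_funD. Qed.

Let m_out x : ~ Iab a b x -> m x = 0.
Proof. by move=> h; rewrite /m m1_out// m2_out// addr0. Qed.

Let msq : ibl leb (fun x => m x ^+ 2).
Proof.
apply: (@ibl_le _ _ _ leb _ _ _ _ (iblZ 2 (iblD m1i m2i))); first exact: measurable_funX.
move=> x; rewrite ger0_norm ?sqr_ge0// /m.
by have : 0 <= (m1 x - m2 x) ^+ 2 by [exact: sqr_ge0]; rewrite !expr2; nra.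
Qed.

Let ml : lib m.
Proof.
have l1 : lib (fun x => 1 + m x ^+ 2) by apply: libD; [exact: lib_cst|exact: lib_ibl].
move=> p q; apply: (@ibl_le _ _ _ leb _ _ _ _ (l1 p q)); first exact: measurable_funM.
move=> x; rewrite normrM (ger0_norm (indic_ge0 _ _)) (ger0_norm (m0 x)) ler_wpM2l ?indic_ge0//.
by have : 0 <= (m x - 1) ^+ 2 by [exact: sqr_ge0]; have := m0 x; rewrite !expr2; nra.
Qed.

Let mO : measurable (O : set (measurableTypeR R * measurableTypeR R)).
Proof. exact: measurable_OmegaT. Qed.

Let mF1 : measurable_fun setT F1.
Proof. by apply/(measurable_restrictT _ _).1 => //; have [] := u1L. Qed.

Let mF2 : measurable_fun setT F2.
Proof. by apply/(measurable_restrictT _ _).1 => //; have [] := u2L. Qed.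

(* Setting the differences to zero outside of this set of full measure makes their
   bounds and signs valid everywhere. *)
Let E : set (R * R) :=
  O' `&` [set z | 0 <= F1 z] `&` [set z | F1 z <= m z.1] `&`
  [set z | 0 <= F2 z] `&` [set z | F2 z <= m z.1].

Let mE : measurable (E : set (measurableTypeR R * measurableTypeR R)).
Proof.
have mm2' : measurable_fun setT (fun z : R * R => m z.1) by exact: measurableT_comp.
have mc : measurable_fun setT (fun z : R * R => 0 : R) by exact: measurable_cst.
have h1 := measurable_le2 mc mF1; have h2 := measurable_le2 mF1 mm2'.
have h3 := measurable_le2 mc mF2; have h4 := measurable_le2 mF2 mm2'.
exact: (measurableI _ _ (measurableI _ _ (measurableI _ _ (measurableI _ _
  (measurable_OmegaT a b S) h1) h2) h3) h4).
Qed.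

Let O'O z : O' z -> O z.
Proof.
move=> /OmegaTE[h /andP[h1 h2]]; apply/OmegaTE; split => //.
by rewrite h1 (lt_trans h2 ST).
Qed.

Let E_ae : {ae leb2, forall z, O' z -> E z}.
Proof.
apply: ae_imp (ae_and (ae_and u1p u2p) (ae_and dom1 dom2)) => z [[p1 p2] [d1 d2]] O'z.
have Oz := O'O O'z; have e1 : F1 z = u1 z by rewrite /F1 patchE mem_set.
have e2 : F2 z = u2 z by rewrite /F2 patchE mem_set.
split; [split; [split; [split|]|]|] => //=.
- by rewrite e1; exact: p1.
- by rewrite (le_trans (ler_norm _))// (le_trans d1)// lerDl.
- by rewrite e2; exact: p2.
- by rewrite (le_trans (ler_norm _))// (le_trans d2)// lerDr.
Qed.

Let U : R * R -> R := (fun z => F1 z - F2 z) \_ E.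
Let v : R * R -> R := (fun z => K (F1 z) - K (F2 z)) \_ E.

Let mU : measurable_fun setT U.
Proof. by apply/(measurable_restrictT _ _).1 => //; apply: measurable_funTS; exact: measurable_funB. Qed.

Let mv : measurable_fun setT v.
Proof.
apply/(measurable_restrictT _ _).1 => //; apply: measurable_funTS.
by apply: measurable_funB; apply: measurableT_comp => //; exact: measurable_Kfun.
Qed.

Let Um z : `|U z| <= m z.1.
Proof.
rewrite /U patchE; case: ifPn => [|_]; last by rewrite normr0.
by rewrite inE => -[[[[_ /= h1] h2] h3] h4]; rewrite ler_norml; apply/andP; split; lra.
Qed.

Let vm z : `|v z| <= K (m z.1).
Proof.
rewrite /v patchE; case: ifPn => [|_]; last by rewrite normr0 (Kfun_ge0 hD).
rewrite inE => -[[[[_ /= h1] h2] h3] h4].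
have := Kfun_nd hD h2; have := Kfun_nd hD h4.
have := Kfun_ge0 hD (F1 z); have := Kfun_ge0 hD (F2 z).
by rewrite ler_norml => *; apply/andP; split; lra.
Qed.

Let Et x t : ~ (0 < t < S) -> ((x, t) \in E) = false.
Proof. by move=> h; apply/negP; rewrite inE => -[[[[/OmegaTE[_ ]]]]]. Qed.

Let Ut x t : ~ (0 < t < S) -> U (x, t) = 0.
Proof. by move=> h; rewrite /U patchE Et. Qed.

Let vt x t : ~ (0 < t < S) -> v (x, t) = 0.
Proof. by move=> h; rewrite /v patchE Et. Qed.

Let Uv0 z : 0 <= U z * v z.
Proof.
rewrite /U /v !patchE; case: ifP => _; last by rewrite mulr0.
have [h|h] := leP (F1 z) (F2 z).
  by rewrite -mulrNN mulr_ge0// opprB subr_ge0//; exact: Kfun_nd.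
by apply: mulr_ge0; rewrite subr_ge0; [exact: ltW|apply: Kfun_nd => //; exact: ltW].
Qed.

Let Uv_eq0 z : U z * v z = 0 -> E z -> u1 z = u2 z.
Proof.
move=> + Ez; have Oz : O z by apply: O'O; case: Ez => -[[[]]].
rewrite /U /v !patchE mem_set// /F1 /F2 !patchE !mem_set//.
move=> /eqP; rewrite mulf_eq0 !subr_eq0 => /orP[/eqP//|/eqP].
case: Ez => -[[[_ /= +] _] + _]; rewrite /F1 /F2 !patchE !mem_set// => p1 p2 KK.
have [h|h|//] := ltgtP (u1 z) (u2 z).
  by have := Kfun_lt hD p1 h; rewrite KK ltxx.
by have := Kfun_lt hD p2 h; rewrite KK ltxx.
Qed.

Let VS (z : R * R) : R := \1_(`]0, S[) z.2 * V z.

Let mVS : measurable_fun setT VS.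
Proof.
have nn (n : nat) : - n%:R <= n%:R :> R by rewrite (@le_trans _ _ 0)// oppr_le0.
apply: (@measurable_fun_cvg _ (measurableTypeR R * measurableTypeR R)%type _ setT
  (fun (n : nat) (z : R * R) => \1_(`[- n%:R, n%:R]) z.1 * VS z)).
  by move=> n; exact: ibl_mfun (V_loc (nn n) S0 ST).
move=> z _; apply: cvg_near_cst; exists (Num.truncn `|z.1|).+1 => // n /= nz.
rewrite indicE mem_setE in_itv/= -ler_norml ltW ?mul1r//.
by rewrite (lt_le_trans (truncnS_gt _))// ler_nat.
Qed.

(* Slices that are not integrable are dropped, so that the pairings of the fractional
   integral with test functions in time are measurable in space. *)
Let B : set R := [set x | (\int[leb]_t (`|VS (x, t)|)%:E < +oo)%E].

Let mB : measurable (B : set (measurableTypeR R)).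
Proof.
have mF : measurable_fun setT (fun x => \int[leb]_t (`|VS (x, t)|)%:E)%E.
  apply: (measurable_fun_fubini_tonelli_F (m2 := leb) (fun z => (`|VS z|)%:E)) => //.
  by apply/measurable_EFinP; exact: measurableT_comp.
by have := emeasurable_fun_infty_o measurableT mF +oo%E; rewrite setTI.
Qed.

Let Vt (z : R * R) : R := \1_B z.1 * VS z.

Let mVt : measurable_fun setT Vt.
Proof.
apply: measurable_funM => //.
by apply: (@measurableT_comp _ _ _ _ _ _ (\1_B : measurableTypeR R -> R)) => //.
Qed.

Let Vt_sec x : ibl leb (fun t => Vt (x, t)).
Proof.
have [Bx|nBx] := pselect (B x).
  apply/integrableP; split; first by apply/measurable_EFinP; exact: mfun_sec1.
  by under eq_integral do rewrite /= /Vt/= indicE mem_set// mul1r.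
have -> : (fun t => Vt (x, t)) = fun t => 0 * 0.
  by apply/funext => t; rewrite /Vt/= indicE memNset// !mul0r.
by apply: iblZ; exact: integrable0.
Qed.

Let Vt_loc p q : ibl leb2 (fun z => \1_(`[p, q]) z.1 * Vt z).
Proof.
have [pq|qp] := leP p q; last first.
  have -> : (fun z : R * R => \1_(`[p, q]) z.1 * Vt z) = fun z => 0 * 0.
    apply/funext => z; rewrite indicE mem_setE in_itv/= !mul0r.
    have [/andP[h1 h2]|_] := boolP (p <= z.1 <= q); last by rewrite mul0r.
    by move: (le_trans h1 h2); rewrite leNgt qp.
  by apply: iblZ; exact: integrable0.
have mB1 : measurable_fun setT (fun z : R * R => \1_B z.1 : R).
  by apply: (@measurableT_comp _ _ _ _ _ _ (\1_B : measurableTypeR R -> R)).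
have := @ibl_mulb _ _ _ leb2 1 _ _ mB1 (fun z => indic_le1 _ _) (V_loc pq S0 ST).
by congr (leb2.-integrable _ (_ \o _)); apply/funext => z; rewrite /Vt /VS; ring.
Qed.

Let Vt_out x t : ~ Iab a b x -> Vt (x, t) = 0.
Proof. by move=> h; rewrite /Vt /VS /V patchE memNset ?mulr0// => /OmegaTE[]. Qed.

Let Vt_ae : {ae leb2, forall z, Vt z = VS z}.
Proof.
pose A : set (measurableTypeR R * measurableTypeR R) := [set z | B z.1].
have : {ae leb2, forall z, A z}; last first.
  by apply: ae_imp => z; rewrite /A/= /Vt => Bz; rewrite indicE mem_set// mul1r.
apply: (@prod_ae1 _ _ _ _ _ leb leb A).
  have -> : A = B `*` setT by apply/seteqP; split => // z [].
  exact: measurableX.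
have : {ae leb, forall x, forall n : nat, - n%:R <= x <= n%:R -> B x}.
  apply: ae_countable => n.
  have nn : - n%:R <= n%:R :> R by rewrite (@le_trans _ _ 0)// oppr_le0.
  apply: ae_imp (ibl_sec1 (V_loc nn S0 ST)) => x /integrableP[_ +] xn.
  by rewrite /B/= indicE mem_setE in_itv/= xn/=; under eq_integral do rewrite mul1r.
apply: ae_imp => x xB; apply: nearW => t; apply: (xB (Num.truncn `|x|).+1).
by rewrite -ler_norml ltW// truncnS_gt.
Qed.


Let ibl_lint (c d : \bar R) (f : R -> R) : ibl leb f -> lint c d f.
Proof. by move=> fi p q _ _; exact: (integrableS measurableT _ _ fi). Qed.

Let rect (p q s t : R) : set (measurableTypeR R * measurableTypeR R) :=
  `[p, q]%classic `*` `[s, t]%classic.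

Let mrect p q s t : measurable (rect p q s t).
Proof. by apply: measurableX; exact: measurable_itv. Qed.

Let rectE p q s t z : (z \in rect p q s t) = (p <= z.1 <= q) && (s <= z.2 <= t).
Proof.
apply/idP/andP; rewrite inE /rect/=; first by move=> [/=]; rewrite !in_itv.
by move=> [h1 h2]; split; rewrite /= in_itv.
Qed.

Let rect_int (h : R * R -> R) p q s t : ibl leb2 (fun z => \1_(`[p, q]) z.1 * h z) ->
  leb2.-integrable (rect p q s t) (EFin \o h).
Proof.
move=> hi; apply: ibl_unpatch; first exact: mrect.
have mi : measurable_fun setT (fun z : R * R => \1_(`[s, t]) z.2 : R).
  by apply: (@measurableT_comp _ _ _ _ _ _ (\1_(`[s, t]%classic) : measurableTypeR R -> R)).
have := @ibl_mulb _ _ _ leb2 1 _ _ mi (fun z => indic_le1 _ _) hi.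
congr (leb2.-integrable _ (_ \o _)); apply/funext => z.
rewrite patchE rectE !indicE !mem_setE !in_itv/=.
by case: (p <= z.1 <= q); case: (s <= z.2 <= t); rewrite /= ?mul1r ?mul0r ?mulr0.
Qed.

Let Iab_S (x : R) : Iab 0%:E S%:E x -> 0 < x < S.
Proof. by move=> []; rewrite !lte_fin => -> ->. Qed.

Let rect_O p q s t : Iab a b p -> Iab a b q -> Iab 0%:E S%:E s -> Iab 0%:E S%:E t ->
  rect p q s t `<=` O'.
Proof.
by move=> ap aq /Iab_S/andP[s0 _] /Iab_S/andP[_ tS]; exact: OmegaT_rect.
Qed.

Let rect_loc (f : R * R -> R) p q s t : loc_integrable2 O f -> Iab a b p -> Iab a b q ->
  Iab 0%:E S%:E s -> Iab 0%:E S%:E t -> leb2.-integrable (rect p q s t) (EFin \o f).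
Proof.
move=> fl ap aq as_ at_; apply: fl.
  by apply: compact_setX; exact: segment_compact.
by move=> z /(rect_O ap aq as_ at_)/O'O.
Qed.

Let vE z : E z -> v z = K (u1 z) - K (u2 z).
Proof.
move=> Ez; have Oz : O z by apply: O'O; case: Ez => -[[[]]].
by rewrite /v patchE mem_set// /F1 /F2 !patchE !mem_set.
Qed.

Let rect_mul (f h : R * R -> R) M p q s t : loc_integrable2 O f ->
  Iab a b p -> Iab a b q -> Iab 0%:E S%:E s -> Iab 0%:E S%:E t ->
  measurable_fun setT h -> (forall z, `|h z| <= M) -> (forall z, ~ rect p q s t z -> h z = 0) ->
  ibl leb2 (fun z => f z * h z) /\ \int[leb2]_(z in O) (f z * h z) = \int[leb2]_z (f z * h z).
Proof.
move=> fl ap aq as_ at_ mh hM h0; split.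
  exact: (mul_supp_ibl (mrect p q s t) (rect_loc fl ap aq as_ at_) mh hM h0).
rewrite Rintegral_mkcond; apply: eq_Rintegral => z _; rewrite patchE; case: ifPn => //.
rewrite notin_setE => nO; rewrite h0 ?mulr0// => /(rect_O ap aq as_ at_)/O'O.
exact: nO.
Qed.

Let v_mul (h : R * R -> R) M p q s t :
  Iab a b p -> Iab a b q -> Iab 0%:E S%:E s -> Iab 0%:E S%:E t ->
  measurable_fun setT h -> (forall z, `|h z| <= M) -> (forall z, ~ rect p q s t z -> h z = 0) ->
  ibl leb2 (fun z => v z * h z) /\ \int[leb2]_z (v z * h z) =
  \int[leb2]_(z in O) ((K \o u1) z * h z) - \int[leb2]_(z in O) ((K \o u2) z * h z).
Proof.
move=> ap aq as_ at_ mh hM h0; have [l1 _ _] := V1x; have [l2 _ _] := V2x.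
have [i1 ->] := rect_mul l1 ap aq as_ at_ mh hM h0.
have [i2 ->] := rect_mul l2 ap aq as_ at_ mh hM h0.
have di := iblB i1 i2.
have mvh : measurable_fun setT (fun z => v z * h z) by exact: measurable_funM.
have ae_vh : {ae leb2, forall z, (K \o u1) z * h z - (K \o u2) z * h z = v z * h z}.
  apply: ae_imp E_ae => z zE; have [zr|/h0 ->] := pselect (rect p q s t z); last by rewrite !mulr0 subr0.
  by rewrite vE ?mulrBl//; apply: zE; exact: rect_O zr.
split; first exact: ibl_ae di mvh ae_vh.
by rewrite -RintegralB//; apply/esym/Rint_ae => //; exact: ibl_mfun di.
Qed.

Let Vt_mul (h : R * R -> R) M p q s t :
  Iab a b p -> Iab a b q -> Iab 0%:E S%:E s -> Iab 0%:E S%:E t ->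
  measurable_fun setT h -> (forall z, `|h z| <= M) -> (forall z, ~ rect p q s t z -> h z = 0) ->
  \int[leb2]_z (Vt z * h z) =
  \int[leb2]_(z in O) (V1 z * h z) - \int[leb2]_(z in O) (V2 z * h z).
Proof.
move=> ap aq as_ at_ mh hM h0; have [_ l1 _] := V1x; have [_ l2 _] := V2x.
have [i1 ->] := rect_mul l1 ap aq as_ at_ mh hM h0.
have [i2 ->] := rect_mul l2 ap aq as_ at_ mh hM h0.
rewrite -RintegralB//; apply: Rint_ae; [exact: measurable_funM|exact: ibl_mfun (iblB i1 i2)|].
apply: ae_imp Vt_ae => z ->; have [zr|/h0 ->] := pselect (rect p q s t z); last by rewrite !mulr0 subr0.
have O'z := rect_O ap aq as_ at_ zr; have [_ zS] := (OmegaTE _ _ _ _).1 O'z.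
rewrite /VS indicE mem_setE in_itv/= zS mul1r /V patchE mem_set; last exact: O'O.
by rewrite mulrBl.
Qed.

Let cutoff2_rect (w1 w2 : R -> R) (p q s t : R) z :
  (forall x, ~ (p <= x <= q) -> w1 x = 0) -> (forall x, ~ (s <= x <= t) -> w2 x = 0) ->
  ~ rect p q s t z -> w1 z.1 * w2 z.2 = 0.
Proof.
move=> h1 h2 nz; have [pq|/negP/h1 ->] := boolP (p <= z.1 <= q); last by rewrite mul0r.
have [st|/negP/h2 ->] := boolP (s <= z.2 <= t); last by rewrite mulr0.
by exfalso; apply: nz; rewrite -inE rectE pq.
Qed.

Let cutoff_out_le (p q r x : R) : 0 < r -> p <= q -> ~ (p - r <= x <= q + r) -> cutoff p q r x = 0.
Proof. by move=> r0 pq h; apply: cutoff_out => // /andP[h1 h2]; apply: h; rewrite !ltW. Qed.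

Let dcutoff_out_le (p q r x : R) : 0 < r -> p <= q -> ~ (p - r <= x <= q + r) -> dcutoff p q r x = 0.
Proof. by move=> r0 pq h; apply: dcutoff_out => // /andP[h1 h2]; apply: h; rewrite !ltW. Qed.

Let mtens (w1 w2 : R -> R) : measurable_fun setT w1 -> measurable_fun setT w2 ->
  measurable_fun setT (fun z : R * R => w1 z.1 * w2 z.2).
Proof. by move=> h1 h2; apply: measurable_funM; exact: measurableT_comp. Qed.

Let mindic (p q : R) : measurable_fun setT (\1_(`[p, q]%classic) : measurableTypeR R -> R).
Proof. by []. Qed.

Let v_slices : exists G : R -> Prop,
  {ae leb, forall x, Iab a b x -> G x} /\
  forall x y, x < y -> Iab a b x -> Iab a b y -> G x -> G y ->
    {ae leb, forall t, Iab 0%:E S%:E t ->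
       v (y, t) - v (x, t) = \int[leb]_(s in `]x, y[) Vt (s, t)}.
Proof.
have vsec p q s t r : Iab a b p -> Iab a b q -> testp 0%:E S%:E s t r ->
    ibl leb2 (fun z => \1_(`[p, q]) z.1 * (v z * cutoff s t r z.2)).
  move=> ap aq [r0 st as_ at_].
  have h1 z : `|\1_(`[p, q]) z.1 * cutoff s t r z.2| <= 1.
    by rewrite normrM -[leRHS]mul1r ler_pM// ?indic_le1// cutoff_norm_le1.
  have h2 z : ~ rect p q (s - r) (t + r) z -> \1_(`[p, q]) z.1 * cutoff s t r z.2 = 0.
    apply: cutoff2_rect => x; last exact: cutoff_out_le.
    by rewrite indicE mem_setE in_itv/= => /negP/negbTE ->.
  have [+ _] := v_mul ap aq as_ at_ (mtens (mindic p q) (measurable_cutoff s t r)) h1 h2.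
  by congr (leb2.-integrable _ (_ \o _)); apply/funext => z; ring.
have [||||G [aeG _ inc]] := @weak_slices R a b 0%:E S%:E v Vt.
- by move=> p q s t _ _ _ _; apply: rect_int.
- apply: nearW => x _; apply: ibl_lint.
  exact: (@bounded_supp_ibl R S _ (K (m x)) (mfun_sec1 x mv) (fun t => vm (x, t)) (fun t => @vt x t)).
- move=> s t r tst p q ap aq; apply: ibl_unpatch; first exact: measurable_itv.
  have := ibl_F (vsec p q s t r ap aq tst); congr (leb.-integrable _ (_ \o _)).
  apply/funext => x; rewrite RintZ_indic patchE indicE.
  by case: ifP => _; rewrite ?mul1r ?mul0r.
- move=> p q r s t r' [r0 pq ap aq] tst; have [r'0 st as_ at_] := tst.
  have [M hM] := @dcutoff_bounded R p q r r0.
  have wi : ibl leb2 (fun z => \1_(`[p - r, q + r]) z.1 * (Vt z * cutoff s t r' z.2)).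
    have mc : measurable_fun setT (fun z : R * R => cutoff s t r' z.2).
      by apply: measurableT_comp => //; exact: measurable_cutoff.
    have := @ibl_mulb _ _ _ leb2 1 _ _ mc (fun z => cutoff_norm_le1 z.2 r'0 st) (Vt_loc (p - r) (q + r)).
    by congr (leb2.-integrable _ (_ \o _)); apply/funext => z; ring.
  have cl x := @cutoff_norm_le1 R p q r x r0 pq.
  apply: (etrans (slice_int (vsec _ _ s t r' ap aq tst) (measurable_dcutoff p q r) hM
    (fun x => @dcutoff_out_le p q r x r0 pq))).
  apply: (etrans _ (congr1 -%R (esym (slice_int wi (measurable_cutoff p q r) cl
    (fun x => @cutoff_out_le p q r x r0 pq))))).
  have b1 z : `|dcutoff p q r z.1 * cutoff s t r' z.2| <= M.
    by rewrite normrM -[leRHS]mulr1 ler_pM// cutoff_norm_le1.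
  have b2 z : `|cutoff p q r z.1 * cutoff s t r' z.2| <= 1.
    by rewrite normrM -[leRHS]mulr1 ler_pM// cutoff_norm_le1.
  have s1 z := @cutoff2_rect (dcutoff p q r) (cutoff s t r') _ _ _ _ z
    (fun x => @dcutoff_out_le p q r x r0 pq) (fun x => @cutoff_out_le s t r' x r'0 st).
  have s2 z := @cutoff2_rect (cutoff p q r) (cutoff s t r') _ _ _ _ z
    (fun x => @cutoff_out_le p q r x r0 pq) (fun x => @cutoff_out_le s t r' x r'0 st).
  have [_ ->] := v_mul ap aq as_ at_ (mtens (measurable_dcutoff p q r) (measurable_cutoff s t r')) b1 s1.
  rewrite (Vt_mul ap aq as_ at_ (mtens (measurable_cutoff p q r) (measurable_cutoff s t r')) b2 s2).
  have phiC : Cc_infty O (tensor (cutoff p q r) (cutoff s t r')).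
    by apply: Cc_infty_tensor => // z /(rect_O ap aq as_ at_)/O'O.
  have [_ _ /(_ _ phiC) e1] := V1x; have [_ _ /(_ _ phiC) e2] := V2x.
  have pE (f : R * R -> R) : \int[leb2]_(z in O) (f z * (dcutoff p q r z.1 * cutoff s t r' z.2)) =
      \int[leb2]_(z in O) (f z * px (tensor (cutoff p q r) (cutoff s t r')) z).
    apply: eq_Rintegral => z _; congr (_ * _).
    by rewrite (px_tensor _ (is_derive_cutoff p q r z.1)).
  by rewrite !pE e1 e2 opprB opprK addrC.
by exists G.
Qed.


(* The exponent for which the Riesz composition gives the kernel of order [al]. *)
Let q0 : R := (al - 2) / 2.

Let q0E : q0 + q0 + 1 = al - 1. Proof. by rewrite /q0; field. Qed.

Let q0_gt : -1 < q0. Proof. by move: al0; rewrite /q0 => h; lra. Qed.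

Let q0_lt : q0 < - 2^-1. Proof. by move: al1; rewrite /q0 => h; lra. Qed.

Let c : R := jconst al.

Let c0 : 0 < c. Proof. exact: jconst_gt0. Qed.

Let IabT (x : R) : Iab -oo%E +oo%E x. Proof. by split; rewrite ?ltNyr ?ltry. Qed.

Let Wt (z : R * R) : R := fint q0 S (fun r => Vt (z.1, r)) z.2.

Let Vt_time x t : ~ (0 < t < S) -> Vt (x, t) = 0.
Proof. by move=> /negP/negbTE h; rewrite /Vt /VS [X in _ * (X * _)]indicE mem_setE in_itv/= h mul0r mulr0. Qed.

Let U_loc p q : ibl leb2 (fun z => \1_(`[p, q]) z.1 * U z).
Proof.
have i2 : ibl leb (\1_(`]0, S[) : R -> R) by exact: integrable_indic_itv.
apply: (@ibl_le _ _ _ leb2 _ _ _ _ (ibl_prod (ml p q) i2)).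
  by apply: measurable_funM => //; apply: (@measurableT_comp _ _ _ _ _ _ (\1_(`[p, q]%classic) : measurableTypeR R -> R)).
move=> [x t] /=; rewrite normrM (ger0_norm (indic_ge0 _ _)) -mulrA ler_wpM2l ?indic_ge0//.
rewrite indicE mem_setE in_itv/=.
by have [_|/negP/Ut ->] := boolP (0 < t < S); rewrite ?mulr1 ?normr0 ?mulr0//; exact: (Um (x, t)).
Qed.

Let ki : ibl leb k. Proof. by move: al0 => h; apply: ibl_kcut; lra. Qed.

Let k0 y : 0 <= k y. Proof. exact: kcut_ge0. Qed.

Section time_test.
Variables (s t r : R).
Hypothesis tst : testp 0%:E S%:E s t r.
Local Notation et := (eta k (cutoff s t r)).

Let r0 : 0 < r. Proof. by case: tst. Qed.
Let st : s <= t. Proof. by case: tst. Qed.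

Let ceta : continuous et.
Proof.
have [M [cM dM]] := cutoff_bounds r0 st.
exact: (continuous_eta ki k0 (fun x => cutoff_ge0 x r0 st) (is_derive_cutoff s t r) cM dM).
Qed.

Let eta_bnd : exists M : R, forall x, `|et x| <= M.
Proof.
have [M [cM dM]] := cutoff_bounds r0 st; exists (M * \int[leb]_y k y) => x.
exact: (eta_bounded ki k0 (fun x => cutoff_ge0 x r0 st) (is_derive_cutoff s t r) cM).
Qed.

Let thS x : ~ (0 < x < S) -> cutoff s t r x = 0.
Proof.
case: tst => _ _ [+ _] [_ +]; rewrite !lte_fin => h1 h2 h.
by apply: cutoff_out => // /andP[h3 h4]; apply: h; rewrite (lt_trans h1 h3) (lt_trans h4 h2).
Qed.

Lemma Aint_Wt x : Aint Wt s t r x = \int[leb]_y (Vt (x, y) * et y).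
Proof.
rewrite /Aint /Wt/=; under eq_Rintegral do rewrite mulrC.
rewrite (@fint_adjoint R q0 S q0_gt _ _ 1 (Vt_sec x) (measurable_cutoff s t r)
  (fun y => cutoff_norm_le1 y r0 st)).
by rewrite /eta q0E.
Qed.

Lemma Vt_eta_loc p q : ibl leb2 (fun z => \1_(`[p, q]) z.1 * (Vt z * et z.2)).
Proof.
have [M hM] := eta_bnd.
have me : measurable_fun setT (fun z : R * R => et z.2).
  by apply: measurableT_comp => //; exact: continuous_mfun.
have := @ibl_mulb _ _ _ leb2 M _ _ me (fun z => hM z.2) (Vt_loc p q).
by congr (leb2.-integrable _ (_ \o _)); apply/funext => z; ring.
Qed.

Lemma Vt_identity p q r' : 0 < r' -> p <= q ->
  \int[leb2]_z (Vt z * (dcutoff p q r' z.1 * et z.2)) =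
  - \int[leb2]_z ((c * U z) * (cutoff p q r' z.1 * cutoff s t r z.2)).
Proof.
move=> r'0 pq; have [M [cM dM]] := cutoff_bounds r0 st.
have [i1 e1] := weak_difference al0 al1 (ltW ST) (is_derive_cutoff s t r)
  (@continuous_dcutoff _ s t r) cM dM (fun x => cutoff_ge0 x r0 st) thS T0 u1L u2L id12 r'0 pq.
have mdet : measurable_fun setT (fun z : R * R => dcutoff p q r' z.1 * et z.2).
  by apply: mtens; [exact: measurable_dcutoff|exact: continuous_mfun].
transitivity (\int[leb2]_z (V z * (dcutoff p q r' z.1 * et z.2))).
  apply: Rint_ae; [exact: measurable_funM|exact: ibl_mfun i1|].
  apply: ae_imp Vt_ae => -[x y] ->; rewrite /VS indicE mem_setE in_itv/=.
  have [yS|/negP yS] := boolP (0 < y < S); first by rewrite mul1r.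
  rewrite !mul0r; have [y0|y0] := ltP 0 y; last first.
    by rewrite /V patchE memNset ?mul0r// => /OmegaTE[_ /andP[]]; rewrite /= ltNge y0.
  rewrite (@eta_out _ _ S _ thS) ?mulr0//.
  by rewrite leNgt; apply/negP => yS'; apply: yS; rewrite y0.
rewrite e1 -/c; congr (- _).
have ui : ibl leb2 (fun z => U z * (cutoff p q r' z.1 * cutoff s t r z.2)).
  have mc : measurable_fun setT (fun z : R * R => cutoff p q r' z.1 * cutoff s t r z.2).
    by apply: mtens; exact: measurable_cutoff.
  have b1 (z : R * R) : `|cutoff p q r' z.1 * cutoff s t r z.2| <= 1.
    by rewrite normrM -[leRHS]mulr1 ler_pM// cutoff_norm_le1.
  have := @ibl_mulb _ _ _ leb2 1 _ _ mc b1 (U_loc (p - r') (q + r')).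
  congr (leb2.-integrable _ (_ \o _)); apply/funext => z; rewrite indicE mem_setE in_itv/=.
  have [_|/negP h] := boolP (p - r' <= z.1 <= q + r'); first by rewrite mul1r mulrC.
  by rewrite (cutoff_out_le r'0 pq h) !mul0r mulr0.
under [RHS]eq_Rintegral do rewrite -mulrA.
rewrite RintegralZl//; congr (c * _).
apply: Rint_ae; [|exact: ibl_mfun ui|].
  apply: measurable_funM; last by apply: mtens; exact: measurable_cutoff.
  apply/(measurable_restrictT _ _).1 => //.
  by apply: measurable_funB; [have [] := u1L|have [] := u2L].
apply: ae_imp E_ae => -[x y] zE /=.
have [yS|/negP/thS ->] := boolP (0 < y < S); last by rewrite !mulr0.
congr (_ * _); rewrite /U !patchE.
have [xab|nxab] := pselect (Iab a b x).
  have O'z : O' (x, y) by apply/OmegaTE.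
  have Oz := O'O O'z; rewrite (mem_set Oz) (mem_set (zE O'z)).
  by rewrite /F1 /F2 !patchE (mem_set Oz).
rewrite !memNset//; first by move=> [[[[/OmegaTE[]]]]].
by move=> /OmegaTE[].
Qed.

End time_test.

Let W_slices : exists G : R -> Prop,
  {ae leb, forall x, G x} /\
  forall x y, x < y -> G x -> G y ->
    {ae leb, forall t, Iab 0%:E S%:E t ->
       Wt (y, t) - Wt (x, t) = \int[leb]_(s in `]x, y[) (c * U (s, t))}.
Proof.
have [||||G [aeG _ inc]] := @weak_slices R -oo%E +oo%E 0%:E S%:E Wt (fun z => c * U z).
- move=> p q s t _ _ _ _; apply: rect_int; have := iblZ c (U_loc p q).
  by congr (leb2.-integrable _ (_ \o _)); apply/funext => z; ring.
- by apply: nearW => x _; apply: ibl_lint; exact: (@fint_ibl R q0 S q0_gt _ (Vt_sec x)).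
- move=> s t r tst p q _ _; apply: ibl_unpatch; first exact: measurable_itv.
  have := ibl_F (Vt_eta_loc tst p q); congr (leb.-integrable _ (_ \o _)).
  apply/funext => x; rewrite RintZ_indic patchE indicE (Aint_Wt tst).
  by case: ifP => _; rewrite ?mul1r ?mul0r.
- move=> p q r s t r' [r0 pq _ _] tst; have [r'0 st _ _] := tst.
  have [M hM] := @dcutoff_bounded R p q r r0.
  have cl x := @cutoff_norm_le1 R p q r x r0 pq.
  under eq_Rintegral do rewrite (Aint_Wt tst).
  apply: (etrans (slice_int (Vt_eta_loc tst _ _) (measurable_dcutoff p q r) hM
    (fun x => @dcutoff_out_le p q r x r0 pq))).
  rewrite (Vt_identity tst r0 pq); congr (- _); apply/esym.
  have mc : measurable_fun setT (fun z : R * R => cutoff s t r' z.2).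
    by apply: measurableT_comp => //; exact: measurable_cutoff.
  have ui : ibl leb2 (fun z => \1_(`[p - r, q + r]) z.1 * (c * U z * cutoff s t r' z.2)).
    have := @ibl_mulb _ _ _ leb2 1 _ _ mc (fun z => cutoff_norm_le1 z.2 r'0 st)
      (iblZ c (U_loc (p - r) (q + r))).
    by congr (leb2.-integrable _ (_ \o _)); apply/funext => z; ring.
  exact: (slice_int ui (measurable_cutoff p q r) cl (fun x => @cutoff_out_le p q r x r0 pq)).
exists G; split; first by apply: ae_imp aeG => x /(_ (IabT x)).
by move=> x y xy Gx Gy; exact: (inc _ _ xy (IabT x) (IabT y) Gx Gy).
Qed.

Lemma truncated_eq : {ae leb2, forall z, O' z -> u1 z = u2 z}.
Proof.
have [Gv [aeGv incv]] := v_slices; have [GW [aeGW incW]] := W_slices.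
pose G x := GW x /\ (Iab a b x -> Gv x).
have Gae : {ae leb, forall x, G x} by exact: ae_and aeGW aeGv.
have UV0 : {ae leb2, forall z, U z * v z = 0}.
  have C0 : 0 <= D 1 by rewrite (diffusivity_ge0 hD).
  apply: (@energy_zero R q0 S q0_gt q0_lt a b c U v Vt m K G S0 c0 mU mv Um vm
    (fun x t => @Ut x t) (fun x t => @vt x t) ml Uv0 Vt_loc Gae (fun x _ => Vt_sec x)
    _ _ msq m_out Vt_out (D 1) C0 (Kfun_le hD)).
    move=> x y xy abx aby [_ Gx] [_ Gy].
    apply: ae_imp (incv _ _ xy abx aby (Gx abx) (Gy aby)) => t h.
    have [/andP[t1 t2]|/negP tS] := boolP (0 < t < S).
      by rewrite iiE; apply: h; split; rewrite lte_fin.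
    rewrite !vt// subrr /ii; under eq_Rintegral do rewrite (Vt_time _ tS) mulr0.
    by rewrite Rintegral_cst// mul0r.
  move=> x y xy [Gx _] [Gy _]; apply: ae_imp (incW _ _ xy Gx Gy) => t h /andP[t1 t2].
  have [h1 h2] : Iab 0%:E S%:E t /\ True by split=> //; split; rewrite lte_fin.
  move: (h h1); rewrite /Wt/= => ->; rewrite -(iiE (fun s => c * U (s, t))) iiZ//.
  move=> p q; apply: (@ibl_le _ _ _ leb _ _ _ _ (ml p q)).
    by apply: measurable_funM => //; exact: mfun_sec2.
  by move=> s; rewrite normrM (ger0_norm (indic_ge0 _ _)) ler_wpM2l ?indic_ge0// (Um (s, t)).
by apply: ae_imp (ae_and UV0 E_ae) => z [uv0 zE] O'z; apply: Uv_eq0 => //; exact: zE.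
Qed.

End truncated.

(** The shortened cylinders exhaust the cylinder. *)
Lemma solutions_eq : {ae leb2, forall z, O z -> u1 z = u2 z}.
Proof.
have [g1 g1L w1] := u1t; have [g2 g2L w2] := u2t.
have [m1 [mm1 m1p m1o m1i d1]] := H1_dominated T0 u1L g1L w1.
have [m2 [mm2 m2p m2o m2i d2]] := H1_dominated T0 u2L g2L w2.
pose S (n : nat) : R := T - T / n.+2%:R.
have nT n : 0 < T / n.+2%:R by rewrite divr_gt0.
have S0 n : 0 < S n by rewrite subr_gt0 gtr_pMr// invf_lt1// ltr1n.
have ST n : S n < T by rewrite gtrBl.
have : {ae leb2, forall z, forall n, OmegaT a b (S n) z -> u1 z = u2 z}.
  apply: ae_countable => n.
  exact: (truncated_eq (S0 n) (ST n) mm1 mm2 m1p m2p m1o m2o m1i m2i d1 d2).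
apply: ae_imp => z zn /OmegaTE[abz /andP[z0 zT]].
apply: (zn (Num.truncn (T / (T - z.2)))); apply/OmegaTE; split => //; rewrite z0/= /S.
have d0 : 0 < T - z.2 by rewrite subr_gt0.
rewrite ltrBrDl -ltrBrDr ltr_pdivrMr// mulrC -ltr_pdivrMr//.
by rewrite (lt_trans (truncnS_gt _))// ltr_nat.
Qed.

End uniqueness.

Theorem theorem1 (R : realType) (alpha T : R) (a b : \bar R) (D : R -> R)
    (u0 mu nu : R -> R) (halpha0 : 0 < alpha) (halpha1 : alpha < 1)
    (hT : 0 < T) (hab : (a < b)%E) (hD : diffusivity D)
    (hdata : admissible_data alpha T a b D u0 mu nu)
    (u1 u2 : R * R -> R)
    (hu1 : weak_solution alpha T a b D u0 mu nu u1)
    (hu2 : weak_solution alpha T a b D u0 mu nu u2) :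
  ae_eq leb2 (OmegaT a b T) u1 u2.
Proof.
case: hu1 => -[u1L [_ [ut1 [_ ut1L _ w1]]]] p1 [V1 [x1 id1]].
case: hu2 => -[u2L [_ [ut2 [_ ut2L _ w2]]]] p2 [V2 [x2 id2]].
apply: (@solutions_eq R alpha T a b D u1 u2 V1 V2 halpha0 halpha1 hT hD u1L u2L _ _ p1 p2 x1 x2).
- by exists ut1.
- by exists ut2.
by move=> chi chiT; have [i1 e1] := id1 _ chiT; have [i2 e2] := id2 _ chiT; split=> //; rewrite e1 e2.
Qed.
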